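(* Let $0<\mu<2$ be such that $\theta:=1-\mu>0$. Assume that $m$ is nonincreasing. Let $f:\mathbb H^\mu\times\mathbb H^\mu\to\mathbb H^{-\theta}=\mathbb H^{\mu-1}$ satisfy $f(0,0)=0$, and suppose there are nonnegative functions $L_f,K_f$ on $(0,\infty)$ such that for all $\rho,\rho'>0$ $$\|f(v_1,w_1)-f(v_2,w_2)\|_{\mathbb H^{-\theta}}\le L_f(\rho)\|v_1-v_2\|_{\mathbb H^\mu}+K_f(\rho')\|w_1-w_2\|_{\mathbb H^\mu}$$ whenever $\|v_1\|_{\mathbb H^\mu},\|v_2\|_{\mathbb H^\mu}\le\rho$ and $\|w_1\|_{\mathbb H^\mu},\|w_2\|_{\mathbb H^\mu}\le\rho'$. Suppose that $$\limsup_{\rho\to0}L_f(\rho)=L_f^*,\qquad \limsup_{\rho'\to0}K_f(\rho')=K_f^*,$$ where $L_f^*,K_f^*$ are finite numbers such that $$4\big((L_f^* )^2+(K_f^* )^2\|\ell\|_{L^1(0,T)}^2\big)<\lambda_1.$$ Then there exists $\eta>0$ such that for every $\xi\in\mathbb H^\mu$ with $\|\xi\|_{\mathbb H^\mu}\le\eta$, the problem $$\partial_tu-(1+D_t^{\{m\}})\Delta u=f(u,\mathcal Hu)\ \text{in }\Omega,\ t\in(0,T),\qquad u=0\ \text{on }\partial\Omega,\qquad u(0)=\xi\ \text{in }\Omega,$$ has a unique mild solution $u$ on $[0,T]$. Moreover, $u$ is Hölder continuous on $(0,T]$, in the sense that there is $\gamma\in(0,1)$ with $$\sup_{h>0,\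 t\in(0,T-h]}\frac{t^\gamma\|u(t+h)-u(t)\|_{\mathbb H^\mu}}{h^\gamma}<\infty.$$
   Context: $\Omega\subset\mathbb R^d$ is a bounded domain with smooth boundary, $T>0$, and $\ell\in L^1(0,T)$. $\mathcal H$ is the convolution operator $\mathcal Hv(t)=\int_0^t\ell(t-\tau)v(\tau)\,d\tau$. The operator $D_t^{\{m\}}$ is $D_t^{\{m\}}v(t)=\frac{d}{dt}\int_0^tm(t-s)v(s)\,ds$. Hilbert scales: $\{e_n\}_{n\ge1}$ is an orthonormal basis of $L^2(\Omega)$ of eigenfunctions of the Dirichlet Laplacian $-\Delta$, with eigenvalues $0<\lambda_1\le\lambda_2\le\dots$. For $\varrho\ge0$, $\mathbb H^\varrho=\{\varphi\in L^2(\Omega):\|\varphi\|_{\mathbb H^\varrho}^2=\sum_n\lambda_n^{\varrho}(\varphi,e_n)^2<\infty\}$; $\mathbb H^{-\varrho}$ is the dual of $\mathbb H^\varrho$, with norm $\|\varphi\|_{\mathbb H^{-\varrho}}^2=\sum_n\lambda_n^{-\varrho}\langle\varphi,e_n\rangle^2$. Standing assumption on $m$: $m\in L^1_{loc}(\mathbb R^+)$ is nonnegative and unbounded on $\mathbb R^+$, and $a(t):=1+m(t)$ is completely positive, i.e. for every $\theta_0>0$ the solutions $s,r$ of $s(t)+\theta_0\int_0^ta(t-\tau)s(\tau)d\tau=1$ $(t\ge0)$ and $r(t)+\theta_0\int_0^ta(t-\tau)r(\tau)d\tau=a(t)$ $(t>0)$ are nonnegative. For $\lambda>0$, $\omega(\cdot,\lambda)$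 denotes the solution of $\omega(t)+\lambda\int_0^t(1+m(t-\tau))\omega(\tau)\,d\tau=1$, $t\ge0$. The resolvent operator is $S(t)\xi=\sum_{n\ge1}\omega(t,\lambda_n)\xi_ne_n$, where $\xi_n=(\xi,e_n)$ (for $\xi$ in a space $\mathbb H^{-\varrho}$, $\xi_n=\langle\xi,e_n\rangle$). Mild solution: for $\xi\in\mathbb H^\mu$, a function $u\in C([0,T];\mathbb H^\mu)$ is a mild solution on $[0,T]$ if $u(t)=S(t)\xi+\int_0^tS(t-\tau)f(u(\tau),\mathcal Hu(\tau))\,d\tau$ for all $t\in[0,T]$. *)

(* Defs.v *)
From HB Require Import structures.
From mathcomp Require Import all_boot all_order all_algebra.
From mathcomp Require Import all_classical all_reals all_analysis.

Set Implicit Arguments.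
Unset Strict Implicit.
Unset Printing Implicit Defensive.
Import Order.TTheory GRing.Theory Num.Theory numFieldNormedType.Exports.
Local Open Scope classical_set_scope.
Local Open Scope ring_scope.

(* Lebesgue measure on R^n: first on n.-tuple R by iterated products, then
   transported to row vectors, whose sigma-algebra is generated by the
   coordinates. *)

Section tuple_measure.
Context d (T : measurableType d) (R : realType) (n : nat).
Context (m : {sigma_finite_measure set T -> \bar R}).
Context (nu : {sigma_finite_measure set (n.-tuple T) -> \bar R}).

Definition tuple_cons (x : T * n.-tuple T) : n.+1.-tuple T :=
  [tuple of x.1 :: x.2].

Lemma measurable_tuple_cons : measurable_fun [set: T * n.-tuple T] tuple_cons.
Proof. exact: measurable_cons. Qed.

Definition cons_measure : set (n.+1.-tuple T) -> \bar R :=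
  pushforward (m \x nu)%E tuple_cons.

Let cons_measure0 : cons_measure set0 = 0%E.
Proof. by rewrite /cons_measure /pushforward preimage_set0 measure0. Qed.

Let cons_measure_ge0 A : (0 <= cons_measure A)%E.
Proof. exact: (measure_ge0 (m \x nu)%E). Qed.

Let cons_measure_sigma_additive : semi_sigma_additive cons_measure.
Proof.
move=> F mF tF mUF; rewrite /cons_measure /pushforward preimage_bigcup.
apply: measure_semi_sigma_additive.
- by move=> k; rewrite -[X in measurable X]setTI; exact: measurable_tuple_cons.
- apply/trivIsetP => /= i j _ _ ij; rewrite -preimage_setI.
  by move/trivIsetP : tF => /(_ _ _ _ _ ij) ->//; rewrite preimage_set0.
- rewrite -preimage_bigcup -[X in measurable X]setTI.
  exact: measurable_tuple_cons.
Qed.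

HB.instance Definition _ := isMeasure.Build _ _ _ cons_measure
  cons_measure0 cons_measure_ge0 cons_measure_sigma_additive.

Let cons_measure_sigma_finite : sigma_finite setT cons_measure.
Proof.
pose g (t : n.+1.-tuple T) : T * n.-tuple T := (thead t, [tuple of behead t]).
have mg : measurable_fun setT g.
  apply/measurable_fun_pairP; split.
    exact: (measurable_tnth ord0).
  exact: measurable_behead.
have gK x : g (tuple_cons x) = x.
  case: x => x t; rewrite /g /tuple_cons; congr pair => //.
  exact/val_inj.
have /sigma_finiteP[F [TF ndF Foo]] := sigma_finiteT m.
have /sigma_finiteP[G [TG ndG Goo]] := sigma_finiteT nu.
exists (fun k => g @^-1` (F k `*` G k)).
  rewrite -preimage_bigcup (_ : \bigcup_k _ = setT) ?preimage_setT//.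
  rewrite -setXTT TF TG predeqE => -[x y]; split.
    by move=> [k _ [? ?]]; split; exists k.
  move=> [/= [i _ Fix] [k _ Gky]]; exists (maxn i k) => //; split.
  - by move: x Fix; exact/subsetPset/ndF/leq_maxl.
  - by move: y Gky; exact/subsetPset/ndG/leq_maxr.
move=> k; have [mF Fk] := Foo k; have [mG Gk] := Goo k; split.
  by rewrite -[X in measurable X]setTI; apply: mg => //; exact: measurableX.
rewrite /cons_measure /pushforward -comp_preimage.
rewrite (_ : g \o tuple_cons = id) ?preimage_id; last exact/funext.
by rewrite product_measure1E// lte_mul_pinfty// ge0_fin_numE.
Qed.

HB.instance Definition _ := Measure_isSigmaFinite.Build _ _ _ cons_measure
  cons_measure_sigma_finite.

End tuple_measure.

Section rV_measure.
Context (R : realType).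

Let dirac_nil_sigma_finite :
  sigma_finite [set: 0.-tuple (measurableTypeR R)] (@dirac _ (0.-tuple (measurableTypeR R)) [tuple] R).
Proof.
exists (fun=> setT); first by rewrite bigcup_const.
by move=> _; split => //; rewrite diracT ltry.
Qed.

HB.instance Definition _ := Measure_isSigmaFinite.Build _ _ _
  (@dirac _ (0.-tuple (measurableTypeR R)) [tuple] R) dirac_nil_sigma_finite.

Fixpoint tuple_lebesgue (n : nat) :
    {sigma_finite_measure set (n.-tuple (measurableTypeR R)) -> \bar R} :=
  match n with
  | 0 => [the {sigma_finite_measure set (0.-tuple (measurableTypeR R)) -> \bar R} of
           @dirac _ (0.-tuple (measurableTypeR R)) [tuple] R]
  | k.+1 => [the {sigma_finite_measure set (k.+1.-tuple (measurableTypeR R)) -> \bar R} of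
              cons_measure (@lebesgue_measure R) (tuple_lebesgue k)]
  end.

Definition tuple_of_rV n (x : 'rV[R]_n) : n.-tuple (measurableTypeR R) :=
  [tuple x ord0 i | i < n].

Definition rV_of_tuple n (t : n.-tuple (measurableTypeR R)) : 'rV[R]_n :=
  \row_i tnth t i.

Definition measurable_rV n : set (set 'rV[R]_n) :=
  preimage_set_system setT (@tuple_of_rV n) measurable.

Let measurable_rV_sigma_algebra n : sigma_algebra setT (@measurable_rV n).
Proof. exact/sigma_algebra_preimage/sigma_algebra_measurable. Qed.

Let measurable_rV0 n : @measurable_rV n set0.
Proof. by have [] := @measurable_rV_sigma_algebra n. Qed.

Let measurable_rVC n A : @measurable_rV n A -> @measurable_rV n (~` A).
Proof.
by have [_ h _] := @measurable_rV_sigma_algebra n; rewrite -setTD; exact: h.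
Qed.

Let measurable_rV_bigcup n (F : (set 'rV[R]_n)^nat) :
  (forall i, measurable_rV (F i)) -> measurable_rV (\bigcup_i F i).
Proof. by have [_ _] := @measurable_rV_sigma_algebra n; exact. Qed.

HB.instance Definition _ n := @isMeasurable.Build default_measure_display
  'rV[R]_n (@measurable_rV n) (@measurable_rV0 n) (@measurable_rVC n)
  (@measurable_rV_bigcup n).

Lemma measurable_rV_of_tuple n :
  measurable_fun [set: n.-tuple (measurableTypeR R)] (@rV_of_tuple n).
Proof.
move=> _ _ [B mB <-]; rewrite !setTI -comp_preimage.
rewrite (_ : _ \o _ = id) ?preimage_id//; apply/funext => t /=.
by apply: eq_from_tnth => i; rewrite tnth_mktuple mxE.
Qed.

Definition lebesgue_rV n : set 'rV[R]_n -> \bar R :=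
  pushforward (tuple_lebesgue n) (@rV_of_tuple n).

Let lebesgue_rV0 n : @lebesgue_rV n set0 = 0%E.
Proof. by rewrite /lebesgue_rV /pushforward preimage_set0 measure0. Qed.

Let lebesgue_rV_ge0 n A : (0 <= @lebesgue_rV n A)%E.
Proof. exact: (measure_ge0 (tuple_lebesgue n)). Qed.

Let lebesgue_rV_sigma_additive n : semi_sigma_additive (@lebesgue_rV n).
Proof.
move=> F mF tF mUF; rewrite /lebesgue_rV /pushforward preimage_bigcup.
apply: (measure_semi_sigma_additive (s := tuple_lebesgue n)).
- move=> k; rewrite -[X in measurable X]setTI.
  exact: measurable_rV_of_tuple.
- apply/trivIsetP => /= i j _ _ ij; rewrite -preimage_setI.
  by move/trivIsetP : tF => /(_ _ _ _ _ ij) ->//; rewrite preimage_set0.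
- rewrite -preimage_bigcup -[X in measurable X]setTI.
  exact: measurable_rV_of_tuple.
Qed.

HB.instance Definition _ n := isMeasure.Build _ _ _ (@lebesgue_rV n)
  (@lebesgue_rV0 n) (@lebesgue_rV_ge0 n) (@lebesgue_rV_sigma_additive n).

Lemma lebesgue_rV_box n (a b : 'I_n -> R) : (forall i, a i <= b i) ->
  lebesgue_rV [set x : 'rV[R]_n | forall i, x ord0 i \in `]a i, b i]] =
  (\prod_(i < n) (b i - a i))%:E.
Proof.
move=> ab; rewrite /lebesgue_rV /pushforward.
pose B k (a b : 'I_k -> R) : set (k.-tuple (measurableTypeR R)) :=
  [set t | forall i, (tnth t i : R) \in `]a i, b i]].
have mB k (c d : 'I_k -> R) : measurable (B k c d).
  rewrite (_ : B k c d = \bigcap_(i : 'I_k)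
      ((@tnth k (measurableTypeR R) ^~ i) @^-1` [set` `]c i, d i]])).
    apply: fin_bigcap_measurable => // i _.
    rewrite -[X in measurable X]setTI.
    have mt := @measurable_tnth _ (measurableTypeR R) k i.
    by apply: mt => //; exact: measurable_itv.
  by apply/seteqP; split => [t h i _ /=|t h i]; [exact: h|exact: (h i)].
rewrite (_ : _ @^-1` _ = B n a b); last first.
  by apply/seteqP; split => t h i; have := h i; rewrite mxE.
elim: n a b ab => [|n ih] a b ab.
  by rewrite big_ord0 /= diracE mem_set// => -[].
rewrite big_ord_recl EFinM /= /cons_measure /pushforward.
rewrite (_ : _ @^-1` _ = ([set` `]a ord0, b ord0]] : set (measurableTypeR R)) `*`
    B n (a \o lift ord0) (b \o lift ord0)); last first.
  apply/seteqP; split => [[x t] /= h|[x t] /= [h0 h] i].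
    split; first by have := h ord0; rewrite tnth0.
    by move=> i; have := h (lift ord0 i); rewrite tnthS.
  by case: (unliftP ord0 i) => [j|] ->; rewrite ?tnthS ?tnth0//; exact: (h j).
rewrite product_measure1E; [|exact: (measurable_itv `]a ord0, b ord0])|exact: mB].
rewrite ih; last by move=> i; exact: ab.
congr (_ * _)%E; rewrite [LHS](lebesgue_measure_itv `]a ord0, b ord0]) /= lte_fin.
by case: ltgtP (ab ord0) => // ->; rewrite ?subrr// EFinB.
Qed.

End rV_measure.

Section smoothness.
Context (R : realType) (d : nat).
Implicit Types (U Omega : set 'rV[R]_d) (phi : 'rV[R]_d -> R).

Definition partial (i : 'I_d) phi : 'rV[R]_d -> R :=
  fun x => 'D_(delta_mx ord0 i) phi x.

Fixpoint Ck (k : nat) U phi : Prop :=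
  match k with
  | 0 => forall x, U x -> {for x, continuous phi}
  | k'.+1 => (forall x, U x -> {for x, continuous phi}) /\
      forall i, (forall x, U x -> derivable phi x (delta_mx ord0 i)) /\
                Ck k' U (partial i phi)
  end.

Definition smooth U phi := forall k, Ck k U phi.

(* Omega lies locally on one side of the zero set of a smooth defining
   function with nonvanishing gradient. *)
Definition smooth_boundary Omega :=
  forall x, (closure Omega `\` Omega°) x ->
    exists U phi, [/\ open U, U x, smooth U phi,
      exists i, partial i phi x != 0 &
      forall y, U y -> (Omega y <-> phi y < 0)].

Definition bounded_smooth_domain Omega :=
  [/\ open Omega, connected Omega, Omega !=set0, bounded_set Omega &
      smooth_boundary Omega].

Definition test_function Omega phi :=
  smooth setT phi /\
  exists K, [/\ compact K, K `<=` Omega & forall x, ~ K x -> phi x = 0].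

End smoothness.

(* Elements of L^2(Omega) are represented by functions; two functions stand for
   the same element when their difference has norm 0. *)
Section L2.
Context (R : realType) (d : nat) (Omega : set 'rV[R]_d).
Implicit Types (phi psi : 'rV[R]_d -> R).

Definition L2norm phi : \bar R :=
  ((\int[@lebesgue_rV R d]_(x in Omega) ((phi x) ^+ 2)%:E) `^ 2^-1)%E.

Definition L2 : set ('rV[R]_d -> R) :=
  [set phi | measurable_fun Omega phi /\ (L2norm phi < +oo)%E].

Definition L2inner phi psi : R :=
  \int[@lebesgue_rV R d]_(x in Omega) (phi x * psi x).

Definition L2cvg (phi_ : nat -> 'rV[R]_d -> R) phi :=
  L2norm (phi_ k - phi) @[k --> \oo] --> 0%E.

(* phi belongs to H^1_0(Omega), the closure of the test functions in H^1, and
   has weak gradient g. *)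
Definition H10_gradient phi (g : 'I_d -> 'rV[R]_d -> R) :=
  [/\ L2 phi, forall i, L2 (g i) &
    exists phi_ : nat -> 'rV[R]_d -> R,
      [/\ forall k, test_function Omega (phi_ k), L2cvg phi_ phi &
          forall i, L2cvg (fun k => partial i (phi_ k)) (g i)]].

(* The Dirichlet Laplacian is the operator of the form (grad ., grad .) on
   H^1_0(Omega). *)
Definition dirichlet_eigenfunction (lambda : R) phi :=
  exists2 g, H10_gradient phi g &
    forall psi, test_function Omega psi ->
      \sum_(i < d) L2inner (g i) (partial i psi) = lambda * L2inner phi psi.

Definition orthonormal_basis (e : nat -> 'rV[R]_d -> R) :=
  [/\ forall n, L2 (e n),
      forall n k, L2inner (e n) (e k) = (n == k)%:R &
      forall phi, L2 phi ->
        L2cvg (fun N => \sum_(n < N) L2inner phi (e n) *: e n) phi].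

Definition dirichlet_eigenbasis (lambda : nat -> R)
    (e : nat -> 'rV[R]_d -> R) :=
  [/\ orthonormal_basis e,
      forall n, dirichlet_eigenfunction (lambda n) (e n),
      forall n, 0 < lambda n & {homo lambda : n k / (n <= k)%N >-> n <= k}].

End L2.

Section hilbert_scale.
Context (R : realType) (d : nat) (Omega : set 'rV[R]_d).
Context (lambda : nat -> R) (e : nat -> 'rV[R]_d -> R).

Definition wnorm (rho : R) (c : nat -> R) : \bar R :=
  ((\sum_(n <oo) (lambda n `^ rho * c n ^+ 2)%:E) `^ 2^-1)%E.

Definition coef (phi : 'rV[R]_d -> R) (n : nat) : R := L2inner Omega phi (e n).

Definition Hnorm (rho : R) (phi : 'rV[R]_d -> R) : \bar R :=
  wnorm rho (coef phi).

Definition Hscale (rho : R) : set ('rV[R]_d -> R) :=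
  [set phi | L2 Omega phi /\ (Hnorm rho phi < +oo)%E].

(* H^{-rho}: bounded linear functionals on H^rho; the values of g outside
   Hscale rho are irrelevant. *)
Definition Hdual (rho : R) : set (('rV[R]_d -> R) -> R) :=
  [set g | (forall (a : R) phi psi, Hscale rho phi -> Hscale rho psi ->
              g (a *: phi + psi) = a * g phi + g psi) /\
           exists C : R, forall phi, Hscale rho phi ->
              (`|g phi|%R%:E <= C%:E * Hnorm rho phi)%E].

Definition dcoef (g : ('rV[R]_d -> R) -> R) (n : nat) : R := g (e n).

Definition Hdual_norm (rho : R) (g : ('rV[R]_d -> R) -> R) : \bar R :=
  wnorm (- rho) (dcoef g).

End hilbert_scale.

Section volterra.
Context (R : realType).
Implicit Types (a k m s r v : R -> R).

Definition conv k v (t : R) : R :=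
  \int[@lebesgue_measure R]_(tau in `]0, t[) (k (t - tau) * v tau).

Definition L1loc v := forall b : R, 0 < b ->
  (@lebesgue_measure R).-integrable `]0, b[ (EFin \o v).

Definition volterra_s a (theta : R) s :=
  {within `[0, +oo[, continuous s} /\
  forall t, 0 <= t -> s t + theta * conv a s t = 1.

Definition volterra_r a (theta : R) r :=
  L1loc r /\
  {ae @lebesgue_measure R, forall t, 0 < t -> r t + theta * conv a r t = a t}.

(* For a in L^1_loc both equations have exactly one solution, r being defined
   up to null sets. *)
Definition completely_positive a :=
  forall theta : R, 0 < theta -> exists s r,
    [/\ volterra_s a theta s, volterra_r a theta r,
        forall t, 0 <= t -> 0 <= s t &
        {ae @lebesgue_measure R, forall t, 0 < t -> 0 <= r t}].

Definition kernel_assumption m :=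
  [/\ L1loc m, forall t, 0 < t -> 0 <= m t,
      forall M : R, exists2 t, 0 < t & M < m t &
      completely_positive (fun t => 1 + m t)].

Definition omega m (lambda : R) : R -> R :=
  get (volterra_s (fun t => 1 + m t) lambda).

End volterra.

(* Bochner integral over D of a function R -> V with values in the subspace X
   of V, with respect to the (semi)norm N. *)
Section bochner.
Context (R : realType) (V : lmodType R) (X : set V) (N : V -> \bar R).
Local Notation leb := (@lebesgue_measure R).

(* The list [:: (A_1, x_1); ...] encodes the simple function
   \1_A_1 x_1 + ... *)
Definition simple_fun (l : seq (set R * V)) (t : R) : V :=
  \sum_(p <- l) (\1_(p.1) t : R) *: p.2.

Definition simple_int (D : set R) (l : seq (set R * V)) : V :=
  \sum_(p <- l) fine (leb (D `&` p.1)) *: p.2.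

Definition is_bochner (D : set R) (F : R -> V) (I : V) :=
  [/\ X I,
      {ae leb, forall t, D t -> X (F t)} &
      exists s : nat -> seq (set R * V),
        [/\ forall k p, p \in s k -> measurable p.1 /\ X p.2,
            {ae leb, forall t, D t ->
              N (F t - simple_fun (s k) t) @[k --> \oo] --> 0%E},
            (\int[leb]_(t in D) N (F t - simple_fun (s k) t)%R)%E
              @[k --> \oo] --> 0%E &
            N (I - simple_int D (s k)) @[k --> \oo] --> 0%E]].

Definition bochner (D : set R) (F : R -> V) : V := xget 0 (is_bochner D F).

End bochner.

Section mild_solution.
Context (R : realType) (d : nat) (Omega : set 'rV[R]_d).
Context (lambda : nat -> R) (e : nat -> 'rV[R]_d -> R).
Context (m ell : R -> R) (mu : R).
Local Notation V := ('rV[R]_d -> R).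
Local Notation Hmu := (Hscale Omega lambda e mu).
Local Notation normmu := (Hnorm Omega lambda e mu).

(* S(t) acts on the coefficient sequence of its argument, so that it applies to
   elements of H^rho and of H^{-rho} alike. *)
Definition resolvent (t : R) (c : nat -> R) : V :=
  get [set phi | L2 Omega phi /\
    L2cvg Omega (fun N => \sum_(n < N) (omega m (lambda n) t * c n) *: e n)
      phi].

Definition memory (v : R -> V) (t : R) : V :=
  bochner Hmu normmu `]0, t[ (fun tau => ell (t - tau) *: v tau).

Definition Hcontinuous (T : R) (u : R -> V) :=
  (forall t, t \in `[0, T] -> Hmu (u t)) /\
  forall t0, t0 \in `[0, T] ->
    normmu (u t - u t0) @[t --> within `[0, T] (nbhs t0)] --> 0%E.

Definition mild_solution (T : R) (f : V -> V -> V -> R) (xi : V) (u : R -> V) :=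
  Hcontinuous T u /\
  forall t, t \in `[0, T] ->
    is_bochner Hmu normmu `]0, t[
      (fun tau => resolvent (t - tau) (dcoef e (f (u tau) (memory u tau))))
      (u t - resolvent t (coef Omega e xi)).

Definition holder_quotients (T gamma : R) (u : R -> V) : set (\bar R) :=
  [set z | exists t h : R, [/\ 0 < h, 0 < t, t <= T - h &
    z = ((t `^ gamma / h `^ gamma)%:E * normmu (u (t + h)%R - u t)%R)%E]].

Definition holder_continuous (T : R) (u : R -> V) :=
  exists2 gamma : R, 0 < gamma < 1 &
    (ereal_sup (holder_quotients T gamma u) < +oo)%E.

End mild_solution.

(* Main.v *)
Require Import Defs.
From HB Require Import structures.
From mathcomp Require Import all_boot all_order all_algebra.
From mathcomp Require Import all_classical all_reals all_analysis.
From mathcomp Require Import measurable_realfun ring lra.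
Import Order.TTheory GRing.Theory Num.Theory numFieldNormedType.Exports.
Local Open Scope classical_set_scope.
Local Open Scope ring_scope.

(** Everything is computed on coefficient sequences with respect to (e_n).

    Inverting the Volterra equation with its resolvent kernel r gives
    omega = 1 - lambda \int r, so omega is nonincreasing with values in [0, 1];
    m >= 0 gives lambda \int omega <= 1, and the monotonicity of m gives
    omega(t) - omega(t + h) <= h / t and lambda t omega(t) <= 1, uniformly in
    lambda. The weighted Cauchy-Schwarz inequality turns these kernel bounds
    into H^{-theta} -> H^mu estimates for v |-> \int_0^t S(t - s) v(s) ds: its
    norm is at most lambda_1^{-1/2} for the sup norm in time, whence a
    contraction on a small ball, and O(eps^{1/2}) on time intervals of length
    eps, whence uniqueness among all mild solutions. It maps every bounded v to
    a 1/4-Hoelder function, because the difference of the kernels is at most 1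
    on an interval of length h^{1/2} and at most h^{1/2} outside; so the
    regularity of a mild solution follows from the boundedness of its forcing
    alone.

    A Bochner integral over a bounded interval is determined by its
    coefficients, and exists as soon as the integrand has measurable
    coefficients and an integrable norm bound, here C (t - s)^{-1/2}; the
    Riesz-Fischer theorem synthesizes functions from coefficients. *)

(** * Invariance of Lebesgue measure under the reflection x -> t - x *)

Section lebesgue_reflection.
Context (R : realType).
Local Notation leb := (@lebesgue_measure R).
Local Notation mR := (measurableTypeR R).

(** Since [mu = 1 - theta], passing from H^{-theta} to H^mu costs one power of lambda in the squared
    norms. Pointwise in time, [S(t)] pays for it with a factor t^{-1/2}; integrating that factor
    would give a constant growing with T instead of lambda_1^{-1/2}. Hence the averaging in time:
    one copy of the kernel in Cauchy-Schwarz is spent on lambda_n \int omega_n <= 1, the other is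
    replaced by a majorant common to all n. The majorant is omega(., lambda_1), which is why omega
    has to be shown nonincreasing in lambda. A second obstacle is the choice of representatives:
    elements of L^2 are functions, [resolvent], [memory] and [bochner] return chosen ones, and [f]
    acts on functions. The Lipschitz condition at distance zero shows that the coefficients of
    [f v w] depend only on those of [v] and [w], so a mild solution is the same as a fixed point
    among paths of sequences. Only existence uses the smallness assumption, through the contraction
    constant lambda_1^{-1/2} (L_f(rho) + K_f(rho') |ell|_1); uniqueness and regularity are proved at
    an arbitrary radius. *)

Definition reflect_fun (t : R) : mR -> mR := fun x => (t - x : R).

Lemma measurable_reflect_fun (t : R) (D : set mR) : measurable_fun D (reflect_fun t).
Proof. by apply: (@measurable_funB _ mR R). Qed.

(** Uniqueness of Lebesgue measure: the image measure gives half-open intervals their length, the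
    preimage of []a, b]] being [[t - b, t - a[]. *)
Lemma lebesgue_reflect (t : R) (A : set R) : measurable A ->
  leb (reflect_fun t @^-1` A) = leb A.
Proof.
move=> mA.
have mphi := measurable_reflect_fun t setT.
rewrite -[LHS]/(pushforward leb (reflect_fun t) A).
apply/esym/lebesgue_measure_unique => //= _ [[a b]] _ <-.
rewrite /pushforward /=.
rewrite (_ : _ @^-1` _ = `[t - b, t - a[%classic).
  rewrite !lebesgue_measure_itv /= !lte_fin ltrD2l ltrN2.
  by case: ifP => // _; congr (_%:E); ring.
by apply/seteqP; split => x /=; rewrite /reflect_fun !in_itv /=; lra.
Qed.

Lemma ge0_integral_reflect (t : R) (D : set R) (f : R -> \bar R) : measurable D ->
  measurable_fun D f -> {in D, forall y, 0 <= f y}%E ->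
  (\int[leb]_(x in reflect_fun t @^-1` D) f (t - x)%R = \int[leb]_(x in D) f x)%E.
Proof.
move=> mD mf f0.
have := @ge0_integral_pushforward _ _ _ _ _ _ (measurable_reflect_fun t setT) leb D f mD mf f0.
move=> /= <-; apply: eq_measure_integral => /= [|? A mA _].
  by move=> ? A mA; exact: measurable_reflect_fun.
exact: lebesgue_reflect.
Qed.

(** Positive and negative parts are transported separately, so measurability of [f] suffices. *)
Lemma integral_reflect (t : R) (D : set R) (f : R -> \bar R) : measurable D ->
  measurable_fun D f ->
  (\int[leb]_(x in reflect_fun t @^-1` D) f (t - x)%R = \int[leb]_(x in D) f x)%E.
Proof.
move=> mD mf; rewrite [RHS]integralE [LHS]integralE.
rewrite -(ge0_integral_reflect t D (f^\+)%E mD) //; last first.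
  exact: measurable_funepos.
rewrite -(ge0_integral_reflect t D (f^\-)%E mD) //; last exact: measurable_funeneg.
by rewrite funepos_comp funeneg_comp.
Qed.

Lemma reflect_itv (t a b : R) : reflect_fun t @^-1` `]a, b[ = `]t - b, t - a[%classic.
Proof. by apply/seteqP; split => x /=; rewrite /reflect_fun !in_itv /=; lra. Qed.

Lemma measurable_fun_reflect d (T : measurableType d) (t : R) (D : set R) (f : R -> T) :
  measurable D -> measurable_fun D f ->
  measurable_fun (reflect_fun t @^-1` D) (fun x => f (t - x)).
Proof.
move=> mD mf; apply: (@measurable_comp _ _ _ mR mR T D f _ (reflect_fun t)) => //.
  by move=> x [y + <-].
exact: measurable_reflect_fun.
Qed.

Lemma integrable_reflect (t : R) (D : set R) (f : R -> \bar R) : measurable D ->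
  leb.-integrable D f ->
  leb.-integrable (reflect_fun t @^-1` D) (fun x => f (t - x)).
Proof.
move=> mD /integrableP[mf f1]; apply/integrableP; split.
  exact: measurable_fun_reflect.
rewrite (ge0_integral_reflect t D (fun x => `|f x|)%E mD) //.
exact: measurableT_comp.
Qed.

Lemma measurable_fun_reflect_itv (t : R) (f : R -> R) :
  measurable_fun `]0, t[ f -> measurable_fun `]0, t[ (fun x => f (t - x)).
Proof.
move=> mf; have := measurable_fun_reflect _ _ t _ f _ mf.
rewrite reflect_itv subr0 subrr; exact.
Qed.

Lemma integrable_reflect_itv (t : R) (f : R -> R) :
  leb.-integrable `]0, t[ (EFin \o f) ->
  leb.-integrable `]0, t[ (EFin \o (fun x => f (t - x))).
Proof.
move=> mf; have := integrable_reflect t _ _ _ mf.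
by rewrite reflect_itv subr0 subrr; exact.
Qed.

Lemma Rintegral_reflect_itv (t : R) (f : R -> R) : measurable_fun `]0, t[ f ->
  \int[leb]_(x in `]0, t[) f (t - x) = \int[leb]_(x in `]0, t[) f x.
Proof.
move=> mf; have := integral_reflect t `]0, t[ (EFin \o f) _ _.
rewrite reflect_itv subr0 subrr /Rintegral /= => -> //.
exact/measurable_EFinP.
Qed.

End lebesgue_reflection.

(** * Convolution on the whole line *)

Section convolution.
Context (R : realType).
Local Notation leb := (@lebesgue_measure R).
Local Notation mR := (measurableTypeR R).
Implicit Types K A S : R -> R.

(** Truncated convolutions are reduced to this one by extending both factors by zero. Fubini is then
    applied on the whole plane and no triangular domain occurs. *)
Definition fconv K A (t : R) : R := \int[leb]_x (K (t - x) * A x).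

Lemma measurable_fconv_kernel K A : measurable_fun setT K -> measurable_fun setT A ->
  measurable_fun [set: mR * mR] (fun p => K (p.1 - p.2) * A p.2 : R).
Proof.
move=> mK mA; apply: (@measurable_funM _ _ R).
- apply: (@measurableT_comp _ _ _ (mR * mR)%type mR R K _ (fun p => p.1 - p.2 : R) mK).
  by apply: (@measurable_funB _ _ R); [exact: measurable_fst|exact: measurable_snd].
- exact: (@measurableT_comp _ _ _ (mR * mR)%type mR R A _ snd mA measurable_snd).
Qed.

Lemma measurable_fconv K A : measurable_fun setT K -> measurable_fun setT A ->
  measurable_fun setT (fconv K A).
Proof.
move=> mK mA; apply: (@measurableT_comp _ _ _ _ _ _ fine) => //.
have mf : measurable_fun [set: mR * mR] (fun p => (K (p.1 - p.2) * A p.2 : R)%:E).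
  by apply/measurable_EFinP; exact: measurable_fconv_kernel.
set f := (fun p : mR * mR => _%:E) in mf.
rewrite (_ : (fun t => _) = (fun x => \int[leb]_y f^\+ (x, y) - \int[leb]_y f^\- (x, y)))%E; last first.
  apply/funext => x; rewrite [LHS]integralE.
  by rewrite -[LHS]/((\int[leb]_y (f \o pair x)^\+ y - \int[leb]_y (f \o pair x)^\- y)%E) funepos_comp funeneg_comp.
apply: emeasurable_funB; apply: (@measurable_fun_fubini_tonelli_F _ _ mR mR R leb).
- exact: measurable_funepos.
- by [].
- exact: measurable_funeneg.
- by [].
Qed.

Lemma integral_reflectT (t : R) (f : R -> \bar R) : measurable_fun setT f ->
  (\int[leb]_x f (t - x)%R = \int[leb]_x f x)%E.
Proof. by move=> mf; have := integral_reflect R t setT f measurableT mf; rewrite preimage_setT. Qed.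

Lemma fconvC K A : measurable_fun setT K -> measurable_fun setT A -> fconv K A =1 fconv A K.
Proof.
move=> mK mA t; rewrite /fconv /Rintegral; congr fine.
rewrite -(integral_reflectT t) /=.
  by apply: eq_integral => x _; congr (_%:E); rewrite mulrC; congr (A _ * K _); ring.
apply/measurable_EFinP/measurable_funM => //.
apply: (@measurableT_comp _ _ _ mR mR R K _ (fun x => t - x : R) mK).
exact: (measurable_reflect_fun R t setT).
Qed.

Lemma integrable_reflectT (t : R) (f : R -> R) : leb.-integrable setT (EFin \o f) ->
  leb.-integrable setT (EFin \o (fun x => f (t - x))).
Proof. by move=> mf; have := integrable_reflect R t setT _ measurableT mf; rewrite preimage_setT. Qed.

(** Fubini with the majorant M |K(t - x)| |A(x - y)|. Boundedness of [S] makes this majorant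
    integrable for every [t], so the identity holds everywhere and not only almost everywhere. *)
Lemma fconvA K A S (M t : R) : leb.-integrable setT (EFin \o K) ->
  leb.-integrable setT (EFin \o A) -> measurable_fun setT S ->
  (forall x, `|S x| <= M) ->
  fconv K (fconv A S) t = fconv (fconv K A) S t.
Proof.
move=> iK iA mS SM.
have mK : measurable_fun setT K by apply/measurable_EFinP; exact: measurable_int iK.
have mA : measurable_fun setT A by apply/measurable_EFinP; exact: measurable_int iA.
have mKr x : measurable_fun [set: R] (fun y : R => K (x - y)).
  by apply/measurable_EFinP; exact: (measurable_int _ (integrable_reflectT x _ iK)).
have mAr x : measurable_fun [set: R] (fun y : R => A (x - y)).
  by apply/measurable_EFinP; exact: (measurable_int _ (integrable_reflectT x _ iA)).
have mAS x : measurable_fun [set: R] (fun y : R => A (x - y) * S y) by exact: measurable_funM.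
have M0 : 0 <= M by exact: le_trans (SM 0).
pose f (p : mR * mR) := (K (t - p.1) * (A (p.1 - p.2) * S p.2))%:E.
have mf : measurable_fun setT f.
  apply/measurable_EFinP/measurable_funM; last exact: measurable_fconv_kernel.
  by apply: (@measurableT_comp _ _ _ (mR * mR)%type mR R _ _ fst (mKr t)).
have iAS x : leb.-integrable setT (fun y => (A (x - y) * S y)%:E).
  apply: (@le_integrable _ mR R leb setT measurableT _ (fun y => M%:E * (A (x - y))%:E)%E).
  - by apply/measurable_EFinP; exact: mAS.
  - by move=> y _; rewrite -EFinM !abse_EFin lee_fin !normrM mulrC ler_wpM2r// (le_trans (SM _)) ?ler_norm.
  - by apply: integrableZl => //; exact: (integrable_reflectT x _ iA).
have ASM x : (\int[leb]_y `|A (x - y) * S y|%:E <= M%:E * \int[leb]_y `|A y|%:E)%E.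
  rewrite -(integral_reflectT x (fun y => `|A y|%:E)); last exact/measurable_EFinP/measurableT_comp.
  rewrite -ge0_integralZl//=; last first.
    by apply/measurable_EFinP/measurableT_comp => //; exact: mAr.
  apply: ge0_le_integral => //=.
  - by apply/measurable_EFinP/measurableT_comp => //; exact: mAS.
  - apply: emeasurable_funM => //; apply/measurable_EFinP/measurableT_comp => //; exact: mAr.
  - by move=> y _; rewrite -EFinM lee_fin normrM mulrC ler_wpM2r.
have iAlt : (\int[leb]_y `|A y|%:E < +oo)%E by move/integrableP : iA => [].
have jf : (leb \x leb)%E.-integrable setT f.
  apply/integrable12ltyP => //.
  apply: (@le_lt_trans _ _ (\int[leb]_x ((M * fine (\int[leb]_y `|A y|%:E))%:E * `|K (t - x)|%:E)))%E.
    apply: ge0_le_integral => //=.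
    - by move=> x _; exact: integral_ge0.
    - apply: (@measurable_fun_fubini_tonelli_F _ _ mR mR R leb (fun p => `|f p|%E)) => //.
      exact: measurableT_comp.
    - by apply: emeasurable_funM => //; apply/measurable_EFinP/measurableT_comp => //; exact: mKr.
    - move=> x _; rewrite -EFinM mulrC EFinM.
      under eq_integral do rewrite normrM EFinM.
      rewrite ge0_integralZl//=; last first.
        by apply/measurable_EFinP/measurableT_comp => //; exact: mAS.
      rewrite lee_wpmul2l// (le_trans (ASM x))// EFinM fineK// ge0_fin_numE//.
      exact: integral_ge0.
  rewrite ge0_integralZl//=.
  - rewrite lte_mul_pinfty//.
      by rewrite lee_fin mulr_ge0// fine_ge0// integral_ge0.
    have /integrableP[_] := integrable_reflectT t _ iK.
    by [].
  - by apply/measurable_EFinP/measurableT_comp => //; exact: mKr.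
  - by rewrite lee_fin mulr_ge0// fine_ge0// integral_ge0.
have := @Fubini _ _ mR mR R leb leb f jf.
rewrite /fconv /Rintegral /f /= => FUB.
transitivity (fine (\int[leb]_x \int[leb]_y (K (t - x) * (A (x - y) * S y))%:E)%E).
  congr fine; apply: eq_integral => x _.
  under [RHS]eq_integral do rewrite EFinM.
  rewrite integralZl//.
  rewrite EFinM fineK//; exact: integrable_fin_num.
rewrite FUB; congr fine; apply: ae_eq_integral => //.
- exact: (measurable_fubini_G jf).
- apply/measurable_EFinP/measurable_funM => //.
  apply: (@measurableT_comp _ _ _ mR mR R _ _ (fun x => t - x : R) (measurable_fconv K A mK mA)).
  exact: (measurable_reflect_fun R t setT).
have := ae_integrable2 jf; apply: filterS => y /= iy _.
(* Fubini gives integrability of the section only together with the factor [S y]; the factor is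
   divided out when it is nonzero, and otherwise both sides vanish. *)
have [Sy0|Sy0] := eqVneq (S y) 0.
  rewrite Sy0 mulr0; under eq_integral do rewrite !mulr0.
  exact: integral0.
have -> : (\int[leb]_x (K (t - y - x) * A x)%:E = \int[leb]_x (K (t - x) * A (x - y))%:E)%E.
  rewrite -(integral_reflectT (t - y)) /=; last first.
    by apply/measurable_EFinP/measurable_funM => //; exact: mKr.
  rewrite -[RHS](integral_reflectT t) /=.
    by apply: eq_integral => x _; congr ((K _ * A _)%:E); ring.
  apply/measurable_EFinP/measurable_funM => //.
  have -> : (fun x => A (x - y)) = (fun x => A (- y - x)) \o (fun x => 0 - x).
    by apply/funext => x /=; congr A; ring.
  apply: (@measurableT_comp _ _ _ mR mR R _ _ (fun x => 0 - x : R) (mAr (- y))).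
  exact: (measurable_reflect_fun R 0 setT).
have iKA : leb.-integrable setT (fun x => (K (t - x) * A (x - y))%:E).
  have := integrableZl measurableT (S y)^-1 iy; apply: eq_integrable => // x _ /=.
  by rewrite -EFinM /f/=; congr (_%:E); field.
rewrite EFinM fineK; last exact: integrable_fin_num.
rewrite -integralZr//; apply: eq_integral => x _; rewrite -EFinM; congr (_%:E); ring.
Qed.

End convolution.

(** * Convolution on (0, t) and inversion of Volterra equations *)

Section convolution_half_line.
Context (R : realType).
Local Notation leb := (@lebesgue_measure R).
Local Notation mR := (measurableTypeR R).
Local Notation conv := (@Defs.conv R).
Implicit Types k v a s r h : R -> R.

Lemma ae_leb_imply (P Q : R -> Prop) : (forall x, P x -> Q x) ->
  {ae leb, forall x, P x} -> {ae leb, forall x, Q x}.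
Proof. exact: (@filterS _ _ (ae_filter_ringOfSetsType leb)). Qed.

(** The cut-off [b] may exceed [t] because the extension of [k] vanishes at t - x for x >= t. One
    cut-off thus serves all t <= b, which yields measurability in [t] and associativity from the
    whole line. *)
Lemma conv_fconv k v (t b : R) : t <= b ->
  conv k v t = fconv R (k \_ `]0, b[) (v \_ `]0, b[) t.
Proof.
move=> tb; rewrite /conv /fconv Rintegral_mkcond; apply: eq_Rintegral => x _.
rewrite !patchE; have [xt|xt] := boolP (x \in `]0, t[%classic).
  have := xt; rewrite inE /= in_itv /= => /andP[x0 x1].
  by rewrite !mem_set //= in_itv /=; lra.
have [xb|xb] := boolP (x \in `]0, b[%classic); last by rewrite mulr0.
have [tx|tx] := boolP (t - x \in `]0, b[%classic); last by rewrite mul0r.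
move: xt xb tx; rewrite !inE /= !in_itv /= => /negP xt /andP[x0 xb] /andP[tx0 txb].
by exfalso; apply: xt; rewrite inE /= in_itv /=; lra.
Qed.

Lemma measurable_patch0 (f : R -> R) (D : set R) : measurable D ->
  measurable_fun D f -> measurable_fun [set: R] (f \_ D).
Proof. by move=> mD mf; apply/(measurable_restrictT _ _).1. Qed.

Lemma integrable_patch0 (f : R -> R) (D : set R) : measurable D ->
  leb.-integrable D (EFin \o f) -> leb.-integrable setT (EFin \o (f \_ D)).
Proof.
move=> mD fi; rewrite -restrict_EFin.
by apply/integrable_restrict => //=; rewrite setTI.
Qed.

Lemma measurable_conv k v (b : R) : measurable_fun `]0, b[ k ->
  measurable_fun `]0, b[ v -> measurable_fun `]0, b[ (conv k v).
Proof.
move=> mk mv; apply: (@eq_measurable_fun _ _ _ _ _ (fconv R (k \_ `]0, b[) (v \_ `]0, b[))).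
  by move=> x; rewrite inE /= in_itv /= => /andP[_ xb]; rewrite (@conv_fconv _ _ _ b)// ltW.
apply: measurable_funTS; apply: measurable_fconv; exact: measurable_patch0.
Qed.

Lemma convC k v (t : R) : measurable_fun `]0, t[ k -> measurable_fun `]0, t[ v ->
  conv k v t = conv v k t.
Proof.
move=> mk mv; rewrite !(@conv_fconv _ _ _ t)//; apply: fconvC; exact: measurable_patch0.
Qed.

Lemma convA k a s (M t : R) : leb.-integrable `]0, t[ (EFin \o k) ->
  leb.-integrable `]0, t[ (EFin \o a) -> measurable_fun `]0, t[ s ->
  0 <= M -> (forall x, x \in `]0, t[ -> `|s x| <= M) ->
  conv k (conv a s) t = conv (conv k a) s t.
Proof.
move=> ik ia ms M0 sM.
rewrite (@conv_fconv _ _ t t)// [RHS](@conv_fconv _ _ t t)//.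
transitivity (fconv R (k \_ `]0, t[) (fconv R (a \_ `]0, t[) (s \_ `]0, t[)) t).
  apply: eq_Rintegral => x _; rewrite [in LHS]patchE [in RHS]patchE.
  have [tx|tx] := boolP (t - x \in `]0, t[%classic); last by rewrite !mul0r.
  move: tx; rewrite inE /= in_itv /= => /andP[tx0 tx1].
  rewrite patchE ifT; last by rewrite inE /= in_itv /=; lra.
  by rewrite -(@conv_fconv a s)//; lra.
rewrite (@fconvA _ _ _ _ M).
- apply: eq_Rintegral => x _; rewrite [in RHS]patchE.
  have [xt|xt] := boolP (x \in `]0, t[%classic); last first.
    by rewrite (_ : (s \_ _) x = 0) ?mulr0// patchE ifF// (negbTE xt).
  move: (xt); rewrite inE /= in_itv /= => /andP[x0 x1].
  rewrite [in RHS]patchE ifT; last by rewrite inE /= in_itv /=; lra.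
  rewrite (@conv_fconv k a (t - x) t); last by lra.
  by rewrite [in LHS]patchE.
- exact: integrable_patch0.
- exact: integrable_patch0.
- exact: measurable_patch0.
- move=> x; rewrite patchE; case: ifP => [|_]; last by rewrite normr0.
  by rewrite inE => ?; exact: sM.
Qed.

Lemma integrable_conv k v (M t : R) : leb.-integrable `]0, t[ (EFin \o k) ->
  measurable_fun `]0, t[ v -> (forall x, x \in `]0, t[ -> `|v x| <= M) ->
  leb.-integrable `]0, t[ (fun x => (k (t - x) * v x)%:E).
Proof.
move=> ik mv vM.
have ikt : leb.-integrable `]0, t[ (EFin \o (fun x => k (t - x))) by exact: integrable_reflect_itv.
apply: (@le_integrable _ mR R leb _ _ _ (fun y => M%:E * (k (t - y))%:E)%E) => //.
- apply/measurable_EFinP/measurable_funM => //; apply/measurable_EFinP.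
  exact: (measurable_int _ ikt).
- move=> x x0t; rewrite -EFinM !abse_EFin lee_fin !normrM mulrC ler_wpM2r//.
  by rewrite (le_trans (vM _ _))// ler_norm.
- exact: integrableZl.
Qed.

Lemma ae_eq_conv k k' v (t : R) : measurable_fun `]0, t[ k ->
  measurable_fun `]0, t[ k' -> measurable_fun `]0, t[ v ->
  {ae leb, forall x, 0 < x -> x < t -> k x = k' x} -> conv k v t = conv k' v t.
Proof.
move=> mk mk' mv kk'; rewrite convC// [RHS]convC// /conv /Rintegral; congr fine.
have mvt := measurable_fun_reflect_itv _ _ _ mv.
apply: ae_eq_integral => //; try by apply/measurable_EFinP/measurable_funM.
apply: ae_leb_imply kk' => x /= kk'; rewrite in_itv /= => /andP[x0 xt].
by rewrite kk'.
Qed.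

(** With * for convolution, r * h = r * s + lam r * a * s = (r + lam a * r) * s = a * s, so the
    solution is s = h - lam r * h: it is expressed by the resolvent kernel [r] and the right-hand
    side alone. *)
Lemma volterra_inversion a r s h (lam M t : R) : 0 < lam -> 0 <= M ->
  leb.-integrable `]0, t[ (EFin \o a) -> leb.-integrable `]0, t[ (EFin \o r) ->
  {ae leb, forall x, 0 < x -> r x + lam * conv a r x = a x} ->
  measurable_fun `]0, t[ s -> measurable_fun `]0, t[ h ->
  (forall x, x \in `]0, t[ -> `|s x| <= M) ->
  (forall x, x \in `]0, t[ -> `|h x| <= M) ->
  (forall x, x \in `]0, t[ -> s x + lam * conv a s x = h x) ->
  conv r h t = conv a s t.
Proof.
move=> lam0 M0 ia ir rE ms mh sM hM sE.
have ma : measurable_fun `]0, t[ a by apply/measurable_EFinP; exact: measurable_int ia.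
have mr : measurable_fun `]0, t[ r by apply/measurable_EFinP; exact: measurable_int ir.
(* On []0, t[] this is the convolution of [a] and [s], by the equation for [s]; in this form it is
   visibly bounded and measurable. *)
pose g x := lam^-1 * (h x - s x).
have gE x : x \in `]0, t[ -> conv a s x = g x.
  by move=> xt; rewrite /g -(sE x xt) addrC addKr mulKf// gt_eqF.
have gM x : x \in `]0, t[ -> `|g x| <= lam^-1 * (M + M).
  move=> xt; rewrite /g normrM gtr0_norm ?invr_gt0// ler_pM2l ?invr_gt0//.
  by rewrite (le_trans (ler_normB _ _))// lerD ?hM ?sM.
have mg : measurable_fun `]0, t[ g by apply: measurable_funM => //; exact: measurable_funB.
have -> : conv r h t = conv r s t + lam * conv r g t.
  rewrite /conv -RintegralZl//=; last by apply: integrable_conv mg gM.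
  rewrite -RintegralD//=.
  - apply: eq_Rintegral => x; rewrite inE /= => xt.
    by rewrite -(sE x xt) (gE _ xt); ring.
  - exact: integrable_conv sM.
  - have := integrableZl _ lam (integrable_conv r g _ t ir mg gM).
    by move=> /(_ (measurable_itv _)); apply: eq_integrable.
have -> : conv r g t = conv r (conv a s) t.
  by apply: eq_Rintegral => x; rewrite inE /= => xt; rewrite gE.
rewrite (convA _ _ _ M)//.
(* The equation for [r] is known almost everywhere only, which is enough under the outer
   integral. *)
have -> : conv (conv r a) s t = conv (fun x => lam^-1 * (a x - r x)) s t.
  apply: ae_eq_conv => //.
  - exact: measurable_conv.
  - by apply: measurable_funM => //; exact: measurable_funB.
  apply: ae_leb_imply rE => x /= rE x0 xt.
  have xtS : `]0, x[ `<=` `]0, t[ by apply: subset_itvl; rewrite bnd_simp ltW.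
  rewrite convC; [|exact: measurable_funS mr|exact: measurable_funS ma].
  by rewrite -[in RHS](rE x0) addrC addKr mulKf// gt_eqF.
rewrite /conv -RintegralZl//=.
  rewrite -RintegralD//=.
  - apply: eq_Rintegral => x _; field; by rewrite gt_eqF.
  - exact: integrable_conv sM.
  - have iar : leb.-integrable `]0, t[ (EFin \o (fun x => a x - r x)).
      by have := integrableB _ ia ir; exact.
    have := integrable_conv _ _ _ t iar ms sM; apply: eq_integrable => // x _ /=.
    by congr (_%:E); field; rewrite gt_eqF.
have iar : leb.-integrable `]0, t[ (EFin \o (fun x => a x - r x)).
  by have := integrableB _ ia ir; exact.
have := integrableZl _ lam^-1 (integrable_conv _ _ _ t iar ms sM).
move=> /(_ (measurable_itv _)); apply: eq_integrable => // x _ /=.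
by rewrite -EFinM; congr (_%:E); field; rewrite gt_eqF.
Qed.

End convolution_half_line.

(** * Bounds and monotonicity of the scalar resolvent function [omega] *)

Section omega_properties.
Context (R : realType).
Local Notation leb := (@lebesgue_measure R).
Local Notation mR := (measurableTypeR R).
Local Notation conv := (@Defs.conv R).

Lemma Rintegral_ae_ge0 (D : set R) (f : R -> R) : measurable D ->
  measurable_fun D f -> {ae leb, forall x, D x -> 0 <= f x} ->
  0 <= \int[leb]_(x in D) f x.
Proof.
move=> mD mf f0; rewrite /Rintegral.
rewrite (@ae_eq_integral _ _ _ leb D (fun x => `|f x|%:E))//.
- by apply: fine_ge0; exact: integral_ge0.
- exact/measurable_EFinP.
- exact/measurable_EFinP/measurableT_comp.
- by apply: ae_leb_imply f0 => x /= f0 Dx; rewrite ger0_norm// f0.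
Qed.

Lemma leb_integrableZ (D : set R) (k : R) (f : R -> R) : measurable D ->
  leb.-integrable D (EFin \o f) -> leb.-integrable D (EFin \o (fun x => k * f x)).
Proof. by move=> mD fi; have := @integrableZl _ mR R leb D mD k _ fi; apply: eq_integrable. Qed.

Lemma leb_integrableB (D : set R) (f g : R -> R) : measurable D ->
  leb.-integrable D (EFin \o f) -> leb.-integrable D (EFin \o g) ->
  leb.-integrable D (EFin \o (fun x => f x - g x)).
Proof. by move=> mD fi gi; have := @integrableB _ mR R leb D mD _ _ fi gi; apply: eq_integrable. Qed.

Lemma leb_integrableD (D : set R) (f g : R -> R) : measurable D ->
  leb.-integrable D (EFin \o f) -> leb.-integrable D (EFin \o g) ->
  leb.-integrable D (EFin \o (fun x => f x + g x)).
Proof. by move=> mD fi gi; have := @integrableD _ mR R leb D mD _ _ fi gi; apply: eq_integrable. Qed.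

Lemma lebesgue_itv_lty (x y : R) (b0 b1 : bool) :
  (leb [set` Interval (BSide b0 x) (BSide b1 y)] < +oo)%E.
Proof. by rewrite lebesgue_measure_itv /=; case: ifP => _; rewrite ?ltry. Qed.

Lemma integrable_bounded (D : set R) (f : R -> R) (M : R) : measurable D ->
  (leb D < +oo)%E -> measurable_fun D f -> (forall x, D x -> `|f x| <= M) ->
  leb.-integrable D (EFin \o f).
Proof.
move=> mD D1 mf fM; apply: (@measurable_bounded_integrable _ mR R leb f D) => //.
exists M; split; first by rewrite num_real.
by move=> N MN x Dx /=; rewrite (le_trans (fM _ Dx))// ltW.
Qed.

Lemma leb_integrable_cst (x y : R) (b0 b1 : bool) (k : R) :
  leb.-integrable [set` Interval (BSide b0 x) (BSide b1 y)] (EFin \o (fun=> k)).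
Proof.
apply: (integrable_bounded _ _ `|k|) => //.
exact: lebesgue_itv_lty.
Qed.

Lemma ge0_subset_Rintegral (A D : set R) (f : R -> R) : measurable A -> measurable D ->
  leb.-integrable D (EFin \o f) -> (forall x, D x -> 0 <= f x) -> A `<=` D ->
  \int[leb]_(x in A) f x <= \int[leb]_(x in D) f x.
Proof.
move=> mA mD fi f0 AD; apply: fine_le.
- by apply: integrable_fin_num => //; exact: integrableS fi.
- exact: integrable_fin_num.
- apply: ge0_subset_integral => //; exact: measurable_int fi.
Qed.

Lemma Rintegral_split (f : R -> R) (t a : R) : 0 <= a -> a <= t ->
  leb.-integrable `]0, t[ (EFin \o f) ->
  \int[leb]_(s in `]0, t[) f s = (\int[leb]_(s in `]0, a[) f s) + \int[leb]_(s in `]a, t[) f s.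
Proof.
move=> a0 at_ fi.
have [->|a_neq0] := eqVneq a 0.
  by rewrite [X in _ = Rintegral _ X _ + _]set_itv_ge ?bnd_simp ?ltxx// Rintegral_set0 add0r.
have a_gt0 : 0 < a by rewrite lt_neqAle eq_sym a_neq0.
have tE : `]0, t[%classic = `]0, a[%classic `|` `[a, t[%classic :> set R.
  by rewrite -itv_bndbnd_setU// bnd_simp.
rewrite {1}tE Rintegral_setU//=; last 2 first.
- by rewrite -tE.
- by apply/disj_setPS => x /= []; rewrite !in_itv /=; lra.
congr (_ + _); rewrite Rintegral_itv_obnd_cbnd//.
by apply: integrableS fi => //; apply: subset_itv; rewrite bnd_simp.
Qed.

Lemma within_continuous_itv (f : R -> R) (t : R) : {within `[0, +oo[, continuous f} ->
  {within `[0, t], continuous f}.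
Proof.
apply: continuous_subspaceW => x /=; rewrite !in_itv /= => /andP[-> _] //.
Qed.

Lemma within_continuous_measurable (f : R -> R) (t : R) :
  {within `[0, t], continuous f} -> measurable_fun `]0, t[ f.
Proof.
move=> cf; apply: (@measurable_funS _ _ _ _ `[0, t]) => //.
  by apply: subset_itv; rewrite bnd_simp.
by apply: subspace_continuous_measurable_fun.
Qed.

Lemma within_continuous_bounded (f : R -> R) (t : R) :
  {within `[0, t], continuous f} ->
  exists2 M : R, 0 <= M & forall x, x \in `[0, t] -> `|f x| <= M.
Proof.
have [t0|t0] := leP 0 t; last first.
  by exists 0 => // x; rewrite in_itv /=; lra.
move=> cf.
have [c _ cM] := EVT_max t0 cf.
have [c' _ cm] := EVT_min t0 cf.
exists (`|f c| + `|f c'|); first by rewrite addr_ge0.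
move=> x xt; have := cM x xt; have := cm x xt => h1 h2.
rewrite ler_norml; have := ler_norm (f c); have := ler_norm (- f c'); rewrite normrN.
have := normr_ge0 (f c); have := normr_ge0 (f c'); lra.
Qed.

Context (m : R -> R) (hm : kernel_assumption m).
Let a (t : R) : R := 1 + m t.

Lemma kernel_L1loc : L1loc a.
Proof.
move=> b b0; have [m1 _ _ _] := hm.
by apply: leb_integrableD; [|exact: leb_integrable_cst|exact: m1].
Qed.

Lemma kernel_ge1 (t : R) : 0 < t -> 1 <= a t.
Proof. by move=> t0; have [_ m0 _ _] := hm; rewrite /a lerDl m0. Qed.

Lemma kernel_integrable (t : R) : leb.-integrable `]0, t[ (EFin \o a).
Proof.
have [t0|t0] := ltP 0 t; first exact: kernel_L1loc.
by rewrite set_itv_ge ?bnd_simp -?leNgt//; exact: integrable_set0.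
Qed.

Lemma L1loc_integrable (r : R -> R) (t : R) : L1loc r -> leb.-integrable `]0, t[ (EFin \o r).
Proof.
move=> rL; have [t0|t0] := ltP 0 t; first exact: rL.
by rewrite set_itv_ge ?bnd_simp -?leNgt//; exact: integrable_set0.
Qed.

Lemma integrable_measurable (r : R -> R) (D : set R) : leb.-integrable D (EFin \o r) ->
  measurable_fun D r.
Proof. by move=> ir; apply/measurable_EFinP; exact: measurable_int ir. Qed.

(** The inversion formula for the right-hand side 1. As [s] does not occur in the integral, the
    formula also shows that [s] is unique. *)
Lemma volterra_s_resolvent (lam : R) (s r : R -> R) (t : R) : 0 < lam ->
  volterra_s a lam s -> volterra_r a lam r -> 0 <= t ->
  s t = 1 - lam * \int[leb]_(x in `]0, t[) r x.
Proof.
move=> lam0 [cs sE] [rL rE] t0.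
have ct := within_continuous_itv _ t cs.
have [M M0 sM] := within_continuous_bounded _ _ ct.
have tS x : x \in `]0, t[ -> x \in `[0, t] by move=> /andP; rewrite !in_itv /= !bnd_simp; lra.
have := volterra_inversion R a r s (cst 1) lam (M + 1) t lam0 _ (kernel_integrable t)
  (L1loc_integrable _ _ rL) rE.
have -> : conv r (cst 1) t = \int[leb]_(x in `]0, t[) r x.
  rewrite -(Rintegral_reflect_itv R t r); last exact: integrable_measurable (L1loc_integrable _ _ rL).
  by apply: eq_Rintegral => x _; rewrite mulr1.
move=> ->; first by rewrite -(sE t t0); ring.
- by rewrite addr_ge0.
- exact: within_continuous_measurable.
- by [].
- by move=> x xt; rewrite (le_trans (sM _ (tS _ xt)))// lerDl.
- by move=> x _; rewrite normr1 lerDr.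
- by move=> x /tS; rewrite in_itv /= => /andP[x0 _]; exact: sE.
Qed.

(** [omega] is selected by [get], whereas complete positivity gives the sign of some solution [s].
    Both are equal to 1 - lam \int r, so the sign passes to [omega]. *)
Lemma omegaP (lam : R) : 0 < lam -> exists r : R -> R,
  [/\ volterra_s a lam (omega m lam), volterra_r a lam r,
      forall t, 0 <= t -> omega m lam t = 1 - lam * \int[leb]_(x in `]0, t[) r x,
      forall t, 0 <= t -> 0 <= omega m lam t &
      {ae leb, forall t, 0 < t -> 0 <= r t}].
Proof.
move=> lam0; have [_ _ _ /(_ lam lam0)[s [r [sV rV s0 r0]]]] := hm.
have oV : volterra_s a lam (omega m lam) by apply: (@getPex _ (volterra_s a lam)); exists s.
have oE t : 0 <= t -> omega m lam t = 1 - lam * \int[leb]_(x in `]0, t[) r x.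
  exact: volterra_s_resolvent.
exists r; split => // t t0; rewrite oE// -(volterra_s_resolvent lam s r)//.
exact: s0.
Qed.

Lemma omega_cont (lam : R) : 0 < lam -> {within `[0, +oo[, continuous (omega m lam)}.
Proof. by move=> /omegaP[r [[]]]. Qed.

Lemma omega_ge0 (lam t : R) : 0 < lam -> 0 <= t -> 0 <= omega m lam t.
Proof. by move=> /omegaP[r [_ _ _ + _]]; exact. Qed.

Lemma measurable_omega (lam t : R) : 0 < lam -> measurable_fun `]0, t[ (omega m lam).
Proof.
by move=> /omega_cont co; exact: within_continuous_measurable (within_continuous_itv _ t co).
Qed.

Lemma omega_noninc (lam s t : R) : 0 < lam -> 0 <= s -> s <= t ->
  omega m lam t <= omega m lam s.
Proof.
move=> lam0 s0 st; have [r [_ [rL _] oE _ r0]] := omegaP lam lam0.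
rewrite !oE// ?(le_trans s0)// lerD2l lerN2 ler_pM2l//.
rewrite (Rintegral_split r t s)//; last exact: L1loc_integrable.
rewrite lerDl; apply: Rintegral_ae_ge0 => //.
  apply: integrable_measurable; apply: integrableS (L1loc_integrable _ t rL) => //.
  by apply: subset_itv; rewrite bnd_simp.
apply: ae_leb_imply r0 => x /= r0; rewrite in_itv /= => /andP[sx _].
by apply: r0; exact: le_lt_trans sx.
Qed.

Lemma omega0 (lam : R) : 0 < lam -> omega m lam 0 = 1.
Proof.
move=> lam0; have [r [_ _ oE _ _]] := omegaP lam lam0.
by rewrite oE// set_itv_ge ?bnd_simp ?ltxx// Rintegral_set0 mulr0 subr0.
Qed.

Lemma omega_le1 (lam t : R) : 0 < lam -> 0 <= t -> omega m lam t <= 1.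
Proof. by move=> lam0 t0; rewrite -(omega0 lam lam0); exact: omega_noninc. Qed.

Lemma omega_norm_le1 (lam t : R) : 0 < lam -> 0 <= t -> `|omega m lam t| <= 1.
Proof. by move=> lam0 t0; rewrite ger0_norm ?omega_ge0 ?omega_le1. Qed.

Lemma omega_conv (lam t : R) : 0 < lam -> 0 <= t ->
  omega m lam t + lam * \int[leb]_(x in `]0, t[) (omega m lam (t - x) * a x) = 1.
Proof.
move=> lam0 t0; have [r [[_ oE] _ _ _ _]] := omegaP lam lam0.
rewrite -[X in _ + lam * X]/(conv (omega m lam) a t) convC ?oE//.
- exact: measurable_omega.
- exact: integrable_measurable (kernel_integrable t).
Qed.

Lemma integrable_omega_kernel (lam t : R) : 0 < lam ->
  leb.-integrable `]0, t[ (fun x => (omega m lam (t - x) * a x)%:E).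
Proof.
move=> lam0; have := integrable_conv R a (omega m lam) 1 t (kernel_integrable t)
  (measurable_omega lam t lam0).
have tS x : x \in `]0, t[ -> 0 <= x by rewrite in_itv /=; lra.
move=> /(_ (fun x xt => omega_norm_le1 _ _ lam0 (tS x xt))).
move=> /(integrable_reflect_itv R t (fun x => a (t - x) * omega m lam x)).
by apply: eq_integrable => // x _ /=; congr (_%:E); rewrite mulrC; congr (_ * a _); ring.
Qed.

Lemma integrable_omega (lam t : R) : 0 < lam ->
  leb.-integrable `]0, t[ (EFin \o omega m lam).
Proof.
move=> lam0; apply: (integrable_bounded _ _ 1) => //.
- exact: lebesgue_itv_lty.
- exact: measurable_omega.
- by move=> x; rewrite /= in_itv /= => /andP[x0 _]; apply: omega_norm_le1 => //; exact: ltW.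
Qed.

Lemma omega_int_le (lam t : R) : 0 < lam -> 0 <= t ->
  lam * \int[leb]_(x in `]0, t[) omega m lam x <= 1.
Proof.
move=> lam0 t0; rewrite -(omega_conv lam t lam0 t0).
apply: ler_wpDl; first exact: omega_ge0.
rewrite ler_pM2l// -(Rintegral_reflect_itv R t); last exact: measurable_omega.
apply: le_Rintegral => //=.
- exact: integrable_reflect_itv (integrable_omega _ _ lam0).
- exact: integrable_omega_kernel.
- move=> x; rewrite in_itv /= => /andP[x0 xt].
  by rewrite ler_peMr ?kernel_ge1// omega_ge0//; lra.
Qed.

(** The difference z = o' - o solves z + lam' a * z = c (1 - o), where c = 1 - lam' / lam. Inverting
    with the resolvent kernel r' of lam', and using lam' \int r' = 1 - o', leaves (1 - c) z = c lam'
    (r' * o), which is nonnegative. *)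
Lemma omega_antitone (lam lam' t : R) : 0 < lam' -> lam' <= lam -> 0 <= t ->
  omega m lam t <= omega m lam' t.
Proof.
move=> lam'0 le_lam t0; have lam0 : 0 < lam by exact: lt_le_trans le_lam.
have [r [[_ oE] _ _ _ _]] := omegaP lam lam0.
have [r' [[_ oE'] [rL' rE'] rI' _ r'0]] := omegaP lam' lam'0.
set o := omega m lam in oE *; set o' := omega m lam' in oE' rI' *.
pose c := (lam - lam') / lam.
have c0 : 0 <= c by rewrite divr_ge0 ?subr_ge0 // ltW.
have mo := measurable_omega lam t lam0; have mo' := measurable_omega lam' t lam'0.
have ir' := L1loc_integrable _ t rL'.
have mr' := integrable_measurable _ _ ir'.
have tS x : x \in `]0, t[ -> 0 <= x by rewrite in_itv /=; lra.
have oM x : x \in `]0, t[ -> `|o x| <= 1 by move=> /tS; exact: omega_norm_le1.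
have oM' x : x \in `]0, t[ -> `|o' x| <= 1 by move=> /tS; exact: omega_norm_le1.
have convB x : 0 <= x -> conv a (fun y => o' y - o y) x = conv a o' x - conv a o x.
  move=> x0; rewrite /Defs.conv -RintegralB//=.
  - by apply: eq_Rintegral => y _; rewrite mulrBr.
  - apply: (integrable_conv _ _ _ 1); [exact: kernel_integrable|exact: measurable_omega|].
    by move=> y; rewrite in_itv /= => /andP[/ltW y0 _]; exact: omega_norm_le1.
  - apply: (integrable_conv _ _ _ 1); [exact: kernel_integrable|exact: measurable_omega|].
    by move=> y; rewrite in_itv /= => /andP[/ltW y0 _]; exact: omega_norm_le1.
have main x : 0 <= x -> (o' x - o x) + lam' * conv a (fun y => o' y - o y) x = c * (1 - o x).
  move=> x0; rewrite convB//.
  have e1 := oE x x0; have e2 := oE' x x0.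
  have -> : conv a o x = (1 - o x) / lam by rewrite -e1 addrC addKr mulrC mulKf// gt_eqF.
  have -> : conv a o' x = (1 - o' x) / lam' by rewrite -e2 addrC addKr mulrC mulKf// gt_eqF.
  by rewrite /c; field; rewrite !gt_eqF.
have INV := volterra_inversion R a r' (fun y => o' y - o y) (fun y => c * (1 - o y)) lam' (c * 2 + 2) t lam'0
  _ (kernel_integrable t) ir' rE'.
have E : conv r' (fun y => c * (1 - o y)) t = conv a (fun y => o' y - o y) t.
  apply: INV.
  - by rewrite addr_ge0// mulr_ge0.
  - exact: measurable_funB.
  - by apply: measurable_funM => //; exact: measurable_funB.
  - move=> x xt; rewrite (le_trans (ler_normB _ _))//.
    have : 0 <= c * 2 by rewrite mulr_ge0.
    by have := oM x xt; have := oM' x xt; lra.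
  - move=> x xt; rewrite normrM ger0_norm//.
    have : c * `|1 - o x| <= c * 2; last by lra.
    rewrite ler_wpM2l// (le_trans (ler_normB _ _))// normr1.
    by have := oM x xt; lra.
  - by move=> x /tS; exact: main.
have := main t t0; rewrite -E.
have -> : conv r' (fun y => c * (1 - o y)) t =
    c * (\int[leb]_(x in `]0, t[) r' x - conv r' o t).
  rewrite -(Rintegral_reflect_itv R t r')// /Defs.conv -RintegralB//=.
  - rewrite -RintegralZl//=; first by apply: eq_Rintegral => y _; ring.
    apply: leb_integrableB => //; first exact: integrable_reflect_itv.
    exact: integrable_conv oM.
  - exact: integrable_reflect_itv.
  - exact: (integrable_conv _ _ _ 1).
have K0 : 0 <= conv r' o t.
  rewrite convC//; apply: Rintegral_ae_ge0 => //.
    by apply: measurable_funM => //; exact: measurable_fun_reflect_itv.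
  apply: ae_leb_imply r'0 => x /= r'0; rewrite in_itv /= => /andP[x0 xt].
  by rewrite mulr_ge0 ?r'0// omega_ge0//; lra.
have := rI' t t0; set I := Rintegral _ _ _; move=> rI.
set K := conv r' o t in K0 *.
have lamI : lam' * I = 1 - o' t by rewrite rI; ring.
move=> H.
(* The term 1 - o' coming from the integral of r' brings the unknown back on the right; collecting
   it produces the factor 1 - c = lam' / lam > 0. *)
have H2 : (1 - c) * (o' t - o t) = c * (lam' * K).
  have : c * (1 - o t) - lam' * (c * (I - K)) = c * (1 - o t) - c * (lam' * I) + c * (lam' * K) by ring.
  rewrite lamI => H3; have := H; move: H3; lra.
have : 0 <= (1 - c) * (o' t - o t) by rewrite H2 mulr_ge0// mulr_ge0// ltW.
have -> : 1 - c = lam' / lam by rewrite /c; field; rewrite gt_eqF.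
by rewrite pmulr_rge0 ?divr_gt0// subr_ge0.
Qed.

Hypothesis hmdec : forall s t : R, 0 < s -> s <= t -> m t <= m s.

(** In lam \int_0^t omega(t - x) a(x) dx <= 1 both factors are at least their values [omega m lam t]
    and [a t], since [omega] and [m] are nonincreasing. *)
Lemma omega_kernel_le (lam t : R) : 0 < lam -> 0 < t -> lam * t * (a t * omega m lam t) <= 1.
Proof.
move=> lam0 t0; rewrite -(omega_conv lam t lam0 (ltW t0)).
apply: ler_wpDl; first exact/omega_ge0/ltW.
rewrite -mulrA ler_pM2l//.
have -> : t * (a t * omega m lam t) = \int[leb]_(x in `]0, t[) (a t * omega m lam t).
  rewrite Rintegral_cst//= lebesgue_measure_itv /= lte_fin t0 /=.
  by rewrite mulrC subr0.
apply: le_Rintegral => //=.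
- exact: leb_integrable_cst.
- exact: integrable_omega_kernel.
- move=> x; rewrite in_itv /= => /andP[x0 xt].
  rewrite mulrC ler_pM//.
  + exact/omega_ge0/ltW.
  + by rewrite (le_trans ler01)// kernel_ge1.
  + by apply: omega_noninc => //; lra.
  + by rewrite /a lerD2l hmdec// ltW.
Qed.

Lemma omega_decay (lam t : R) : 0 < lam -> 0 < t -> lam * t * omega m lam t <= 1.
Proof.
move=> lam0 t0; apply: le_trans (omega_kernel_le lam t lam0 t0).
rewrite ler_pM2l ?mulr_gt0// ler_peMl ?kernel_ge1//.
exact/omega_ge0/ltW.
Qed.

(** Subtracting the constant [a t] from the kernel gives a function [b] that is nonnegative before
    [t] and nonpositive after it. As [o] is nonincreasing, the integral of o(x - y) b(y) over (0, x)
    does not grow when x passes from t to t + h. By the Volterra equation this says o(t) - o(t + h)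
    <= lam a(t) \int_t^{t+h} o <= lam a(t) h o(t), and [omega_kernel_le] bounds the right-hand side
    by h / t. *)
Lemma omega_diff_le (lam t h : R) : 0 < lam -> 0 < t -> 0 < h ->
  omega m lam t - omega m lam (t + h) <= h / t.
Proof.
move=> lam0 t0 h0; set o := omega m lam.
have th0 : 0 < t + h by rewrite addr_gt0.
have o0 x : 0 <= x -> 0 <= o x by exact: omega_ge0.
have on x y : 0 <= x -> x <= y -> o y <= o x by exact: omega_noninc.
pose b x := a x - a t.
have ib x : leb.-integrable `]0, x[ (fun y => (o (x - y) * b y)%:E).
  have i1 : leb.-integrable `]0, x[ (fun y => (a t * o (x - y))%:E).
    apply: leb_integrableZ => //.
    exact: integrable_reflect_itv (integrable_omega _ x lam0).
  have := leb_integrableB _ _ _ (measurable_itv _) (integrable_omega_kernel lam x lam0) i1.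
  by apply: eq_integrable => // y _ /=; congr (_%:E); rewrite /b /o; ring.
have IbE x : 0 <= x -> \int[leb]_(y in `]0, x[) (o (x - y) * b y) =
    (1 - o x) / lam - a t * \int[leb]_(y in `]0, x[) o y.
  move=> x0.
  have -> : (1 - o x) / lam = \int[leb]_(y in `]0, x[) (o (x - y) * a y).
    by rewrite -(omega_conv lam x lam0 x0) addrC addKr mulrC mulKf// gt_eqF.
  rewrite -(Rintegral_reflect_itv R x o); last exact: measurable_omega.
  rewrite -RintegralZl//=; last exact: integrable_reflect_itv (integrable_omega _ x lam0).
  rewrite -RintegralB//=.
  - by apply: eq_Rintegral => y _; rewrite /b; ring.
  - exact: integrable_omega_kernel.
  - apply: leb_integrableZ => //.
    exact: integrable_reflect_itv (integrable_omega _ x lam0).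
have S1 : `]0, t[%classic `<=` `]0, t + h[%classic by apply: subset_itvl; rewrite bnd_simp ler_wpDr// ltW.
have S2 : `]t, t + h[%classic `<=` `]0, t + h[%classic by apply: subset_itvr; rewrite bnd_simp ltW.
have tth : t <= t + h by rewrite lerDl ltW.
have D1 : \int[leb]_(y in `]0, t + h[) (o (t + h - y) * b y) <=
          \int[leb]_(y in `]0, t[) (o (t - y) * b y).
  rewrite (Rintegral_split _ (t + h) t)//; last exact: ltW.
  rewrite -[leRHS]addr0 lerD//.
    apply: le_Rintegral => //= [|y]; first by apply: integrableS (ib (t + h)) => //.
    rewrite in_itv /= => /andP[y0 yt].
    rewrite ler_wpM2r//; first by rewrite /b subr_ge0 /a lerD2l hmdec// ltW.
    by apply: on; lra.
  rewrite -oppr_ge0 -mulN1r -RintegralZl//=; last by apply: integrableS (ib (t + h)).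
  apply: Rintegral_ge0 => y; rewrite /= in_itv /= => /andP[ty yth].
  rewrite mulN1r oppr_ge0 mulr_ge0_le0//; first by apply: o0; lra.
  by rewrite /b subr_le0 /a lerD2l hmdec// ltW.
rewrite (IbE _ (ltW th0)) (IbE _ (ltW t0)) in D1.
have D2 : \int[leb]_(y in `]0, t + h[) o y - \int[leb]_(y in `]0, t[) o y <= h * o t.
  rewrite (Rintegral_split _ (t + h) t)//; [|exact: ltW|exact: integrable_omega].
  rewrite [X in X - _]addrC addrK.
  have -> : h * o t = \int[leb]_(x in `]t, t + h[) (o t).
    rewrite Rintegral_cst//= lebesgue_measure_itv /= lte_fin ltrDl h0 /=.
    by rewrite [t + h]addrC addrK mulrC.
  apply: le_Rintegral => //=.
  - by apply: integrableS (integrable_omega lam (t + h) lam0).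
  - exact: leb_integrable_cst.
  - by move=> y; rewrite in_itv /= => /andP[ty _]; apply: on; exact: ltW.
have at0 : 0 <= a t by rewrite (le_trans ler01)// kernel_ge1.
have D3 : o t - o (t + h) <= lam * (a t * (h * o t)).
  have : (o t - o (t + h)) / lam <= a t * (h * o t).
    apply: (@le_trans _ _ (a t * (\int[leb]_(y in `]0, t + h[) o y - \int[leb]_(y in `]0, t[) o y))).
      have -> : (o t - o (t + h)) / lam = (1 - o (t + h)) / lam - (1 - o t) / lam by ring.
      rewrite mulrBr.
      have aux (A B X Y : R) : A - X <= B - Y -> A - B <= X - Y by clear; lra.
      exact: aux D1.
    by rewrite ler_wpM2l.
  by rewrite ler_pdivrMr// [X in _ <= X -> _]mulrC.
apply: (le_trans D3); rewrite ler_pdivlMr//.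
have := omega_kernel_le lam t lam0 t0; rewrite -/o => D4.
have -> : lam * (a t * (h * o t)) * t = h * (lam * t * (a t * o t)) by ring.
by rewrite -[leRHS]mulr1 ler_pM2l.
Qed.

End omega_properties.

(** * A Cauchy-Schwarz inequality with a weight of arbitrary sign *)

Section weighted_integral.
Context (R : realType).
Local Notation leb := (@lebesgue_measure R).
Local Notation mR := (measurableTypeR R).

Lemma leb_integrableM (D : set R) (k g : R -> R) (G : R) : measurable D ->
  leb.-integrable D (EFin \o k) -> measurable_fun D g -> (forall x, D x -> `|g x| <= G) ->
  leb.-integrable D (EFin \o (fun x => k x * g x)).
Proof.
move=> mD ik mg gG; apply: (@le_integrable _ mR R leb _ _ _ (fun y => (G * k y)%:E)) => //.
- apply/measurable_EFinP/measurable_funM => //; exact: integrable_measurable ik.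
- move=> x Dx; rewrite /= lee_fin !normrM mulrC ler_wpM2r//.
  by rewrite (le_trans (gG _ _))// ler_norm.
- exact: leb_integrableZ.
Qed.

Lemma leb_integrable_norm (D : set R) (k : R -> R) : measurable D ->
  leb.-integrable D (EFin \o k) -> leb.-integrable D (EFin \o (fun x => `|k x|)).
Proof. by move=> mD ik; exact: (@integrable_norm _ mR R leb D k ik). Qed.

(* The discriminant of the nonnegative quadratic polynomial
   c |-> \int |k| (|g| - c)^2 is nonpositive. *)
Lemma weighted_cauchy_schwarz (D : set R) (k g : R -> R) (G : R) : measurable D ->
  leb.-integrable D (EFin \o k) -> measurable_fun D g -> (forall x, D x -> `|g x| <= G) ->
  (\int[leb]_(x in D) (k x * g x)) ^+ 2 <=
  (\int[leb]_(x in D) `|k x|) * \int[leb]_(x in D) (`|k x| * g x ^+ 2).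
Proof.
move=> mD ik mg gG; have ik' := leb_integrable_norm D k mD ik.
have ikg := leb_integrableM D k g G mD ik mg gG.
have ikg' : leb.-integrable D (EFin \o (fun x => `|k x| * `|g x|)).
  apply: (leb_integrableM _ _ _ G) => //; first exact: measurableT_comp.
  by move=> x Dx; rewrite normr_id gG.
have ikg2 : leb.-integrable D (EFin \o (fun x => `|k x| * g x ^+ 2)).
  apply: (leb_integrableM _ _ _ (G ^+ 2)) => //; first exact: measurable_funX.
  by move=> x Dx; rewrite normrX lerXn2r ?nnegrE ?gG// (le_trans _ (gG _ Dx)).
set P := \int[leb]_(x in D) `|k x|; set Q := \int[leb]_(x in D) (`|k x| * g x ^+ 2).
pose J := \int[leb]_(x in D) (`|k x| * `|g x|).
have P0 : 0 <= P by apply: Rintegral_ge0.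
have J0 : 0 <= J by apply: Rintegral_ge0 => x _; rewrite mulr_ge0.
have quad (c : R) : 0 <= Q - 2 * c * J + c ^+ 2 * P.
  rewrite (_ : _ + _ = \int[leb]_(x in D) (`|k x| * (`|g x| - c) ^+ 2)).
    by apply: Rintegral_ge0 => x _; rewrite mulr_ge0// sqr_ge0.
  rewrite /J /P -!RintegralZl// -RintegralB//; last exact: leb_integrableZ.
  rewrite -RintegralD//.
  - by apply: eq_Rintegral => x _; rewrite -(real_normK (num_real (g x))); ring.
  - by apply: leb_integrableB => //; exact: leb_integrableZ.
  - exact: leb_integrableZ.
have IJ : `|\int[leb]_(x in D) (k x * g x)| <= J.
  apply: (le_trans (@le_normr_Rintegral _ mR R leb D _ mD ikg)).
  by apply: le_Rintegral => //= [|x _]; [exact: leb_integrable_norm|rewrite normrM].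
rewrite -(real_normK (num_real (\int[leb]_(x in D) (k x * g x)))).
apply: (@le_trans _ _ (J ^+ 2)); first by rewrite lerXn2r ?nnegrE.
have [P_gt0|P_le0] := ltP 0 P.
  have := quad (J / P).
  have -> : Q - 2 * (J / P) * J + (J / P) ^+ 2 * P = (P * Q - J ^+ 2) / P by field; rewrite gt_eqF.
  by rewrite pmulr_lge0 ?invr_gt0// subr_ge0.
have PE : P = 0 by apply/le_anti; rewrite P_le0.
rewrite PE mul0r.
(* For P = 0 the polynomial is affine in [c]; if J were positive, it would take the value -1 at (Q +
   1) / (2 J). *)
have [J_gt0|J_le0] := ltP 0 J; last first.
  by have -> : J = 0 by [apply/le_anti; rewrite J_le0]; rewrite expr0n.
have := quad ((Q + 1) / (2 * J)); rewrite PE mulr0 addr0.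
have -> : Q - 2 * ((Q + 1) / (2 * J)) * J = -1 by field; rewrite gt_eqF.
by rewrite ler0N1.
Qed.

End weighted_integral.

Lemma small_factor (R : realType) (a eps : R) : 0 <= a -> 0 < eps ->
  exists2 z : R, 0 < z & a * z <= eps.
Proof.
move=> a0 e0; have a1 : 0 < a + 1 by rewrite ltr_wpDl.
exists (eps / (a + 1)); first by rewrite divr_gt0.
by rewrite mulrCA ler_piMr ?(ltW e0)// ler_pdivrMr// mul1r lerDl.
Qed.

(** * Norm bounds in weighted sequence spaces *)

Section norm_bound.
Context (R : realType) (lam : nat -> R) (lam_gt0 : forall n, 0 < lam n).
Implicit Types (rho A B : R) (x y : nat -> R).

(** The bound is imposed on all partial sums, so finiteness of the norm is built in and every
    estimate is one between finite sums of real numbers. *)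
Definition norm_le rho B x :=
  0 <= B /\ forall N, \sum_(n < N) lam n `^ rho * x n ^+ 2 <= B ^+ 2.

Lemma norm_le_ge0 rho B x : norm_le rho B x -> 0 <= B.
Proof. by case. Qed.

Lemma weight_gt0 rho n : 0 < lam n `^ rho. Proof. exact: powR_gt0. Qed.

Lemma weight_ge0 rho n : 0 <= lam n `^ rho. Proof. exact: powR_ge0. Qed.

Lemma norm_le_ext rho B x y : x =1 y -> norm_le rho B x -> norm_le rho B y.
Proof. by move=> /funext ->. Qed.

Lemma norm_le_weaken rho A B x : A <= B -> norm_le rho A x -> norm_le rho B x.
Proof.
move=> AB [A0 xA]; have B0 := le_trans A0 AB; split => // N.
by rewrite (le_trans (xA N))// lerXn2r.
Qed.

Lemma norm_le0 rho B : 0 <= B -> norm_le rho B (fun=> 0).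
Proof. by move=> B0; split => // N; rewrite big1 ?sqr_ge0// => i _; rewrite expr0n mulr0. Qed.

Lemma norm_le_coord rho B x n : norm_le rho B x -> lam n `^ rho * x n ^+ 2 <= B ^+ 2.
Proof.
move=> [B0 /(_ n.+1)]; apply: le_trans; rewrite big_ord_recr /= lerDr.
by apply: sumr_ge0 => i _; rewrite mulr_ge0 ?sqr_ge0 ?weight_ge0.
Qed.

Lemma norm_le_coord_abs rho B x n : norm_le rho B x ->
  `|x n| <= Num.sqrt (lam n `^ rho)^-1 * B.
Proof.
move=> xB; have B0 := norm_le_ge0 _ _ _ xB; have := norm_le_coord _ _ _ n xB.
rewrite mulrC -ler_pdivlMr ?weight_gt0// mulrC => h.
rewrite -(ger0_norm B0) -[`|B|]sqrtr_sqr -sqrtrM ?invr_ge0 ?weight_ge0//.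
by rewrite -[`|x n|]sqrtr_sqr ler_wsqrtr.
Qed.

Lemma norm_le_eq0 rho x : norm_le rho 0 x -> x =1 fun=> 0.
Proof.
move=> x0 n; have := norm_le_coord_abs _ _ _ n x0.
by rewrite mulr0 normr_le0 => /eqP.
Qed.

(** Termwise, (A + B)/A x^2 + (A + B)/B y^2 = (x + y)^2 + (B x - A y)^2 / (A B); dropping the last
    square and summing gives the triangle inequality without an inner product. Vanishing bounds are
    treated apart because of the divisions. *)
Lemma norm_leD rho A B x y : norm_le rho A x -> norm_le rho B y ->
  norm_le rho (A + B) (fun n => x n + y n).
Proof.
move=> xA yB; have [A0 xA'] := xA; have [B0 yB'] := yB.
have [A_gt0|A_le0] := ltP 0 A; last first.
  have AE : A = 0 by apply/le_anti; rewrite A_le0.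
  rewrite AE add0r; apply: norm_le_ext yB => n; rewrite AE in xA.
  by rewrite (norm_le_eq0 _ _ xA) add0r.
have [B_gt0|B_le0] := ltP 0 B; last first.
  have BE : B = 0 by apply/le_anti; rewrite B_le0.
  rewrite BE addr0; apply: norm_le_ext xA => n; rewrite BE in yB.
  by rewrite (norm_le_eq0 _ _ yB) addr0.
split; first exact: addr_ge0.
move=> N.
apply: (@le_trans _ _ ((A + B) / A * \sum_(n < N) lam n `^ rho * x n ^+ 2 +
                       (A + B) / B * \sum_(n < N) lam n `^ rho * y n ^+ 2)).
  rewrite !mulr_sumr -big_split /=; apply: ler_sum => n _.
  have -> : (A + B) / A * (lam n `^ rho * x n ^+ 2) + (A + B) / B * (lam n `^ rho * y n ^+ 2) =
            lam n `^ rho * ((x n + y n) ^+ 2 + (B * x n - A * y n) ^+ 2 / (A * B)).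
    by field; rewrite !gt_eqF.
  rewrite ler_wpM2l ?weight_ge0// lerDl divr_ge0 ?sqr_ge0// mulr_ge0// ltW.
have -> : (A + B) ^+ 2 = (A + B) / A * A ^+ 2 + (A + B) / B * B ^+ 2.
  by field; rewrite !gt_eqF.
by rewrite lerD// ler_wpM2l// divr_ge0// addr_ge0.
Qed.

Lemma norm_le_diff0 rho B x y : 0 <= B -> x =1 y -> norm_le rho B (fun n => x n - y n).
Proof. by move=> /(norm_le0 rho) + /funext ->; apply: norm_le_ext => n; rewrite subrr. Qed.

Lemma norm_leM rho B (C : R) (c : nat -> R) x : 0 <= C -> (forall n, `|c n| <= C) ->
  norm_le rho B x -> norm_le rho (C * B) (fun n => c n * x n).
Proof.
move=> C0 cC [B0 xB]; split; first exact: mulr_ge0.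
move=> N; rewrite exprMn.
apply: (@le_trans _ _ (C ^+ 2 * \sum_(n < N) lam n `^ rho * x n ^+ 2)).
  rewrite mulr_sumr; apply: ler_sum => n _; rewrite exprMn mulrCA.
  apply: ler_wpM2r; first by apply: mulr_ge0; [exact: weight_ge0|exact: sqr_ge0].
  by rewrite -(real_normK (num_real (c n))) lerXn2r ?nnegrE.
by rewrite ler_wpM2l// sqr_ge0.
Qed.

Lemma norm_leN rho B x : norm_le rho B x -> norm_le rho B (fun n => - x n).
Proof.
move=> xB; rewrite -[B]mul1r; apply: norm_le_ext (norm_leM _ _ 1 (fun=> -1) _ _ _ xB) => //.
- by move=> n; rewrite mulN1r.
- by move=> _; rewrite normrN1.
Qed.

Lemma norm_leB rho A B x y : norm_le rho A x -> norm_le rho B y ->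
  norm_le rho (A + B) (fun n => x n - y n).
Proof. by move=> xA yB; apply: norm_leD => //; exact: norm_leN. Qed.

Lemma norm_leBC rho A x y : norm_le rho A (fun n => x n - y n) ->
  norm_le rho A (fun n => y n - x n).
Proof. by move=> /norm_leN; apply: norm_le_ext => n; rewrite opprB. Qed.

Lemma norm_le_trans rho A B x y z : norm_le rho A (fun n => x n - y n) ->
  norm_le rho B (fun n => y n - z n) -> norm_le rho (A + B) (fun n => x n - z n).
Proof. by move=> h1 h2; apply: norm_le_ext (norm_leD _ _ _ _ _ h1 h2) => n; rewrite addrA subrK. Qed.

Lemma norm_le_small rho x : (forall eps, 0 < eps -> norm_le rho eps x) -> x =1 fun=> 0.
Proof.
move=> h n; apply/eqP; rewrite -normr_le0; apply/ler_addgt0Pr => e e0; rewrite add0r.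
pose c := Num.sqrt (lam n `^ rho)^-1.
have c0 : 0 < c by rewrite sqrtr_gt0 invr_gt0 weight_gt0.
have := norm_le_coord_abs _ _ _ n (h (c^-1 * e) (mulr_gt0 _ e0)).
by rewrite -/c mulVKf ?gt_eqF//; apply; rewrite invr_gt0.
Qed.

(** Each condition in [norm_le] involves finitely many coordinates, hence survives coordinatewise
    limits. This takes the place of completeness of the space. *)
Lemma norm_le_lim rho B (X : nat -> nat -> R) x :
  (forall n, X k n @[k --> \oo] --> x n) -> (\forall k \near \oo, norm_le rho B (X k)) ->
  norm_le rho B x.
Proof.
move=> Xx XB; split.
  have [k _ kB] := XB; exact: norm_le_ge0 (kB k (leqnn k)).
move=> N; pose S k := \sum_(n < N) lam n `^ rho * X k n ^+ 2.
have SS : S k @[k --> \oo] --> \sum_(n < N) lam n `^ rho * x n ^+ 2.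
  rewrite /S; elim: N {S} => [|N IH].
    by rewrite big_ord0; under eq_fun do rewrite big_ord0; exact: cvg_cst.
  rewrite big_ord_recr /=; under eq_fun do rewrite big_ord_recr /=.
  apply: cvgD => //; apply: cvgM; first exact: cvg_cst.
  by rewrite expr2; under eq_fun do rewrite expr2; apply: cvgM.
rewrite -(cvg_lim _ SS)//; apply: limr_le; first by apply/cvg_ex; eexists; exact: SS.
by apply: filterS XB => k [_]; exact.
Qed.

Lemma norm_le_tail rho B (xi : nat -> R) (eps : R) : norm_le rho B xi -> 0 < eps ->
  exists M, forall N, \sum_(n < N | (M <= n)%N) lam n `^ rho * xi n ^+ 2 <= eps ^+ 2.
Proof.
move=> [B0 xB] e0.
pose S N := \sum_(n < N) lam n `^ rho * xi n ^+ 2.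
have ndS : nondecreasing_seq S.
  apply/nondecreasing_seqP => N; rewrite /S big_ord_recr /= lerDl.
  by rewrite mulr_ge0 ?sqr_ge0 ?powR_ge0.
have ubS : has_ubound (range S) by exists (B ^+ 2) => _ [N _ <-]; exact: xB.
have cS := nondecreasing_cvgn ndS ubS.
have e2 : 0 < eps ^+ 2 by rewrite exprn_gt0.
move/cvgrPdist_lt : cS => /(_ _ e2)[M _ /(_ M (leqnn M))/= hM]; exists M => N.
have le_sup k : S k <= sup (range S) by apply: ub_le_sup => //; exists k.
have [NM|MN] := leqP N M.
  rewrite big1 ?sqr_ge0// => n /= Mn.
  by exfalso; have := leq_trans (ltn_ord n) NM; rewrite ltnNge Mn.
have -> : \sum_(n < N | (M <= n)%N) lam n `^ rho * xi n ^+ 2 = S N - S M.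
  rewrite /S (bigID (fun n : 'I_N => (M <= n)%N) xpredT) /=.
  rewrite [X in _ = _ + X - _](_ : _ = S M) ?addrK//.
  rewrite /S (big_ord_widen _ (fun n => lam n `^ rho * xi n ^+ 2) (ltnW MN)).
  by apply: eq_bigl => n; rewrite -ltnNge.
have := le_sup N; have := ler_norm (sup (range S) - S M); lra.
Qed.

Lemma norm_le_dom rho B (x y : nat -> R) : norm_le rho B x -> (forall n, `|y n| <= `|x n|) -> norm_le rho B y.
Proof.
move=> [B0 xB] yx; split => // N; apply: le_trans (xB N); apply: ler_sum => n _.
rewrite ler_wpM2l ?powR_ge0// -(real_normK (num_real (y n))) -(real_normK (num_real (x n))).
by rewrite lerXn2r ?nnegrE.
Qed.

(** Dominated convergence for sequences: a sequence dominated by [x] is small in norm as soon as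
    finitely many coordinates are small relative to those of [x], because the tail of [x] controls
    the rest. *)
Lemma norm_le_dominated rho B x (eps : R) : norm_le rho B x -> 0 < eps ->
  exists M, exists2 del : R, 0 < del & forall y, (forall n, `|y n| <= `|x n|) ->
    (forall n, (n < M)%N -> `|y n| <= del * `|x n|) -> norm_le rho eps y.
Proof.
move=> xB e0; have B0 := norm_le_ge0 _ _ _ xB; have e2 : 0 < eps / 2 by rewrite divr_gt0.
have [M hM] := norm_le_tail _ _ _ _ xB e2; have [del d0 hdel] := small_factor R B _ B0 e2.
exists M, del => // y yx ydel.
pose y1 n := if (n < M)%N then y n else 0; pose y2 n := if (n < M)%N then 0 else y n.
have h1 : norm_le rho (eps / 2) y1.
  apply: (norm_le_weaken _ (del * B)); first by rewrite mulrC.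
  apply: norm_le_dom (norm_leM _ _ _ (fun=> del) _ (ltW d0) _ xB) _ => [_|n].
    by rewrite gtr0_norm.
  rewrite /y1 normrM gtr0_norm//; case: ifP => [/ydel//|_].
  by rewrite normr0 mulr_ge0// ltW.
have h2 : norm_le rho (eps / 2) y2.
  split=> [|N]; first exact: ltW.
  apply: le_trans (hM N); rewrite [leRHS]big_mkcond /=; apply: ler_sum => n _.
  rewrite /y2 ltnNge; case: leqP => _ /=; last by rewrite expr0n mulr0.
  by rewrite ler_wpM2l ?weight_ge0// -[leLHS]real_normK ?num_real// -[leRHS]real_normK ?num_real// lerXn2r ?nnegrE.
rewrite [eps]splitr; apply: norm_le_ext (norm_leD _ _ _ _ _ h1 h2) => n.
by rewrite /y1 /y2; case: ifP; rewrite ?addr0 ?add0r.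
Qed.

End norm_bound.

(** * Integral operators and continuous paths in weighted sequence spaces *)

Section coefficient_estimates.
Context (R : realType) (lam : nat -> R) (lam_gt0 : forall n, 0 < lam n).
Local Notation leb := (@lebesgue_measure R).
Local Notation nle := (@norm_le R lam).

(** Cauchy-Schwarz in each coordinate gives (\int k_n g_n)^2 <= \int |k_n| \int |k_n| g_n^2. The
    first factor converts the weight lam^mu into C lam^nu. In the second, the majorant [kap],
    independent of n, lets the sum over n move under the integral, where it is at most B^2; the
    remaining \int kap is at most A. *)
Lemma kernel_estimate (D : set R) (k : nat -> R -> R) (kap : R -> R)
    (g : R -> nat -> R) (mu nu A B C : R) : measurable D ->
  (forall n, leb.-integrable D (EFin \o k n)) -> leb.-integrable D (EFin \o kap) ->
  (forall n x, D x -> `|k n x| <= kap x) -> 0 <= C ->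
  (forall n, lam n `^ mu * (\int[leb]_(x in D) `|k n x|) <= C * lam n `^ nu) ->
  (forall n, measurable_fun D (g ^~ n)) -> 0 <= B -> (forall x, D x -> nle nu B (g x)) ->
  \int[leb]_(x in D) kap x <= A ->
  nle mu (Num.sqrt (C * A) * B) (fun n => \int[leb]_(x in D) (k n x * g x n)).
Proof.
move=> mD ik ikap kkap C0 kC mg B0 gB kapA.
have kap0 x : D x -> 0 <= kap x by move=> Dx; apply: le_trans (kkap 0%N x Dx).
have A0 : 0 <= A by apply: le_trans kapA; exact: Rintegral_ge0.
pose G n := Num.sqrt (lam n `^ nu)^-1 * B.
have gG n x : D x -> `|g x n| <= G n by move=> Dx; exact: norm_le_coord_abs (gB x Dx).
have mg2 n : measurable_fun D (fun x => g x n ^+ 2) by exact: measurable_funX.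
have gG2 n x : D x -> `|g x n ^+ 2| <= G n ^+ 2.
  by move=> Dx; rewrite normrX lerXn2r ?nnegrE ?gG// (le_trans _ (gG n x Dx)).
have mS N : measurable_fun D (fun x => \sum_(n < N) lam n `^ nu * g x n ^+ 2).
  apply: measurable_sum => n; exact: measurable_funM.
have SB N x : D x -> `|\sum_(n < N) lam n `^ nu * g x n ^+ 2| <= B ^+ 2.
  move=> Dx; rewrite ger0_norm; first by have [_] := gB x Dx; exact.
  by apply: sumr_ge0 => i _; rewrite mulr_ge0 ?powR_ge0 ?sqr_ge0.
have iS N : leb.-integrable D (EFin \o (fun x => kap x * \sum_(n < N) lam n `^ nu * g x n ^+ 2)).
  by apply: (leb_integrableM _ _ _ _ (B ^+ 2)) => //; exact: SB.
have i1 n : leb.-integrable D (EFin \o (fun x => kap x * (lam n `^ nu * g x n ^+ 2))).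
  apply: (leb_integrableM _ _ _ _ (lam n `^ nu * G n ^+ 2)) => //.
    exact: measurable_funM.
  by move=> x Dx; rewrite normrM ger0_norm ?powR_ge0// ler_wpM2l ?powR_ge0// gG2.
split; first by rewrite mulr_ge0 ?sqrtr_ge0.
move=> N; rewrite exprMn sqr_sqrtr ?mulr_ge0//.
apply: (@le_trans _ _ (C * \sum_(n < N) \int[leb]_(x in D) (kap x * (lam n `^ nu * g x n ^+ 2)))).
  rewrite mulr_sumr; apply: ler_sum => n _.
  have CS := weighted_cauchy_schwarz R D (k n) (g ^~ n) (G n) mD (ik n) (mg n) (gG n).
  have Q0 : 0 <= \int[leb]_(x in D) (`|k n x| * g x n ^+ 2).
    by apply: Rintegral_ge0 => x _; rewrite mulr_ge0// sqr_ge0.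
  apply: (le_trans (ler_wpM2l (powR_ge0 _ _) CS)).
  rewrite mulrA; apply: (le_trans (ler_wpM2r Q0 (kC n))).
  rewrite -mulrA; apply: ler_wpM2l => //.
  have ikg2 : leb.-integrable D (EFin \o (fun x => `|k n x| * g x n ^+ 2)).
    apply: (leb_integrableM _ _ _ _ (G n ^+ 2)) => //; first exact: leb_integrable_norm.
    exact: gG2.
  rewrite -RintegralZl//; apply: le_Rintegral => //.
    exact: leb_integrableZ.
  move=> x Dx; rewrite mulrCA; apply: ler_wpM2r; last exact: kkap.
  by rewrite mulr_ge0 ?powR_ge0 ?sqr_ge0.
have -> : \sum_(n < N) \int[leb]_(x in D) (kap x * (lam n `^ nu * g x n ^+ 2)) =
    \int[leb]_(x in D) (kap x * \sum_(n < N) lam n `^ nu * g x n ^+ 2).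
  elim: N => [|N IH].
    rewrite big_ord0; under eq_Rintegral do rewrite big_ord0 mulr0.
    by rewrite Rintegral_cst// mul0r.
  rewrite big_ord_recr /= IH -RintegralD//.
  by apply: eq_Rintegral => x _; rewrite big_ord_recr /= mulrDr.
rewrite -mulrA; apply: ler_wpM2l => //.
apply: (@le_trans _ _ (\int[leb]_(x in D) (B ^+ 2 * kap x))).
  apply: le_Rintegral => //; first exact: leb_integrableZ.
  move=> x Dx; rewrite mulrC ler_wpM2r ?kap0//.
  by have [_] := gB x Dx; exact.
by rewrite RintegralZl// mulrC ler_wpM2r// sqr_ge0.
Qed.

(** Minkowski's integral inequality: for a kernel independent of n, both constants of
    [kernel_estimate] are the integral of |k|. *)
Lemma kernel_estimate1 (D : set R) (k : R -> R) (x : R -> nat -> R) (mu B : R) :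
  measurable D -> leb.-integrable D (EFin \o k) ->
  (forall n, measurable_fun D (x ^~ n)) -> 0 <= B -> (forall t, D t -> nle mu B (x t)) ->
  nle mu ((\int[leb]_(t in D) `|k t|) * B) (fun n => \int[leb]_(t in D) (k t * x t n)).
Proof.
move=> mD ik mx B0 xB; set P := \int[leb]_(t in D) `|k t|.
have P0 : 0 <= P by exact: Rintegral_ge0.
have -> : P = Num.sqrt (P * P) by rewrite -expr2 sqrtr_sqr ger0_norm.
apply: (kernel_estimate D (fun=> k) (fun t => `|k t|) x mu mu) => //.
- exact: leb_integrable_norm.
- by move=> n; rewrite mulrC.
Qed.

Definition path_cont (rho T : R) (x : R -> nat -> R) :=
  forall t0, t0 \in `[0, T] -> forall eps, 0 < eps -> exists2 del : R, 0 < del &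
  forall t, t \in `[0, T] -> `|t - t0| < del -> nle rho eps (fun n => x t n - x t0 n).

Lemma nbhs_dist_lt (s e : R) : 0 < e -> \forall t \near s, `|t - s| < e.
Proof. by move=> e0; exists e => // t /=; rewrite distrC. Qed.

Lemma path_ucont (rho T : R) (x : R -> nat -> R) : path_cont rho T x ->
  forall eps, 0 < eps -> exists2 del : R, 0 < del &
  forall s t, s \in `[0, T] -> t \in `[0, T] -> `|t - s| < del ->
    nle rho eps (fun n => x t n - x s n).
Proof.
move=> xc eps e0; have cT : compact `[0, T]%classic by exact: segment_compact.
have e20 : 0 < eps / 2 by rewrite divr_gt0.
(* Compactness in the form: a property valid jointly for s' near each s and for small d holds, for
   all small d, at every point of the interval. *)
have /= := (compact_near_coveringP `[0, T]%classic).1 cT R (0 : R)^'+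
  (fun d s => s \in `[0, T] -> forall t, t \in `[0, T] -> `|t - s| < d ->
    nle rho eps (fun n => x t n - x s n)) _.
have H : forall s : R, `[0, T]%classic s -> \forall s' \near s & d \near (0 : R)^'+,
    s' \in `[0, T] -> forall t, t \in `[0, T] -> `|t - s'| < d ->
    nle rho eps (fun n => x t n - x s' n).
  move=> s sT; have [del d0 hd] := xc s sT _ e20.
  near=> s' d => /= s'T t tT ts'.
  have s's : `|s' - s| < del / 2 by near: s'; apply: nbhs_dist_lt; rewrite divr_gt0.
  have dd : d < del / 2 by near: d; apply: nbhs_right_lt; rewrite divr_gt0.
  rewrite [eps](splitr eps); apply: (norm_le_trans _ _ lam_gt0 _ _ _ _ (x s)).
  - apply: hd => //; rewrite -(subrKA s') (le_lt_trans (ler_normD _ _))//; lra.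
  - apply: norm_leBC => //; apply: hd => //; lra.
move=> /(_ _ H) hn.
have : \forall d \near (0:R)^'+, 0 < d /\ (forall s, s \in `[0, T] -> forall t, t \in `[0, T] -> `|t - s| < d ->
    nle rho eps (fun n => x t n - x s n)).
  near=> d; split; first by near: d; exact: nbhs_right_gt.
  by move=> s sT; have := near hn d; apply => //.
move=> /filter_ex[d [d0 hd]]; exists d => // s t sT tT; exact: hd.
Unshelve. all: by end_near. Qed.

(** By uniform continuity the norm grows by at most 1 over each time step of length del / 2, and [N]
    steps reach the end of the interval. *)
Lemma path_bounded (rho T : R) (x : R -> nat -> R) : 0 <= T -> path_cont rho T x ->
  (forall t, t \in `[0, T] -> exists B, nle rho B (x t)) ->
  exists2 B : R, 0 < B & forall t, t \in `[0, T] -> nle rho B (x t).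
Proof.
move=> T0 xc xB; have [del d0 hd] := path_ucont rho T x xc 1 ltr01.
pose N := (Num.truncn (T / (del / 2))).+1.
have [B0 hB0] : exists B, nle rho B (x 0) by apply: xB; rewrite in_itv /= lexx.
have key k t : t \in `[0, T] -> t <= k%:R * (del / 2) -> nle rho (B0 + k%:R) (x t).
  elim: k t => [|k IH] t tT tk.
    have -> : t = 0 by apply/le_anti; move: tT tk; rewrite in_itv /= mul0r => /andP[-> _ ->].
    by rewrite addr0.
  have [tk'|tk'] := leP t (k%:R * (del / 2)).
    by apply: norm_le_weaken (IH t tT tk'); rewrite lerD2l ler_nat.
  have sT : k%:R * (del / 2) \in `[0, T].
    rewrite in_itv /=; move: tT; rewrite in_itv /= => /andP[_ tT].
    apply/andP; split; first by rewrite mulr_ge0// divr_ge0// ltW.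
    exact: ltW (lt_le_trans tk' tT).
  have := norm_leD _ _ lam_gt0 _ _ _ _ _ (IH _ sT (lexx _)) (hd _ t sT tT _).
  rewrite -addrA natr1 => h; apply: norm_le_ext (h _) => [n|]; first by rewrite addrC subrK.
  rewrite ger0_norm; last by lra.
  by move: tk; rewrite -natr1 mulrDl mul1r; lra.
exists (`|B0| + N%:R + 1); first by rewrite ltr_wpDl// addr_ge0.
move=> t tT; apply: norm_le_weaken (key N t tT _).
  by rewrite -addrA lerD ?ler_norm// lerDl.
move: tT; rewrite in_itv /= => /andP[_ tT]; apply: (le_trans tT).
rewrite -ler_pdivrMr ?divr_gt0//; apply: ltW; rewrite /N.
exact: truncnS_gt.
Qed.

Lemma path_coord_cont (rho T : R) (x : R -> nat -> R) n : path_cont rho T x ->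
  {within `[0, T], continuous (x ^~ n)}.
Proof.
move=> xc; apply/subspace_continuousP => t0 t0T; apply/cvgrPdist_lt => eps e0.
pose c := Num.sqrt (lam n `^ rho)^-1.
have c0 : 0 < c by rewrite sqrtr_gt0 invr_gt0 powR_gt0.
have [|del d0 hd] := xc t0 t0T (c^-1 * (eps / 2)).
  by rewrite mulr_gt0 ?invr_gt0// divr_gt0.
rewrite near_withinE; near=> t => tT.
have := norm_le_coord_abs _ _ lam_gt0 _ _ _ n (hd t tT _).
rewrite -/c mulVKf ?gt_eqF// distrC => h.
rewrite /from_subspace distrC.
apply: (@le_lt_trans _ _ (eps / 2)); last by lra.
by apply: h; rewrite distrC; near: t; exact: nbhs_dist_lt.
Unshelve. all: by end_near. Qed.

Lemma path_coord_measurable (rho T t : R) (x : R -> nat -> R) n : path_cont rho T x ->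
  t <= T -> measurable_fun `]0, t[ (x ^~ n).
Proof.
move=> xc tT; apply: within_continuous_measurable.
apply: continuous_subspaceW (path_coord_cont _ _ _ n xc) => s /=; rewrite !in_itv /=.
by move=> /andP[-> /le_trans]; exact.
Qed.

End coefficient_estimates.

(** * The Duhamel operator, for kernels [w n] with the properties established for
    [omega m (lam n)] *)

Section duhamel.
Context (R : realType) (lam : nat -> R) (lam_gt0 : forall n, 0 < lam n).
Local Notation leb := (@lebesgue_measure R).
Local Notation mR := (measurableTypeR R).
Local Notation nle := (@norm_le R lam).
Context (w : nat -> R -> R).
Hypothesis w_cont : forall n, {within `[0, +oo[, continuous (w n)}.
Hypothesis w_ge0 : forall n t, 0 <= t -> 0 <= w n t.
Hypothesis w_noninc : forall n s t, 0 <= s -> s <= t -> w n t <= w n s.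
Hypothesis w_le1 : forall n t, 0 <= t -> w n t <= 1.
Hypothesis w_antitone : forall n t, 0 <= t -> w n t <= w 0%N t.
Hypothesis w_int : forall n t, 0 <= t -> lam n * (\int[leb]_(x in `]0, t[) w n x) <= 1.
Hypothesis w_diff : forall n t h, 0 < t -> 0 < h -> w n t - w n (t + h) <= h / t.
Context (mu theta : R) (mutheta : mu = 1 - theta).

Definition semigroup (xi : nat -> R) (t : R) (n : nat) : R := w n t * xi n.

Definition duhamel (g : R -> nat -> R) (t : R) (n : nat) : R :=
  \int[leb]_(s in `]0, t[) (w n (t - s) * g s n).

Lemma w_norm_le1 n t : 0 <= t -> `|w n t| <= 1.
Proof. by move=> t0; rewrite ger0_norm ?w_le1 ?w_ge0. Qed.

Lemma measurable_w n (t : R) : measurable_fun `]0, t[ (w n).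
Proof. exact: within_continuous_measurable (within_continuous_itv _ _ _ (w_cont n)). Qed.

Lemma measurable_w_cc n (t : R) : measurable_fun `[0, t] (w n).
Proof.
by apply: subspace_continuous_measurable_fun => //; exact: within_continuous_itv.
Qed.

Lemma integrable_w n (t : R) : leb.-integrable `]0, t[ (EFin \o w n).
Proof.
apply: (integrable_bounded _ _ _ 1) => //.
- exact: lebesgue_itv_lty.
- exact: measurable_w.
- by move=> x; rewrite /= in_itv /= => /andP[/ltW x0 _]; exact: w_norm_le1.
Qed.

Lemma integrable_w_reflect n (t : R) : leb.-integrable `]0, t[ (EFin \o (fun s => w n (t - s))).
Proof. exact: integrable_reflect_itv (integrable_w n t). Qed.

Lemma weight_shift n : lam n `^ mu = lam n * lam n `^ (- theta).
Proof.
rewrite mutheta powRD; last by apply/implyP => _; rewrite gt_eqF.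
by rewrite powRr1// ltW.
Qed.

(** The smoothing hypothesis of [kernel_estimate] with constant 1; this is where the relation
    between [mu] and [theta] enters. *)
Lemma weight_int n (D : set R) (k : R -> R) : lam n * (\int[leb]_(x in D) `|k x|) <= 1 ->
  lam n `^ mu * (\int[leb]_(x in D) `|k x|) <= 1 * lam n `^ (- theta).
Proof.
move=> h; rewrite weight_shift mulrAC mul1r.
by rewrite -[leRHS]mul1r ler_wpM2r// powR_ge0.
Qed.

Lemma w_int_reflect n t : 0 <= t -> lam n * (\int[leb]_(s in `]0, t[) w n (t - s)) <= 1.
Proof. by move=> t0; rewrite Rintegral_reflect_itv ?w_int//; exact: measurable_w. Qed.

Lemma integral_w0_le t : 0 <= t -> \int[leb]_(s in `]0, t[) w 0%N (t - s) <= (lam 0%N)^-1.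
Proof. by move=> t0; rewrite -[leRHS]mul1r ler_pdivlMr// mulrC w_int_reflect. Qed.

(** [kernel_estimate] with majorant [w 0], the largest of the kernels, whose integral is at most the
    inverse of [lam 0]. As indices start at 0, [lam 0] is the first eigenvalue. *)
Lemma duhamel_bound (g : R -> nat -> R) (B t : R) : 0 <= t -> 0 <= B ->
  (forall n, measurable_fun `]0, t[ (g ^~ n)) ->
  (forall s, s \in `]0, t[ -> nle (- theta) B (g s)) ->
  nle mu ((Num.sqrt (lam 0%N))^-1 * B) (duhamel g t).
Proof.
move=> t0 B0 mg gB.
rewrite -sqrtrV; last exact: ltW.
rewrite -[(lam 0%N)^-1]mul1r.
apply: (kernel_estimate _ _ lam_gt0 `]0, t[ (fun n s => w n (t - s)) (fun s => w 0%N (t - s)) g mu (- theta)) => //.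
- by move=> n; exact: integrable_w_reflect.
- exact: integrable_w_reflect.
- move=> n x; rewrite /= in_itv /= => /andP[x0 xt].
  have tx : 0 <= t - x by lra.
  by rewrite ger0_norm ?w_ge0// w_antitone.
- move=> n; apply: weight_int; rewrite (_ : Rintegral _ _ _ = \int[leb]_(s in `]0, t[) w n (t - s)) ?w_int_reflect//.
  apply: eq_Rintegral => x; rewrite inE /= in_itv /= => /andP[x0 xt].
  by rewrite ger0_norm// w_ge0//; lra.
- exact: integral_w0_le.
Qed.

Lemma integrable_w_sub n t (a b : R) (b0 b1 : bool) : 0 <= a -> b <= t ->
  leb.-integrable [set` Interval (BSide b0 a) (BSide b1 b)] (EFin \o (fun s => w n (t - s))).
Proof.
move=> a0 bt.
have mw' : measurable_fun `[0, t] (fun s => w n (t - s)).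
  have := measurable_fun_reflect R _ _ t `[0, t] (w n) (measurable_itv _) (measurable_w_cc n t).
  congr (measurable_fun _ _); apply/seteqP; split => s /=; rewrite /reflect_fun !in_itv /=; lra.
apply: (integrable_bounded _ _ _ 1) => //.
- exact: lebesgue_itv_lty.
- apply: measurable_funS mw' => //; apply: subset_itv.
  + by case: b0; rewrite bnd_simp.
  + by case: b1; rewrite bnd_simp.
- move=> x /=; rewrite in_itv /= => /andP[ax xb].
  apply: w_norm_le1; rewrite subr_ge0.
  by move: xb; case: b1 => /= [/ltW|] xb; exact: le_trans bt.
Qed.

(** [kernel_estimate] with the majorant 1, whose integral is the length of the interval: the
    constant is small on short time intervals, whatever the size of the eigenvalues. *)
Lemma duhamel_short (g : R -> nat -> R) (B t a : R) : 0 <= a -> a <= t -> 0 <= B ->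
  (forall n, measurable_fun `]a, t[ (g ^~ n)) ->
  (forall s, s \in `]a, t[ -> nle (- theta) B (g s)) ->
  nle mu (Num.sqrt (t - a) * B) (fun n => \int[leb]_(s in `]a, t[) (w n (t - s) * g s n)).
Proof.
move=> a0 at_ B0 mg gB; rewrite -[t - a]mul1r.
have t0 := le_trans a0 at_.
apply: (kernel_estimate _ _ lam_gt0 _ (fun n s => w n (t - s)) (fun=> 1) g mu (- theta)) => //.
- by move=> n; exact: integrable_w_sub.
- exact: leb_integrable_cst.
- move=> n x; rewrite /= in_itv /= => /andP[ax xt].
  by apply: w_norm_le1; lra.
- move=> n; apply: weight_int; apply: le_trans (w_int_reflect n t t0).
  apply: ler_wpM2l; first exact: ltW.
  rewrite (_ : Rintegral _ _ _ = \int[leb]_(s in `]a, t[) w n (t - s)); last first.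
    apply: eq_Rintegral => x; rewrite inE /= in_itv /= => /andP[x0 xt].
    by rewrite ger0_norm// w_ge0//; lra.
  apply: ge0_subset_Rintegral => //.
  + exact: integrable_w_reflect.
  + by move=> x; rewrite /= in_itv /= => /andP[x0 xt]; apply: w_ge0; lra.
  + by apply: subset_itv; rewrite bnd_simp.
- rewrite Rintegral_cst//= lebesgue_measure_itv /= lte_fin mul1r.
  by case: ltP => // _; rewrite /= subr_ge0.
Qed.

Lemma integrable_duhamel (g : R -> nat -> R) (B t a b : R) (b0 b1 : bool) n : 0 <= a -> b <= t ->
  measurable_fun [set` Interval (BSide b0 a) (BSide b1 b)] (g ^~ n) ->
  (forall s, s \in Interval (BSide b0 a) (BSide b1 b) -> nle (- theta) B (g s)) ->
  leb.-integrable [set` Interval (BSide b0 a) (BSide b1 b)] (EFin \o (fun s => w n (t - s) * g s n)).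
Proof.
move=> a0 bt mg gB.
apply: (leb_integrableM _ _ _ _ (Num.sqrt (lam n `^ (- theta))^-1 * B)) => //.
- exact: integrable_w_sub.
- by move=> x; rewrite /= => /gB; exact: norm_le_coord_abs.
Qed.

Lemma duhamel_split (g : R -> nat -> R) (B t a : R) n : 0 <= a -> a <= t ->
  measurable_fun `]0, t[ (g ^~ n) ->
  (forall s, s \in `]0, t[ -> nle (- theta) B (g s)) ->
  duhamel g t n = (\int[leb]_(s in `]0, a[) (w n (t - s) * g s n)) +
                  \int[leb]_(s in `]a, t[) (w n (t - s) * g s n).
Proof. by move=> a0 at_ mg gB; apply: Rintegral_split => //; exact: (integrable_duhamel _ B). Qed.

Lemma sqrt_step (s h : R) : 0 < h -> 0 < s -> Num.sqrt h <= s -> h / s <= Num.sqrt h.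
Proof.
move=> h0 s0 hs; rewrite ler_pdivrMr// -{1}(sqr_sqrtr (ltW h0)) expr2.
by rewrite ler_wpM2l// sqrtr_ge0.
Qed.

(* w n s - w n (s + h) is at most 1 for s < sqrt h and at most h / s <= sqrt h
   otherwise, uniformly in n. *)
Lemma duhamel_shift (g : R -> nat -> R) (B T t h : R) : 0 <= t -> 0 < h -> t + h <= T -> 0 <= B ->
  (forall n, measurable_fun `]0, t[ (g ^~ n)) ->
  (forall s, s \in `]0, t[ -> nle (- theta) B (g s)) ->
  nle mu (Num.sqrt (Num.sqrt h * (1 + T)) * B)
    (fun n => \int[leb]_(s in `]0, t[) ((w n (t + h - s) - w n (t - s)) * g s n)).
Proof.
move=> t0 h0 thT B0 mg gB; set q := Num.sqrt h.
have q0 : 0 < q by rewrite sqrtr_gt0.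
have T0 : 0 <= T by lra.
pose kap (s : R) := \1_`]t - q, t[ s + q.
have i1 : leb.-integrable `]0, t[ (EFin \o (\1_`]t - q, t[ : R -> R)).
  apply: (integrable_bounded _ _ _ 1) => //; first exact: lebesgue_itv_lty.
  by move=> x _; rewrite ger0_norm// indicE; case: (_ \in _).
have ikap : leb.-integrable `]0, t[ (EFin \o kap).
  by apply: leb_integrableD => //; exact: leb_integrable_cst.
have ik n : leb.-integrable `]0, t[ (EFin \o (fun s => w n (t + h - s) - w n (t - s))).
  apply: leb_integrableB => //; last exact: integrable_w_reflect.
  by apply: integrable_w_sub => //; lra.
have kE n s : s \in `]0, t[ -> `|w n (t + h - s) - w n (t - s)| = w n (t - s) - w n (t + h - s).
  rewrite in_itv /= => /andP[s0 st]; rewrite ler0_norm ?opprB// subr_le0.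
  by apply: w_noninc; lra.
rewrite -[q * (1 + T)]mul1r.
apply: (kernel_estimate _ _ lam_gt0 `]0, t[ (fun n s => w n (t + h - s) - w n (t - s)) kap g mu (- theta)) => //.
- move=> n s /= st; rewrite kE//; move: (st); rewrite in_itv /= => /andP[s0 s_lt].
  rewrite /kap indicE; have [sq|sq] := boolP (s \in `]t - q, t[%classic).
    have := w_le1 n (t - s); have := w_ge0 n (t + h - s) => h1 h2.
    apply: (@le_trans _ _ 1); last by rewrite lerDl ltW.
    apply: (@le_trans _ _ (w n (t - s))); last by apply: h2; lra.
    by rewrite lerBlDr lerDl; apply: h1; lra.
  have qs : q <= t - s.
    by rewrite leNgt; apply/negP => hlt; move/negP: sq; apply; rewrite inE /= in_itv /=; apply/andP; split; lra.
  rewrite add0r (_ : t + h - s = (t - s) + h); last by ring.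
  by apply: le_trans (w_diff n (t - s) h _ h0) _; [lra|apply: sqrt_step => //; lra].
- move=> n; apply: weight_int; apply: le_trans (w_int_reflect n t t0).
  apply: ler_wpM2l; first exact: ltW.
  apply: le_Rintegral => //=.
  + by apply: leb_integrable_norm.
  + exact: integrable_w_reflect.
  + move=> s st; rewrite kE//; move: st; rewrite in_itv /= => /andP[s0 st].
    by rewrite lerBlDr lerDl; apply: w_ge0; lra.
(* The indicator contributes at most q, since []t - q, t[] has length q even if it leaves []0, t[];
   the constant q contributes at most q T. *)
- rewrite RintegralD//; last exact: leb_integrable_cst.
  rewrite Rintegral_cst//= mulrDr mulr1; apply: lerD.
    rewrite /Rintegral integral_indic//.
    have sub : (leb (`](t - q)%R, t[ `&` `]0%R, t[) <= leb `](t - q)%R, t[)%E.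
      by apply: le_measure; rewrite ?inE//; exact: measurableI.
    rewrite -lee_fin fineK; last first.
      by rewrite ge0_fin_numE//; apply: le_lt_trans sub _; exact: lebesgue_itv_lty.
    apply: le_trans sub _; rewrite lebesgue_measure_itv /= lte_fin; case: ifP => _; last by rewrite lee_fin ltW.
    by rewrite -EFinB lee_fin; lra.
  rewrite lebesgue_measure_itv /= lte_fin ler_wpM2l//; first exact: ltW.
  by case: ifP => _ /=; lra.
Qed.

(** The increment is the change of kernel on (0, t), of order h^{1/4}, plus the new contribution of
    (t, t + h), of order h^{1/2}. *)
Lemma duhamel_holder (g : R -> nat -> R) (B T t h : R) : 0 <= t -> 0 < h -> t + h <= T -> 0 <= B ->
  (forall n, measurable_fun `]0, t + h[ (g ^~ n)) ->
  (forall s, s \in `]0, t + h[ -> nle (- theta) B (g s)) ->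
  nle mu ((Num.sqrt (Num.sqrt h * (1 + T)) + Num.sqrt h) * B)
    (fun n => duhamel g (t + h) n - duhamel g t n).
Proof.
move=> t0 h0 thT B0 mg gB.
have tS s : s \in `]0, t[ -> s \in `]0, t + h[ by rewrite !in_itv /= => /andP[-> /lt_le_trans]; apply; lra.
have tS' s : s \in `]t, t + h[ -> s \in `]0, t + h[ by rewrite !in_itv /= => /andP[ts ->]; rewrite (le_lt_trans t0).
have mgt n : measurable_fun `]0, t[ (g ^~ n) by apply: measurable_funS (mg n) => // s /=; exact: tS.
have mgt' n : measurable_fun `]t, t + h[ (g ^~ n) by apply: measurable_funS (mg n) => // s /=; exact: tS'.
have N1 := duhamel_shift g B T t h t0 h0 thT B0 mgt (fun s hs => gB s (tS s hs)).
have N2 : nle mu (Num.sqrt (t + h - t) * B) (fun n => \int[leb]_(s in `]t, t + h[) (w n (t + h - s) * g s n)).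
  apply: duhamel_short => //; first by lra.
  by move=> s /tS'; exact: gB.
rewrite (_ : t + h - t = h) in N2; last by ring.
rewrite mulrDl; apply: norm_le_ext (norm_leD _ _ lam_gt0 _ _ _ _ _ N1 N2) => n.
rewrite (duhamel_split g B (t + h) t)//; last by lra.
rewrite addrAC; congr (_ + _); rewrite /duhamel -RintegralB//=.
- by apply: eq_Rintegral => s _; rewrite mulrBl.
- by apply: (integrable_duhamel _ B) => //; [lra|move=> s /tS; exact: gB].
- by apply: (integrable_duhamel _ B) => //; move=> s /tS; exact: gB.
Qed.

Lemma duhamelB (g1 g2 : R -> nat -> R) (B t : R) n :
  measurable_fun `]0, t[ (g1 ^~ n) -> measurable_fun `]0, t[ (g2 ^~ n) ->
  (forall s, s \in `]0, t[ -> nle (- theta) B (g1 s)) ->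
  (forall s, s \in `]0, t[ -> nle (- theta) B (g2 s)) ->
  duhamel (fun s n => g1 s n - g2 s n) t n = duhamel g1 t n - duhamel g2 t n.
Proof.
move=> m1 m2 g1B g2B; rewrite /duhamel -RintegralB//=.
- by apply: eq_Rintegral => s _; rewrite mulrBr.
- by apply: (integrable_duhamel _ B).
- by apply: (integrable_duhamel _ B).
Qed.

Lemma semigroup_bound rho (xi : nat -> R) (B t : R) : 0 <= t -> nle rho B xi ->
  nle rho B (semigroup xi t).
Proof.
move=> t0 xB; rewrite -[B]mul1r; apply: norm_leM => // n; exact: w_norm_le1.
Qed.

(** A quantity bounded by both 1 and x is bounded by x^{1/4}. This lowers the rate h / t of the
    semigroup to the exponent 1/4 of the Duhamel term. *)
Lemma le_root4 (d x : R) : 0 <= d -> d <= 1 -> d <= x -> d <= Num.sqrt (Num.sqrt x).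
Proof.
move=> d0 d1 dx; have dd : d <= Num.sqrt d.
  have s1 : Num.sqrt d <= 1 by rewrite -sqrtr1 ler_wsqrtr.
  by rewrite -{1}(sqr_sqrtr d0) expr2 ler_piMr// sqrtr_ge0.
apply: (le_trans dd); apply: ler_wsqrtr; apply: (le_trans dd); exact: ler_wsqrtr.
Qed.

Lemma semigroup_holder rho (xi : nat -> R) (B t h : R) : 0 < t -> 0 < h -> nle rho B xi ->
  nle rho (Num.sqrt (Num.sqrt (h / t)) * B) (fun n => semigroup xi (t + h) n - semigroup xi t n).
Proof.
move=> t0 h0 xB.
apply: norm_le_ext (norm_leM _ _ _ _ _ (fun n => w n (t + h) - w n t) _ _ _ xB) => [n||n].
- by rewrite /semigroup mulrBl.
- exact: sqrtr_ge0.
- have t0' := ltW t0; have th0 : 0 <= t + h by lra.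
  rewrite ler0_norm ?opprB; last by rewrite subr_le0; apply: w_noninc; lra.
  apply: le_root4; last exact: w_diff.
  + by rewrite subr_ge0; apply: w_noninc; lra.
  + by rewrite lerBlDr (le_trans (w_le1 n t t0'))// lerDl w_ge0.
Qed.

Lemma w_near (N : nat) (t0 eps : R) : 0 <= t0 -> 0 < eps ->
  exists2 del : R, 0 < del & forall t, 0 <= t -> `|t - t0| < del ->
    forall n, (n < N)%N -> `|w n t - w n t0| <= eps.
Proof.
move=> t00 e0; elim: N => [|N [del d0 hd]]; first by exists 1.
have /subspace_continuousP/(_ t0) := w_cont N.
rewrite /= in_itv /= t00 => /(_ isT)/cvgrPdist_lt/(_ _ e0).
rewrite near_withinE => /nbhs_ballP[del' /= d'0 hd'].
exists (Num.min del del'); first by rewrite lt_min d0.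
move=> t t_ge0; rewrite lt_min => /andP[h1 h2] n.
rewrite ltnS leq_eqVlt => /predU1P[->|]; last exact: hd.
rewrite distrC; apply: ltW; apply: hd'; last by rewrite /= in_itv /= t_ge0.
by rewrite /ball /= distrC.
Qed.

(** The kernels are not equicontinuous at time 0, so continuity is obtained for each fixed [xi]:
    [w_near] handles finitely many coordinates, and the increments, being bounded by those of [xi],
    are negligible in the others. *)
Lemma semigroup_cont rho (xi : nat -> R) (B T : R) : nle rho B xi ->
  path_cont R lam rho T (semigroup xi).
Proof.
move=> xB t0 t0T eps e0.
have [M [del d0 hM]] := norm_le_dominated _ _ lam_gt0 _ _ _ _ xB e0.
have t00 : 0 <= t0 by move: t0T; rewrite in_itv /= => /andP[].
have [del' d'0 hd] := w_near M t0 del t00 d0.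
exists del' => // t tT ht; have t_ge0 : 0 <= t by move: tT; rewrite in_itv /= => /andP[].
have E n : `|semigroup xi t n - semigroup xi t0 n| = `|w n t - w n t0| * `|xi n|.
  by rewrite -normrM mulrBl.
apply: hM => n => [|nM]; rewrite E; last by rewrite ler_wpM2r// hd.
rewrite ler_piMl//; have := w_ge0 n t t_ge0; have := w_ge0 n t0 t00.
have := w_le1 n t t_ge0; have := w_le1 n t0 t00.
by move=> h1 h2 h3 h4; rewrite ler_norml; apply/andP; split; lra.
Qed.

Context (T : R) (T_gt0 : 0 < T).

Lemma path_cont_mod rho (x : R -> nat -> R) :
  (forall eps, 0 < eps -> exists2 del : R, 0 < del & forall s h, 0 <= s -> 0 < h ->
     s + h <= T -> h < del -> nle rho eps (fun n => x (s + h) n - x s n)) ->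
  path_cont R lam rho T x.
Proof.
move=> hx t0 t0T eps e0; have [del d0 hd] := hx eps e0; exists del => // t tT ht.
move: tT t0T; rewrite !in_itv /= => /andP[t_ge0 tT] /andP[t00 t0T].
have [tt|tt|tt] := ltgtP t t0.
- apply: norm_leBC => //.
  have := hd t (t0 - t) t_ge0; rewrite (_ : t + (t0 - t) = t0); last by ring.
  apply; [lra|lra|]; move: ht; rewrite ltr0_norm; lra.
- have := hd t0 (t - t0) t00; rewrite (_ : t0 + (t - t0) = t); last by ring.
  apply; [lra|lra|]; move: ht; rewrite gtr0_norm; lra.
- by rewrite tt; apply: norm_le_diff0; first exact: ltW.
Qed.

Lemma duhamel_cont (g : R -> nat -> R) (B : R) : 0 <= B ->
  (forall n, measurable_fun `]0, T[ (g ^~ n)) ->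
  (forall s, s \in `]0, T[ -> nle (- theta) B (g s)) ->
  path_cont R lam mu T (duhamel g).
Proof.
move=> B0 mg gB; apply: path_cont_mod => eps e0.
have e2 : 0 < eps / 2 by rewrite divr_gt0.
have [z z0 hzB] := small_factor R B _ B0 e2.
have T1 : 0 < 1 + T by rewrite addr_gt0.
(* If Num.sqrt h <= z2, then Num.sqrt h * (1 + T) <= z^2, so the first root in [duhamel_holder] is
   at most [z]; the second is at most [z] when h <= z^2. *)
pose z2 := z ^+ 2 / (1 + T).
have z20 : 0 < z2 by rewrite divr_gt0// exprn_gt0.
exists (Num.min (z2 ^+ 2) (z ^+ 2)); first by rewrite lt_min !exprn_gt0.
move=> s h s0 h0 shT; rewrite lt_min => /andP[/ltW h1 /ltW h2].
have shS r : r \in `]0, s + h[ -> r \in `]0, T[ by rewrite !in_itv /= => /andP[-> /lt_le_trans]; exact.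
apply: (norm_le_weaken _ _ _ ((Num.sqrt (Num.sqrt h * (1 + T)) + Num.sqrt h) * B)); last first.
  apply: duhamel_holder => //; last by move=> r /shS; exact: gB.
  by move=> n; apply: measurable_funS (mg n) => // r /=; exact: shS.
have hz : Num.sqrt h <= z by rewrite -(ger0_norm (ltW z0)) -sqrtr_sqr ler_wsqrtr.
have hz2 : Num.sqrt h <= z2 by rewrite -(ger0_norm (ltW z20)) -sqrtr_sqr ler_wsqrtr.
have hz3 : Num.sqrt (Num.sqrt h * (1 + T)) <= z.
  rewrite -(ger0_norm (ltW z0)) -sqrtr_sqr ler_wsqrtr//.
  by rewrite -ler_pdivlMr.
apply: (@le_trans _ _ ((z + z) * B)); first by rewrite ler_wpM2r// lerD.
by rewrite mulrDl ![z * B]mulrC [leRHS]splitr lerD.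
Qed.

(** * The memory operator on paths *)

Context (ell : R -> R) (iell : leb.-integrable `]0, T[ (EFin \o ell)).

Definition ell_norm : R := \int[leb]_(t in `]0, T[) `|ell t|.

Definition mem_path (x : R -> nat -> R) (t : R) (n : nat) : R :=
  \int[leb]_(s in `]0, t[) (ell (t - s) * x s n).

Lemma ell_norm_ge0 : 0 <= ell_norm.
Proof. exact: Rintegral_ge0. Qed.

Lemma integrable_ell (a t : R) : 0 <= a -> t <= T -> leb.-integrable `]a, t[ (EFin \o ell).
Proof. by move=> a0 tT; apply: integrableS iell => //; apply: subset_itv; rewrite bnd_simp. Qed.

Lemma ell_norm_sub (a t : R) : 0 <= a -> t <= T -> \int[leb]_(s in `]a, t[) `|ell s| <= ell_norm.
Proof.
move=> a0 tT; apply: ge0_subset_Rintegral => //; first exact: leb_integrable_norm.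
by apply: subset_itv; rewrite bnd_simp.
Qed.

Lemma mem_bound rho (x : R -> nat -> R) (B t : R) : 0 <= B -> t <= T ->
  (forall n, measurable_fun `]0, t[ (x ^~ n)) ->
  (forall s, s \in `]0, t[ -> nle rho B (x s)) ->
  nle rho (ell_norm * B) (mem_path x t).
Proof.
move=> B0 tT mx xB.
apply: (norm_le_weaken _ _ _ ((\int[leb]_(s in `]0, t[) `|ell (t - s)|) * B)).
  apply: ler_wpM2r => //.
  rewrite (Rintegral_reflect_itv _ _ (fun s => `|ell s|)); first exact: ell_norm_sub.
  by apply: measurableT_comp => //; apply: integrable_measurable; exact: integrable_ell.
apply: (kernel_estimate1 _ _ lam_gt0 `]0, t[ (fun s => ell (t - s)) x) => //.
by apply: integrable_reflect_itv; exact: integrable_ell.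
Qed.

Lemma integrable_mem rho (x : R -> nat -> R) (B t : R) n : t <= T ->
  measurable_fun `]0, t[ (x ^~ n) -> (forall s, s \in `]0, t[ -> nle rho B (x s)) ->
  leb.-integrable `]0, t[ (EFin \o (fun s => ell (t - s) * x s n)).
Proof.
move=> tT mx xB; apply: (leb_integrableM _ _ _ _ (Num.sqrt (lam n `^ rho)^-1 * B)) => //.
- by apply: integrable_reflect_itv; exact: integrable_ell.
- by move=> s /= /xB; exact: norm_le_coord_abs.
Qed.

Lemma mem_pathB rho (x y : R -> nat -> R) (B t : R) n : t <= T ->
  measurable_fun `]0, t[ (x ^~ n) -> (forall s, s \in `]0, t[ -> nle rho B (x s)) ->
  measurable_fun `]0, t[ (y ^~ n) -> (forall s, s \in `]0, t[ -> nle rho B (y s)) ->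
  mem_path x t n - mem_path y t n = mem_path (fun s n => x s n - y s n) t n.
Proof.
move=> tT mx xB my yB; rewrite /mem_path -RintegralB//=.
- by apply: eq_Rintegral => s _; rewrite mulrBr.
- exact: integrable_mem xB.
- exact: integrable_mem yB.
Qed.

Lemma mem_path_reflect (x : R -> nat -> R) (t : R) n : t <= T ->
  measurable_fun `]0, t[ (x ^~ n) ->
  mem_path x t n = \int[leb]_(s in `]0, t[) (ell s * x (t - s) n).
Proof.
move=> tT mx; rewrite -(Rintegral_reflect_itv _ t (fun s => ell s * x (t - s) n)).
  by apply: eq_Rintegral => s _; rewrite (_ : t - (t - s) = s)//; ring.
apply: measurable_funM; first by apply: integrable_measurable; exact: integrable_ell.
exact: (measurable_fun_reflect_itv _ _ (x ^~ n)).
Qed.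

Lemma ell_abs_cont (eps : R) : 0 < eps -> exists2 del : R, 0 < del &
  forall s h, 0 <= s -> 0 < h -> s + h <= T -> h < del ->
    \int[leb]_(u in `]s, s + h[) `|ell u| <= eps.
Proof.
move=> e0.
have iell' : leb.-integrable setT (EFin \o (ell \_ `]0, T[)) by exact: integrable_patch0.
have [del [d0 hd]] := @integral_normr_continuous _ mR R leb _ iell' eps e0.
exists del => // s h s0 h0 shT hdel.
have hl : (leb `]s, (s + h)%R[%classic < del%:E)%E.
  by rewrite lebesgue_measure_itv /= lte_fin ltrDl h0 -EFinB lte_fin [s + h]addrC addrK.
have /ltW := hd `]s, s + h[%classic (measurable_itv _) hl.
apply: le_trans; rewrite le_eqVlt; apply/orP; left; apply/eqP.
apply: eq_Rintegral => u; rewrite inE /= in_itv /= => /andP[su ush].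
by rewrite patchE ifT// inE /= in_itv /= (le_lt_trans s0)// (lt_le_trans ush)// addrC.
Qed.

(** [ell] is merely integrable, so the convolution is reflected to let the time shift act on [x].
    Uniform continuity of [x] controls the integral over (0, s), and absolute continuity of the
    integral of |ell| controls the one over (s, s + h). *)
Lemma mem_cont rho (x : R -> nat -> R) (B : R) : 0 < B -> path_cont R lam rho T x ->
  (forall s, s \in `[0, T] -> nle rho B (x s)) -> path_cont R lam rho T (mem_path x).
Proof.
move=> B0 xc xB; apply: path_cont_mod => eps e0.
have e2 : 0 < eps / 2 by rewrite divr_gt0.
have [z z0 hz] := small_factor R ell_norm _ ell_norm_ge0 e2.
have [d1 d10 h1] := path_ucont _ _ lam_gt0 _ _ _ xc z z0.
have [|d2 d20 h2] := ell_abs_cont (eps / 2 / B); first by rewrite !divr_gt0.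
exists (Num.min d1 d2); first by rewrite lt_min d10.
move=> s h s0 h0 shT; rewrite lt_min => /andP[hd1 hd2].
have sT : s <= T by lra.
have mx t n : t <= T -> measurable_fun `]0, t[ (x ^~ n) by exact: path_coord_measurable xc.
have mxr t n : t <= T -> measurable_fun `]0, t[ (fun u => x (t - u) n).
  by move=> tT; apply: (measurable_fun_reflect_itv _ _ (x ^~ n)); exact: mx.
have sS u : u \in `]0, s[ -> u \in `]0, s + h[ by rewrite !in_itv /= => /andP[-> us]; lra.
have sS' u : u \in `]s, s + h[ -> u \in `]0, s + h[ by rewrite !in_itv /= => /andP[us ->]; lra.
have ix t : 0 <= t -> t <= T -> forall n, leb.-integrable `]0, t[ (EFin \o (fun u => ell u * x (t - u) n)).
  move=> t0 tT n; apply: (leb_integrableM _ _ _ _ (Num.sqrt (lam n `^ rho)^-1 * B)) => //.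
  - exact: integrable_ell.
  - exact: mxr.
  - move=> u; rewrite /= in_itv /= => /andP[u0 ut]; apply: norm_le_coord_abs => //.
    by apply: xB; rewrite in_itv /=; lra.
have N1 : nle rho (eps / 2) (fun n => \int[leb]_(u in `]0, s[) (ell u * (x (s + h - u) n - x (s - u) n))).
  apply: (norm_le_weaken _ _ _ ((\int[leb]_(u in `]0, s[) `|ell u|) * z)).
    by apply: le_trans hz; apply: ler_wpM2r; [exact: ltW|exact: ell_norm_sub].
  apply: (kernel_estimate1 _ _ lam_gt0 `]0, s[ ell (fun u n => x (s + h - u) n - x (s - u) n)) => //.
  - exact: integrable_ell.
  - move=> n; apply: measurable_funB; last exact: mxr.
    by apply: measurable_funS (mxr (s + h) n shT) => // u /=; exact: sS.
  - exact: ltW.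
  - move=> u; rewrite /= in_itv /= => /andP[u0 us].
    apply: h1; rewrite ?in_itv /=; [lra|lra|].
    by rewrite (_ : s + h - u - (s - u) = h); [rewrite gtr0_norm|ring].
have N2 : nle rho (eps / 2) (fun n => \int[leb]_(u in `]s, s + h[) (ell u * x (s + h - u) n)).
  apply: (norm_le_weaken _ _ _ ((\int[leb]_(u in `]s, s + h[) `|ell u|) * B)).
    by rewrite -ler_pdivlMr//; exact: h2.
  apply: (kernel_estimate1 _ _ lam_gt0 `]s, s + h[ ell (fun u n => x (s + h - u) n)) => //.
  - exact: integrable_ell.
  - by move=> n; apply: measurable_funS (mxr (s + h) n shT) => // u /=; exact: sS'.
  - exact: ltW.
  - by move=> u; rewrite /= in_itv /= => /andP[us ush]; apply: xB; rewrite in_itv /=; lra.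
rewrite [eps]splitr; apply: norm_le_ext (norm_leD _ _ lam_gt0 _ _ _ _ _ N1 N2) => n.
rewrite !mem_path_reflect//; [|exact: mx|exact: mx].
rewrite [in RHS](Rintegral_split _ _ (s + h) s)//; [|lra|by apply: ix; lra].
rewrite [RHS]addrAC; congr (_ + _); rewrite -RintegralB//=.
- by apply: eq_Rintegral => u _; rewrite mulrBr.
- have := ix (s + h) _ shT n; move=> /(_ ltac:(lra)); apply: integrableS => //.
- exact: ix.
Qed.

(** * The Picard map for a nonlinearity acting on sequences *)

Context (Phi : (nat -> R) -> (nat -> R) -> nat -> R) (Lf Kf : R -> R).
Hypothesis Phi0 : Phi (fun=> 0) (fun=> 0) =1 fun=> 0.
Hypothesis Lf_ge0 : forall rho, 0 < rho -> 0 <= Lf rho.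
Hypothesis Kf_ge0 : forall rho, 0 < rho -> 0 <= Kf rho.
Hypothesis Phi_lip : forall rho rho' : R, 0 < rho -> 0 < rho' ->
  forall (x1 x2 y1 y2 : nat -> R) (d1 d2 : R),
  nle mu rho x1 -> nle mu rho x2 -> nle mu rho' y1 -> nle mu rho' y2 ->
  nle mu d1 (fun n => x1 n - x2 n) -> nle mu d2 (fun n => y1 n - y2 n) ->
  nle (- theta) (Lf rho * d1 + Kf rho' * d2) (fun n => Phi x1 y1 n - Phi x2 y2 n).

Definition forcing (x : R -> nat -> R) (t : R) : nat -> R := Phi (x t) (mem_path x t).

Definition picard (xi : nat -> R) (x : R -> nat -> R) (t : R) (n : nat) : R :=
  semigroup xi t n + duhamel (forcing x) t n.

Lemma picard_at0 xi x n : picard xi x 0 n = semigroup xi 0 n.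
Proof.
rewrite /picard /duhamel (_ : `]0, 0[%classic = set0) ?Rintegral_set0 ?addr0//.
by rewrite set_itv_ge ?bnd_simp ?ltxx.
Qed.

Definition admissible (rho : R) (x : R -> nat -> R) :=
  path_cont R lam mu T x /\ forall t, t \in `[0, T] -> nle mu rho (x t).

Lemma admissible_measurable rho x n (t : R) : admissible rho x -> t <= T ->
  measurable_fun `]0, t[ (x ^~ n).
Proof. by move=> [xc _] tT; exact: path_coord_measurable xc tT. Qed.

Lemma admissible_sub rho x (s t : R) : admissible rho x -> t <= T -> s \in `]0, t[ ->
  nle mu rho (x s).
Proof.
by move=> [_ xB] tT; rewrite in_itv /= => /andP[s0 st]; apply: xB; rewrite in_itv /=; lra.
Qed.

(** The added 1 keeps the radius positive when [ell] vanishes almost everywhere. Where no smallness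
    is required, any radius for the memory variable will do. *)
Lemma mem_radius rho : 0 < rho -> exists2 rho' : R, 0 < rho' & ell_norm * rho <= rho'.
Proof.
move=> rho0; exists (ell_norm * rho + 1); last by rewrite lerDl.
by rewrite ltr_wpDl// mulr_ge0 ?ell_norm_ge0// ltW.
Qed.

Section ball.
Context (rho rho' : R) (rho0 : 0 < rho) (rho'0 : 0 < rho') (hrho : ell_norm * rho <= rho').
Let c := Lf rho + Kf rho' * ell_norm.

Lemma lip_const_ge0 : 0 <= c.
Proof. by rewrite addr_ge0 ?mulr_ge0 ?Lf_ge0 ?Kf_ge0 ?ell_norm_ge0. Qed.

Lemma mem_ball x t : admissible rho x -> t \in `[0, T] -> nle mu rho' (mem_path x t).
Proof.
move=> xa; rewrite in_itv /= => /andP[t0 tT].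
apply: norm_le_weaken hrho _; apply: mem_bound => //; first exact: ltW.
- by move=> n; exact: admissible_measurable xa tT.
- by move=> s; exact: admissible_sub.
Qed.

Lemma mem_diff x y t d : admissible rho x -> admissible rho y -> 0 <= d -> t \in `[0, T] ->
  (forall s, s \in `]0, t[ -> nle mu d (fun n => x s n - y s n)) ->
  nle mu (ell_norm * d) (fun n => mem_path x t n - mem_path y t n).
Proof.
move=> xa ya d0; rewrite in_itv /= => /andP[t0 tT] xyd.
have mx n := admissible_measurable rho x n t xa tT.
have my n := admissible_measurable rho y n t ya tT.
apply: (norm_le_ext _ _ _ _ (mem_path (fun s n => x s n - y s n) t)) => [n|].
  rewrite (mem_pathB mu x y rho)// => s sT.
  - exact: (admissible_sub rho x s t xa tT sT).
  - exact: (admissible_sub rho y s t ya tT sT).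
by apply: mem_bound => // n; exact: measurable_funB.
Qed.

(** The distance of the paths is needed only up to time [t]; this causality is what the stepwise
    uniqueness argument relies on. *)
Lemma forcing_diff x y t d : admissible rho x -> admissible rho y -> 0 <= d -> t \in `[0, T] ->
  (forall s, s \in `[0, t] -> nle mu d (fun n => x s n - y s n)) ->
  nle (- theta) (c * d) (fun n => forcing x t n - forcing y t n).
Proof.
move=> xa ya d0 tT xyd; rewrite mulrDl -mulrA.
have t0 : 0 <= t by move: tT; rewrite in_itv /= => /andP[].
apply: Phi_lip => //; [exact: xa.2|exact: ya.2|exact: mem_ball|exact: mem_ball| |].
- by apply: xyd; rewrite in_itv /= t0 lexx.
- apply: mem_diff => // s; rewrite in_itv /= => /andP[s0 st]; apply: xyd.
  by rewrite in_itv /= !ltW.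
Qed.

Lemma zero_admissible r : 0 <= r -> admissible r (fun _ _ => 0).
Proof.
move=> r0; split=> [t0 _ e e0|t _]; last exact: norm_le0.
by exists 1 => // t _ _; apply: norm_le_diff0; first exact: ltW.
Qed.

Lemma forcing0 t : forcing (fun _ _ => 0) t =1 fun=> 0.
Proof.
move=> n; rewrite /forcing (_ : mem_path _ t = fun=> 0) ?Phi0//.
apply/funext => k; rewrite /mem_path; under eq_Rintegral do rewrite mulr0.
by rewrite Rintegral_cst// mul0r.
Qed.

(** The forcing is compared with that of the zero path, which vanishes by [Phi0]. *)
Lemma forcing_bound x t : admissible rho x -> t \in `[0, T] ->
  nle (- theta) (c * rho) (forcing x t).
Proof.
move=> xa tT.
apply: (norm_le_ext _ _ _ _ (fun n => forcing x t n - forcing (fun _ _ => 0) t n)) => [n|].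
  by rewrite forcing0 subr0.
apply: forcing_diff => //; [apply: zero_admissible; exact: ltW|exact: ltW|].
move=> s /= st; apply: (norm_le_ext _ _ _ _ (x s)) => [n|]; first by rewrite subr0.
by apply: xa.2; move: st tT; rewrite !in_itv /=; lra.
Qed.

(** Continuity in time is the source of the measurability of the coordinates of the forcing, on
    which all the integral estimates depend. *)
Lemma forcing_cont x : admissible rho x -> path_cont R lam (- theta) T (forcing x).
Proof.
move=> xa t0 t0T eps e0.
have e2 : 0 < eps / 2 by rewrite divr_gt0.
have [z1 z10 hz1] := small_factor R (Lf rho) _ (Lf_ge0 rho rho0) e2.
have [z2 z20 hz2] := small_factor R (Kf rho') _ (Kf_ge0 rho' rho'0) e2.
have [d1 d10 h1] := xa.1 t0 t0T z1 z10.
have [d2 d20 h2] := mem_cont mu x rho rho0 xa.1 xa.2 t0 t0T z2 z20.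
exists (Num.min d1 d2); first by rewrite lt_min d10.
move=> t tT; rewrite lt_min => /andP[hd1 hd2].
apply: (norm_le_weaken _ _ _ (Lf rho * z1 + Kf rho' * z2)); first by rewrite [leRHS]splitr lerD.
apply: Phi_lip => //; [exact: xa.2|exact: xa.2|exact: mem_ball|exact: mem_ball|exact: h1|exact: h2].
Qed.

Lemma forcing_measurable x n (t : R) : admissible rho x -> t <= T ->
  measurable_fun `]0, t[ (fun s => forcing x s n).
Proof. by move=> xa tT; exact: path_coord_measurable (forcing_cont x xa) tT. Qed.

Lemma forcing_sub x (s t : R) : admissible rho x -> t <= T -> s \in `]0, t[ ->
  nle (- theta) (c * rho) (forcing x s).
Proof.
by move=> xa tT; rewrite in_itv /= => /andP[s0 st]; apply: forcing_bound => //; rewrite in_itv /=; lra.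
Qed.

Lemma crho_ge0 : 0 <= c * rho.
Proof. by rewrite mulr_ge0 ?lip_const_ge0// ltW. Qed.

Lemma picard_cont xi x eta : nle mu eta xi -> admissible rho x ->
  path_cont R lam mu T (picard xi x).
Proof.
move=> xiE xa t0 t0T eps e0.
have e2 : 0 < eps / 2 by rewrite divr_gt0.
have [d1 d10 h1] := semigroup_cont mu xi eta T xiE t0 t0T (eps / 2) e2.
have [|||d2 d20 h2] := duhamel_cont (forcing x) (c * rho) _ _ _ t0 t0T (eps / 2) e2.
- exact: crho_ge0.
- by move=> n; exact: forcing_measurable.
- by move=> s; exact: forcing_sub.
exists (Num.min d1 d2); first by rewrite lt_min d10.
move=> t tT; rewrite lt_min => /andP[hd1 hd2].
rewrite [eps]splitr.
apply: norm_le_ext (norm_leD _ _ lam_gt0 _ _ _ _ _ (h1 t tT hd1) (h2 t tT hd2)) => n.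
by rewrite /picard opprD addrACA.
Qed.

Let q := (Num.sqrt (lam 0%N))^-1 * c.

Lemma picard_bound xi x eta t : nle mu eta xi -> admissible rho x -> t \in `[0, T] ->
  nle mu (eta + q * rho) (picard xi x t).
Proof.
move=> xiE xa; rewrite in_itv /= => /andP[t0 tT].
apply: norm_leD => //; first exact: semigroup_bound.
rewrite -mulrA; apply: duhamel_bound => //; first exact: crho_ge0.
- by move=> n; exact: forcing_measurable.
- by move=> s; exact: forcing_sub.
Qed.

Lemma picard_contraction xi x y d t : admissible rho x -> admissible rho y -> 0 <= d ->
  (forall s, s \in `[0, T] -> nle mu d (fun n => x s n - y s n)) -> t \in `[0, T] ->
  nle mu (q * d) (fun n => picard xi x t n - picard xi y t n).
Proof.
move=> xa ya d0 xyd; rewrite in_itv /= => /andP[t0 tT].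
have mx n := forcing_measurable x n t xa tT.
have my n := forcing_measurable y n t ya tT.
apply: (norm_le_ext _ _ _ _ (duhamel (fun s n => forcing x s n - forcing y s n) t)) => [n|].
  rewrite (duhamelB (forcing x) (forcing y) (c * rho))//.
  - have aux (a1 a2 a3 : R) : a2 - a3 = (a1 + a2) - (a1 + a3) by ring.
    exact: aux.
  - by move=> s; exact: forcing_sub.
  - by move=> s; exact: forcing_sub.
rewrite -mulrA; apply: duhamel_bound => //.
- by rewrite mulr_ge0// lip_const_ge0.
- by move=> n; exact: measurable_funB.
- move=> s; rewrite in_itv /= => /andP[s0 st]; apply: forcing_diff => //.
    by rewrite in_itv /=; lra.
  by move=> r; rewrite in_itv /= => /andP[r0 rs]; apply: xyd; rewrite in_itv /=; lra.
Qed.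

Context (eta : R) (hball : eta + q * rho <= rho) (q_lt1 : q < 1).

Lemma q_ge0 : 0 <= q.
Proof. by rewrite mulr_ge0 ?lip_const_ge0// invr_ge0 sqrtr_ge0. Qed.

Lemma picard_admissible xi x : nle mu eta xi -> admissible rho x -> admissible rho (picard xi x).
Proof.
move=> xiE xa; split; first exact: picard_cont xiE xa.
by move=> t tT; apply: norm_le_weaken hball _; exact: picard_bound.
Qed.

Definition picard_iter xi k : R -> nat -> R := iter k (picard xi) (fun _ _ => 0).

Lemma picard_iter_admissible xi k : nle mu eta xi -> admissible rho (picard_iter xi k).
Proof.
move=> xiE; elim: k => [|k IH]; first by apply: zero_admissible; exact: ltW.
exact: picard_admissible.
Qed.

Lemma picard_iter_step xi k t : nle mu eta xi -> t \in `[0, T] ->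
  nle mu (q ^+ k * rho) (fun n => picard_iter xi k.+1 t n - picard_iter xi k t n).
Proof.
move=> xiE; elim: k t => [|k IH] t tT.
  apply: (norm_le_ext _ _ _ _ (picard_iter xi 1 t)) => [n|]; first by rewrite subr0.
  by rewrite mul1r; exact: (picard_iter_admissible xi 1 xiE).2.
rewrite exprS -mulrA; apply: picard_contraction => //.
- exact: (picard_iter_admissible xi k.+1).
- exact: picard_iter_admissible.
- by rewrite mulr_ge0 ?exprn_ge0 ?q_ge0// ltW.
Qed.

Let C := rho / (1 - q).

Lemma picard_iter_cauchy xi k j t : nle mu eta xi -> t \in `[0, T] ->
  nle mu (q ^+ k * C) (fun n => picard_iter xi (k + j)%N t n - picard_iter xi k t n).
Proof.
move=> xiE tT.
have q1 : 0 < 1 - q by rewrite subr_gt0.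
have qk i : 0 <= q ^+ i by rewrite exprn_ge0 ?q_ge0.
(* The exact partial sum of the geometric series makes the induction on [j] close; the cruder bound
   is recovered from 1 - q^j <= 1. *)
suff H : nle mu (q ^+ k * (C * (1 - q ^+ j))) (fun n => picard_iter xi (k + j)%N t n - picard_iter xi k t n).
  apply: norm_le_weaken H; rewrite ler_wpM2l// ler_piMr//.
    by rewrite divr_ge0// ltW.
  by rewrite gerBl.
elim: j => [|j IH].
  by rewrite expr0 subrr !mulr0 addn0; exact: norm_le_diff0.
have := norm_leD _ _ lam_gt0 _ _ _ _ _ (picard_iter_step xi (k + j) t xiE tT) IH.
rewrite addnS; have -> : q ^+ (k + j) * rho + q ^+ k * (C * (1 - q ^+ j)) = q ^+ k * (C * (1 - q ^+ j.+1)).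
  by rewrite exprD exprS /C; field; rewrite gt_eqF.
by apply: norm_le_ext => n; rewrite addrA subrK.
Qed.

Lemma geometric_small (D eps : R) : 0 <= D -> 0 < eps -> exists N, forall k, (N <= k)%N -> q ^+ k * D < eps.
Proof.
move=> D0 e0.
have D1 : 0 < D + 1 by rewrite ltr_wpDl.
have /cvgrPdist_lt/(_ (eps / (D + 1)) (divr_gt0 e0 D1))[N _ hN] : q ^+ k @[k --> \oo] --> (0 : R).
  by apply: cvg_expr; rewrite ger0_norm ?q_ge0.
exists N => k /hN /=; rewrite sub0r normrN ger0_norm ?exprn_ge0 ?q_ge0// ltr_pdivlMr// => h.
by apply: le_lt_trans h; rewrite ler_wpM2l ?exprn_ge0 ?q_ge0// lerDl.
Qed.

Lemma picard_iter_cvg xi t n : nle mu eta xi -> t \in `[0, T] ->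
  cvg (picard_iter xi k t n @[k --> \oo]).
Proof.
move=> xiE tT; apply: cauchy_cvg; apply: cauchy_exP => eps e0.
pose b := Num.sqrt (lam n `^ mu)^-1.
have C0 : 0 <= C by rewrite divr_ge0 ?subr_ge0// ltW.
have [N hN] := geometric_small (b * C) eps (mulr_ge0 (sqrtr_ge0 _) C0) e0.
exists (picard_iter xi N t n); exists N => // k /= Nk.
have := norm_le_coord_abs _ _ lam_gt0 _ _ _ n (picard_iter_cauchy xi N (k - N) t xiE tT).
rewrite subnKC// /ball /= distrC => h; apply: (le_lt_trans h).
by rewrite -/b mulrCA; exact: hN.
Qed.

(** The limit is taken in each coordinate at each time separately. [norm_le_lim] then turns the
    Cauchy estimate into a bound on the distance to the limit that is uniform in time. *)
Definition picard_lim xi t n : R := lim (picard_iter xi k t n @[k --> \oo]).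

Lemma picard_lim_dist xi k t : nle mu eta xi -> t \in `[0, T] ->
  nle mu (q ^+ k * C) (fun n => picard_lim xi t n - picard_iter xi k t n).
Proof.
move=> xiE tT; apply: (norm_le_lim _ _ _ _ (fun j n => picard_iter xi j t n - picard_iter xi k t n)).
  by move=> n; apply: cvgB; [exact: picard_iter_cvg|exact: cvg_cst].
by exists k => // j /= kj; have := picard_iter_cauchy xi k (j - k) t xiE tT; rewrite subnKC.
Qed.

Lemma picard_lim_admissible xi : nle mu eta xi -> admissible rho (picard_lim xi).
Proof.
move=> xiE; have C0 : 0 <= C by rewrite divr_ge0 ?subr_ge0// ltW.
split=> [t0 t0T eps e0|t tT].
  have e3 : 0 < eps / 3 by rewrite divr_gt0.
  have [N /(_ N (leqnn N)) hN] := geometric_small C (eps / 3) C0 e3.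
  have [del d0 hd] := (picard_iter_admissible xi N xiE).1 t0 t0T (eps / 3) e3.
  exists del => // t tT ht.
  have D1 := norm_le_weaken _ _ _ _ _ _ (ltW hN) (picard_lim_dist xi N t xiE tT).
  have D2 := norm_le_weaken _ _ _ _ _ _ (ltW hN) (picard_lim_dist xi N t0 xiE t0T).
  have D3 := norm_leBC _ _ _ _ _ _ D2.
  have := norm_le_trans _ _ lam_gt0 _ _ _ _ _ _ (norm_le_trans _ _ lam_gt0 _ _ _ _ _ _ D1 (hd t tT ht)) D3.
  by apply: norm_le_weaken; lra.
apply: (norm_le_lim _ _ _ _ (fun j n => picard_iter xi j t n)).
  by move=> n; exact: picard_iter_cvg.
by apply: nearW => j; exact: (picard_iter_admissible xi j xiE).2.
Qed.

Lemma picard_lim_fixed xi t n : nle mu eta xi -> t \in `[0, T] ->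
  picard_lim xi t n = picard xi (picard_lim xi) t n.
Proof.
move=> xiE tT; apply/eqP; rewrite -subr_eq0; apply/eqP.
have C0 : 0 <= C by rewrite divr_ge0 ?subr_ge0// ltW.
move: n; apply: (norm_le_small _ _ lam_gt0 mu) => eps e0.
have e2 : 0 < eps / 2 by rewrite divr_gt0.
have [M hM] := geometric_small C (eps / 2) C0 e2.
have hM2 := hM M.+1 (leqnSn M).
have D1 := picard_lim_dist xi M.+1 t xiE tT.
have qC : 0 <= q ^+ M * C by rewrite mulr_ge0 ?exprn_ge0 ?q_ge0.
(* The iterate of index M.+1 is by definition the Picard image of the M-th one, so [D1] and [D2]
   share their middle term. *)
have D2 := picard_contraction xi (picard_iter xi M) (picard_lim xi) (q ^+ M * C) t
  (picard_iter_admissible xi M xiE) (picard_lim_admissible xi xiE) qC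
  (fun s sT => norm_leBC _ _ _ _ _ _ (picard_lim_dist xi M s xiE sT)) tT.
apply: norm_le_weaken (norm_le_trans _ _ lam_gt0 _ _ _ _ _ _ D1 D2).
by move: hM2; rewrite exprS -mulrA; lra.
Qed.

End ball.

(** * Existence, uniqueness and time regularity of fixed points *)

Definition solution xi x := forall t, t \in `[0, T] -> x t =1 picard xi x t.

Lemma picard_exists rho eta xi : 0 < rho -> (exists2 rho' : R, 0 < rho' &
    ell_norm * rho <= rho' /\
    let q := (Num.sqrt (lam 0%N))^-1 * (Lf rho + Kf rho' * ell_norm) in
    q < 1 /\ eta + q * rho <= rho) ->
  nle mu eta xi -> exists2 x, admissible rho x & solution xi x.
Proof.
move=> rho0 [rho' rho'0 [h1 [h2 h3]]] xiE.
exists (picard_lim xi); first exact: (picard_lim_admissible rho rho' rho0 rho'0 h1 eta h3 h2).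
by move=> t tT n; exact: (picard_lim_fixed rho rho' rho0 rho'0 h1 eta h3 h2).
Qed.

Lemma admissible_weaken rho rho1 x : rho <= rho1 -> admissible rho x -> admissible rho1 x.
Proof. by move=> h [xc xB]; split => // t tT; apply: norm_le_weaken h (xB t tT). Qed.

(* If two solutions agree on [0, a], their distance on [a, a + eps] is halved
   by the integral equation, hence vanishes. *)
Lemma solution_unique rho xi x y : 0 < rho -> admissible rho x -> admissible rho y ->
  solution xi x -> solution xi y -> forall t, t \in `[0, T] -> x t =1 y t.
Proof.
move=> rho0 xa ya xs ys.
have [rho' rho'0 hrho] := mem_radius rho rho0.
pose c := Lf rho + Kf rho' * ell_norm.
have c0 : 0 <= c by exact: lip_const_ge0.
(* This makes Num.sqrt eps * c at most 1/2. It does not depend on the time [a] reached so far, so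
   finitely many steps cover [[0, T]]. *)
pose eps := ((2 * (c + 1))^-1) ^+ 2.
have c1 : 0 < c + 1 by rewrite ltr_wpDl.
have i0 : 0 < (2 * (c + 1))^-1 by rewrite invr_gt0 mulr_gt0.
have eps0 : 0 < eps by rewrite exprn_gt0.
have sqrtE : Num.sqrt eps * c <= 2^-1.
  rewrite sqrtr_sqr ger0_norm ?(ltW i0)// invfM -mulrA ler_piMr ?invr_ge0//.
  by rewrite mulrC ler_pdivrMr// mul1r lerDl.
have step a : 0 <= a -> (forall t, t \in `[0, T] -> t <= a -> x t =1 y t) ->
    forall t, t \in `[0, T] -> t <= a + eps -> x t =1 y t.
  move=> a0 xya.
  have half k t : t \in `[0, T] -> t <= a + eps ->
      nle mu ((2^-1) ^+ k * (rho + rho)) (fun n => x t n - y t n).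
    elim: k t => [|k IH] t tT ta.
      by rewrite mul1r; apply: norm_leB => //; [exact: xa.2|exact: ya.2].
    have d0 : 0 <= 2^-1 ^+ k * (rho + rho) by rewrite mulr_ge0 ?exprn_ge0 ?invr_ge0// addr_ge0// ltW.
    have [ta'|at_] := leP t a.
      apply: norm_le_diff0; last exact: xya.
      by rewrite mulr_ge0 ?exprn_ge0 ?invr_ge0// addr_ge0// ltW.
    move: (tT); rewrite in_itv /= => /andP[t0 tT'].
    set d := 2^-1 ^+ k * (rho + rho) in IH d0.
    pose g s n := forcing x s n - forcing y s n.
    have gd s : s \in `]0, t[ -> nle (- theta) (c * d) (g s).
      rewrite in_itv /= => /andP[s0 st].
      apply: (forcing_diff rho rho') => //; first by rewrite in_itv /=; lra.
      by move=> r; rewrite in_itv /= => /andP[r0 rs]; apply: IH; rewrite ?in_itv /=; lra.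
    (* Before [a] the paths agree, hence so do their memories, which only look back. The difference
       of the Duhamel terms reduces to an integral over []a, t[], whose length is at most [eps]. *)
    have g0 s n : s \in `]0, a[ -> g s n = 0.
      rewrite in_itv /= => /andP[s0 sa].
      have sT : s \in `[0, T] by rewrite in_itv /=; lra.
      rewrite /g /forcing (_ : x s = y s); last by apply/funext => k'; apply: xya => //; exact: ltW.
      rewrite (_ : mem_path x s = mem_path y s) ?subrr//.
      apply/funext => k'; apply: eq_Rintegral => r; rewrite inE /= in_itv /= => /andP[r0 rs].
      by rewrite (xya r)//; rewrite ?in_itv /=; lra.
    have mx n := forcing_measurable rho rho' rho0 rho'0 hrho x n t xa tT'.
    have my n := forcing_measurable rho rho' rho0 rho'0 hrho y n t ya tT'.
    have mg n : measurable_fun `]0, t[ (g ^~ n) by exact: measurable_funB.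
    have N : nle mu (Num.sqrt (t - a) * (c * d)) (fun n => \int[leb]_(s in `]a, t[) (w n (t - s) * g s n)).
      apply: duhamel_short => //; first exact: ltW.
      - exact: mulr_ge0.
      - by move=> n; apply: measurable_funS (mg n) => //; apply: subset_itv; rewrite bnd_simp.
      - by move=> s; rewrite in_itv /= => /andP[sa st]; apply: gd; rewrite in_itv /=; lra.
    apply: (norm_le_ext _ _ _ _ (fun n => \int[leb]_(s in `]a, t[) (w n (t - s) * g s n))) => [n|].
      rewrite xs// ys// /picard opprD addrACA subrr add0r.
      rewrite -(duhamelB (forcing x) (forcing y) (c * rho))//.
      - rewrite (duhamel_split g (c * d) t a n a0 (ltW at_) (mg n) gd).
        rewrite [X in _ = X + _](_ : _ = 0) ?add0r//.
        under eq_Rintegral => s; first by rewrite inE /= => sa; rewrite g0// mulr0; over.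
        by rewrite Rintegral_cst// mul0r.
      - by move=> s; exact: (forcing_sub rho rho' rho0 rho'0 hrho x s t xa tT').
      - by move=> s; exact: (forcing_sub rho rho' rho0 rho'0 hrho y s t ya tT').
    apply: norm_le_weaken N.
    rewrite (_ : 2^-1 ^+ k.+1 * (rho + rho) = 2^-1 * d); last by rewrite exprS -mulrA.
    rewrite mulrA; apply: ler_wpM2r => //.
    apply: le_trans sqrtE; rewrite ler_wpM2r//; apply: ler_wsqrtr; lra.
  move=> t tT ta n; apply/eqP; rewrite -subr_eq0; apply/eqP; move: n.
  apply: (norm_le_small _ _ lam_gt0 mu) => e e0.
  have /cvgrPdist_lt/(_ (e / (rho + rho)) _)[|N _ hN] : (2^-1 : R) ^+ k @[k --> \oo] --> (0 : R).
    by apply: cvg_expr; rewrite ger0_norm ?invr_ge0// invf_lt1// ltr1n.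
    by rewrite divr_gt0// addr_gt0.
  have := hN N (leqnn N); rewrite /= sub0r normrN ger0_norm ?exprn_ge0 ?invr_ge0//.
  rewrite ltr_pdivlMr ?addr_gt0// => /ltW h.
  exact: norm_le_weaken h (half N t tT ta).
have all k t : t \in `[0, T] -> t <= k%:R * eps -> x t =1 y t.
  elim: k t => [|k IH] t tT tk.
    have -> : t = 0 by move: tk tT; rewrite mul0r in_itv /= => h /andP[h' _]; apply/le_anti; rewrite h.
    have z0 : 0 \in `[0, T] by rewrite in_itv /= lexx ltW.
    by move=> n; rewrite (xs 0 z0) (ys 0 z0) !picard_at0.
  apply: (step (k%:R * eps)) => //; first by rewrite mulr_ge0// ltW.
  by move: tk; rewrite -natr1 mulrDl mul1r.
move=> t tT; apply: (all (Num.truncn (T / eps)).+1 t tT).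
move: tT; rewrite in_itv /= => /andP[_ tT]; apply: (le_trans tT).
by rewrite -ler_pdivrMr//; apply: ltW; exact: truncnS_gt.
Qed.

(** Only the semigroup term produces a singularity at t = 0. The Duhamel increment is of order
    h^{1/4} up to t = 0, and h <= T (h / t) brings it to the same form. *)
Lemma solution_holder rho xi eta x : 0 < rho -> admissible rho x -> solution xi x -> nle mu eta xi ->
  exists2 D : R, 0 <= D & forall t h, 0 < t -> 0 < h -> t + h <= T ->
    nle mu (D * Num.sqrt (Num.sqrt (h / t))) (fun n => x (t + h) n - x t n).
Proof.
move=> rho0 xa xs xiE.
have [rho' rho'0 hrho] := mem_radius rho rho0.
pose G := (Lf rho + Kf rho' * ell_norm) * rho.
have G0 : 0 <= G by exact: crho_ge0.
have eta0 := norm_le_ge0 _ _ _ _ _ xiE.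
pose S (z : R) := Num.sqrt (Num.sqrt z).
have S0 z : 0 <= S z by exact: sqrtr_ge0.
have T0 := ltW T_gt0.
have T1 : 0 <= 1 + T by rewrite addr_ge0.
exists (eta + S T * (Num.sqrt (1 + T) + S T) * G).
  by rewrite addr_ge0// mulr_ge0// mulr_ge0// addr_ge0// sqrtr_ge0.
move=> t h t0 h0 thT.
have hT : h <= T by lra.
have h0' := ltW h0.
have D1 := semigroup_holder mu xi eta t h t0 h0 xiE.
have D2 : nle mu ((Num.sqrt (Num.sqrt h * (1 + T)) + Num.sqrt h) * G)
    (fun n => duhamel (forcing x) (t + h) n - duhamel (forcing x) t n).
  apply: duhamel_holder => //; first exact: ltW.
  - by move=> n; exact: (forcing_measurable rho rho').
  - by move=> s; exact: (forcing_sub rho rho').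
have hS : S h <= S T * S (h / t).
  rewrite -!sqrtrM ?sqrtr_ge0// ler_wsqrtr// ler_wsqrtr//.
  by rewrite mulrCA ler_peMr// ler_pdivlMr// mul1r; lra.
have sE : Num.sqrt (Num.sqrt h * (1 + T)) + Num.sqrt h <= S T * (Num.sqrt (1 + T) + S T) * S (h / t).
  have -> : Num.sqrt h = S h * S h by rewrite -expr2 sqr_sqrtr ?sqrtr_ge0.
  rewrite sqrtrM ?mulr_ge0 ?S0// -{1}expr2 sqrtr_sqr ger0_norm ?S0//.
  rewrite -mulrDr mulrAC; apply: ler_pM => //; first by rewrite addr_ge0 ?sqrtr_ge0.
  by rewrite lerD2l; apply: ler_wsqrtr; exact: ler_wsqrtr.
have th_in : t + h \in `[0, T] by rewrite in_itv /=; lra.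
have t_in : t \in `[0, T] by rewrite in_itv /=; lra.
apply: (norm_le_weaken _ _ _ (S (h / t) * eta + (Num.sqrt (Num.sqrt h * (1 + T)) + Num.sqrt h) * G)).
  rewrite -/(S (h / t)) [leRHS]mulrDl [X in X + _ <= _]mulrC lerD2l.
  by rewrite [leRHS]mulrAC ler_wpM2r.
apply: norm_le_ext (norm_leD _ _ lam_gt0 _ _ _ _ _ D1 D2) => n.
by rewrite xs// xs// /picard opprD addrACA.
Qed.

End duhamel.

(** * Square-integrable functions and the Riesz-Fischer theorem *)

Section riesz_fischer.
Context d (T : measurableType d) (R : realType) (mu : {measure set T -> \bar R}).
Context (D : set T) (mD : measurable D).
Implicit Types f g : T -> R.

Definition sq_integrable f :=
  measurable_fun D f /\ (\int[mu]_(x in D) ((f x) ^+ 2)%:E < +oo)%E.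

Definition inner f g : R := \int[mu]_(x in D) (f x * g x).

Lemma sq_integrable_meas f : sq_integrable f -> measurable_fun D f.
Proof. by case. Qed.

Lemma integrable_sq f : sq_integrable f -> mu.-integrable D (EFin \o (fun x => f x ^+ 2)).
Proof.
move=> [mf f2]; apply/integrableP; split; first exact/measurable_EFinP/measurable_funX.
apply: le_lt_trans f2; rewrite le_eqVlt; apply/orP; left; apply/eqP.
by apply: eq_integral => x _ /=; rewrite ger0_norm// sqr_ge0.
Qed.

Lemma integrable_mul f g : sq_integrable f -> sq_integrable g ->
  mu.-integrable D (EFin \o (fun x => f x * g x)).
Proof.
move=> sf sg; apply: (@le_integrable _ _ _ mu D mD _ (fun x => (f x ^+ 2 + g x ^+ 2)%:E)).
- by apply/measurable_EFinP/measurable_funM; exact: sq_integrable_meas.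
- move=> x Dx /=; rewrite lee_fin [leRHS]ger0_norm ?addr_ge0 ?sqr_ge0// normrM.
  rewrite -(real_normK (num_real (f x))) -(real_normK (num_real (g x))).
  have := sqr_ge0 (`|f x| - `|g x|); have := sqr_ge0 (`|f x|); have := sqr_ge0 (`|g x|).
  by rewrite sqrrB; lra.
- have := integrableD mD (integrable_sq f sf) (integrable_sq g sg).
  by apply: eq_integrable.
Qed.

Lemma sq_integrableZ a f : sq_integrable f -> sq_integrable (fun x => a * f x).
Proof.
move=> sf; split; first by apply: measurable_funM => //; exact: sq_integrable_meas.
have /integrableP[_] := integrableZl mD (a ^+ 2) (integrable_sq f sf).
apply: le_lt_trans; rewrite le_eqVlt; apply/orP; left; apply/eqP.
by apply: eq_integral => x _ /=; rewrite -exprMn ger0_norm ?sqr_ge0.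
Qed.

Lemma sq_integrableD f g : sq_integrable f -> sq_integrable g ->
  sq_integrable (fun x => f x + g x).
Proof.
move=> sf sg; split; first by apply: measurable_funD; exact: sq_integrable_meas.
have i1 := integrableD mD (integrable_sq f sf) (integrable_sq g sg).
have /integrableP[_] := integrableZl mD 2 i1.
apply: le_lt_trans; apply: ge0_le_integral => //=.
- by move=> x _; rewrite lee_fin sqr_ge0.
- by apply/measurable_EFinP/measurable_funX/measurable_funD; exact: sq_integrable_meas.
- apply/measurable_EFinP/measurableT_comp => //; apply: measurable_funM => //.
  by apply: measurable_funD; apply: measurable_funX; exact: sq_integrable_meas.
- move=> x _; rewrite lee_fin.
  apply: le_trans (ler_norm _).
  by have := sqr_ge0 (f x - g x); rewrite sqrrB sqrrD; lra.
Qed.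

Lemma sq_integrable0 : sq_integrable (fun=> 0).
Proof.
split => //; under eq_integral do rewrite expr0n /=.
by rewrite integral0.
Qed.

Lemma sq_integrableB f g : sq_integrable f -> sq_integrable g ->
  sq_integrable (fun x => f x - g x).
Proof.
move=> sf sg; have := sq_integrableD f _ sf (sq_integrableZ (-1) g sg).
by congr sq_integrable; apply/funext => x; rewrite mulN1r.
Qed.

Lemma innerC f g : inner f g = inner g f.
Proof. by apply: eq_Rintegral => x _; rewrite mulrC. Qed.

Lemma innerDl f g h : sq_integrable f -> sq_integrable g -> sq_integrable h ->
  inner (fun x => f x + g x) h = inner f h + inner g h.
Proof.
move=> sf sg sh; rewrite /inner -RintegralD//; [|exact: integrable_mul..].
by apply: eq_Rintegral => x _; rewrite mulrDl.
Qed.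

Lemma innerZl a f h : sq_integrable f -> sq_integrable h ->
  inner (fun x => a * f x) h = a * inner f h.
Proof.
move=> sf sh; rewrite /inner -RintegralZl//; last exact: integrable_mul.
by apply: eq_Rintegral => x _; rewrite mulrA.
Qed.

Lemma innerBl f g h : sq_integrable f -> sq_integrable g -> sq_integrable h ->
  inner (fun x => f x - g x) h = inner f h - inner g h.
Proof.
move=> sf sg sh; rewrite /inner -RintegralB//; [|exact: integrable_mul..].
by apply: eq_Rintegral => x _; rewrite mulrBl.
Qed.

Lemma integral_sq f : sq_integrable f ->
  (\int[mu]_(x in D) ((f x) ^+ 2)%:E = (inner f f)%:E)%E.
Proof.
move=> sf; rewrite /inner /Rintegral fineK; last exact: integrable_fin_num (integrable_mul f f sf sf).
by apply: eq_integral => x _; rewrite expr2.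
Qed.

Lemma inner_ge0 f : 0 <= inner f f.
Proof. by apply: Rintegral_ge0 => x _; rewrite -expr2 sqr_ge0. Qed.

(** The weighted inequality of means with a free parameter does the work of Cauchy-Schwarz:
    [inner_limit] takes [del] of the order of the tolerance. *)
Lemma inner_amgm f g (del : R) : 0 < del -> sq_integrable f -> sq_integrable g ->
  `|inner f g| <= del^-1 * inner f f + del * inner g g.
Proof.
move=> d0 sf sg.
have ifg := integrable_mul f g sf sg.
apply: (le_trans (@le_normr_Rintegral _ _ _ mu D _ mD ifg)).
have i1 := integrable_mul f f sf sf; have i2 := integrable_mul g g sg sg.
rewrite /inner -!RintegralZl// -RintegralD//=.
- apply: le_Rintegral => //=.
  + exact: (@integrable_norm _ _ _ mu D _ ifg).
  + have := integrableD mD (integrableZl mD del^-1 i1) (integrableZl mD del i2).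
    by apply: eq_integrable.
  + move=> x _; rewrite normrM.
    have -> : del^-1 * (f x * f x) + del * (g x * g x) =
      del^-1 * (`|f x| ^+ 2 + del ^+ 2 * `|g x| ^+ 2).
      by rewrite !real_normK ?num_real//; field; rewrite gt_eqF.
    rewrite ler_pdivlMl//.
    have := sqr_ge0 (`|f x| - del * `|g x|); rewrite sqrrB exprMn.
    have : 0 <= del * (`|f x| * `|g x|) by rewrite !mulr_ge0// ltW.
    have := sqr_ge0 (`|f x|); lra.
- by have := integrableZl mD del^-1 i1; apply: eq_integrable.
- by have := integrableZl mD del i2; apply: eq_integrable.
Qed.

Context (e : nat -> T -> R) (e_sq : forall n, sq_integrable (e n)).
Hypothesis e_on : forall n k, inner (e n) (e k) = (n == k)%:R.

Definition lincomb (c : nat -> R) (N : nat) (x : T) : R := \sum_(n < N) c n * e n x.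

Lemma lincombS c N x : lincomb c N.+1 x = lincomb c N x + c N * e N x.
Proof. by rewrite /lincomb big_ord_recr. Qed.

Lemma lincomb0 c : lincomb c 0 = fun=> 0.
Proof. by apply/funext => x; rewrite /lincomb big_ord0. Qed.

Lemma lincomb_sq c N : sq_integrable (lincomb c N).
Proof.
elim: N => [|N IH]; first by rewrite lincomb0; exact: sq_integrable0.
by rewrite (funext (lincombS c N)); apply: sq_integrableD => //; exact: sq_integrableZ.
Qed.

Lemma inner_lincomb c N f : sq_integrable f ->
  inner (lincomb c N) f = \sum_(n < N) c n * inner (e n) f.
Proof.
move=> sf; elim: N => [|N IH].
  by rewrite lincomb0 big_ord0 /inner; under eq_Rintegral do rewrite mul0r; rewrite Rintegral_cst// mul0r.
rewrite (funext (lincombS c N)) big_ord_recr /= innerDl//.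
- by rewrite IH innerZl.
- exact: lincomb_sq.
- exact: sq_integrableZ.
Qed.

Lemma inner_lincomb_e c N k : inner (lincomb c N) (e k) = if (k < N)%N then c k else 0.
Proof.
rewrite inner_lincomb//; under eq_bigr do rewrite e_on mulr_natr mulrb.
rewrite -big_mkcond /=; case: ifPn => kN.
  by rewrite (big_pred1 (Ordinal kN))// => i; rewrite -val_eqE.
by rewrite big1// => i /eqP ik; exfalso; move: kN; rewrite -ik ltn_ord.
Qed.

Lemma inner_lincomb_sq c N : inner (lincomb c N) (lincomb c N) = \sum_(n < N) c n ^+ 2.
Proof.
rewrite inner_lincomb; last exact: lincomb_sq.
by apply: eq_bigr => n _; rewrite innerC inner_lincomb_e ltn_ord expr2.
Qed.

Lemma lincomb_diff c a b : (a <= b)%N ->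
  inner (fun x => lincomb c b x - lincomb c a x) (fun x => lincomb c b x - lincomb c a x) =
  \sum_(n < b | (a <= n)%N) c n ^+ 2.
Proof.
move=> ab; have -> : (fun x => lincomb c b x - lincomb c a x) =
    lincomb (fun n => if (a <= n)%N then c n else 0) b.
  apply/funext => x; rewrite /lincomb (big_ord_widen _ (fun n => c n * e n x) ab).
  rewrite [X in _ - X]big_mkcond /= -sumrB; apply: eq_bigr => n _.
  by rewrite ltnNge; case: leqP => _ /=; rewrite ?subr0 ?subrr ?mul0r.
rewrite inner_lincomb_sq [RHS]big_mkcond /=; apply: eq_bigr => n _.
by case: ifP => _; rewrite ?expr0n.
Qed.

Lemma lincomb_cauchy (c : nat -> R) (t : R) M a b : (forall N, \sum_(n < N | (M <= n)%N) c n ^+ 2 <= t) ->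
  (M <= a)%N -> (M <= b)%N ->
  inner (fun x => lincomb c b x - lincomb c a x) (fun x => lincomb c b x - lincomb c a x) <= t.
Proof.
move=> tail; wlog ab : a b / (a <= b)%N.
  move=> h Ma Mb; have [ab|/ltnW ba] := leqP a b; first exact: h.
  apply: le_trans (h b a ba Mb Ma); rewrite le_eqVlt; apply/orP; left; apply/eqP.
  by apply: eq_Rintegral => x _; rewrite -mulrNN !opprB.
move=> Ma Mb; rewrite lincomb_diff//; apply: le_trans (tail b).
rewrite [leLHS]big_mkcond [leRHS]big_mkcond /=; apply: ler_sum => n _.
case: ifP => [an|_]; first by rewrite (leq_trans Ma an).
by case: ifP => // _; rewrite sqr_ge0.
Qed.

(** The tail estimate [norm_le_tail] with all weights equal to 1; the absolute value of [B] supplies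
    the sign that [norm_le] demands. *)
Lemma square_tail (c : nat -> R) (B eps : R) : (forall N, \sum_(n < N) c n ^+ 2 <= B ^+ 2) -> 0 < eps ->
  exists M, forall N, \sum_(n < N | (M <= n)%N) c n ^+ 2 <= eps ^+ 2.
Proof.
move=> cB e0; have one (n : nat) : (1 : R) `^ 0 = 1 by rewrite powRr0.
have [|M hM] := norm_le_tail R (fun=> 1) 0 `|B| c eps _ e0.
  split=> // N; rewrite real_normK ?num_real//.
  by apply: le_trans (cB N); rewrite le_eqVlt; apply/orP; left; apply/eqP; apply: eq_bigr => n _; rewrite one// mul1r.
exists M => N; apply: le_trans (hM N).
by rewrite le_eqVlt; apply/orP; left; apply/eqP; apply: eq_bigr => n _; rewrite one// mul1r.
Qed.

Lemma limn_einf_le_near (u : (\bar R)^nat) (l : \bar R) N :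
  (forall n, (N <= n)%N -> (u n <= l)%E) -> (limn_einf u <= l)%E.
Proof.
move=> h; apply: (le_trans (limn_einf_sup u)); rewrite /limn_esup /limf_esup.
apply: ereal_inf_le; exists (ereal_sup (u @` [set n | (N <= n)%N])).
  by exists [set n | (N <= n)%N] => //; exists N.
by apply: ub_ereal_sup => _ [n /= Nn <-]; exact: h.
Qed.

Lemma nneseries_le_fin (u : nat -> R) (c : R) : (forall k, 0 <= u k) ->
  (forall N, \sum_(k < N) u k <= c) -> (\sum_(k <oo) (u k)%:E <= c%:E)%E.
Proof.
move=> u0 uc; apply: lime_le.
  by apply: is_cvg_nneseries => k _ _; rewrite lee_fin.
by apply: nearW => N; rewrite sumEFin lee_fin big_mkord.
Qed.

Lemma geometric4_le N : \sum_(k < N) ((4^-1 : R) ^+ k) <= 2 - 2 * 4^-1 ^+ N.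
Proof.
elim: N => [|N IH]; first by rewrite big_ord0 expr0; lra.
rewrite big_ord_recr /= exprS; have : 0 <= (4^-1 : R) ^+ N by rewrite exprn_ge0// invr_ge0.
by move: IH; lra.
Qed.

Lemma fast_cauchy (u : nat -> R) (s : R) :
  (forall k, `|u k.+1 - u k| <= 2^-1 ^+ k * s) -> cvgn u.
Proof.
move=> us; have C : cvgn (series (telescope u)).
  apply: normed_cvg; apply: (@series_le_cvg _ _ (geometric s 2^-1)) => [n|n|n|].
  - exact: normr_ge0.
  - by apply: le_trans (normr_ge0 (u n.+1 - u n)) _; rewrite /= mulrC us.
  - by rewrite /= mulrC; exact: us.
  - by apply: is_cvg_geometric_series; rewrite ger0_norm ?invr_ge0// invf_lt1// ltr1n.
rewrite (_ : u = fun n => u 0%N + series (telescope u) n).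
  by apply: is_cvgD => //; exact: is_cvg_cst.
by apply/funext => n; exact: eq_sum_telescope.
Qed.

(* Partial sums along a subsequence with tails at most 16^-k converge almost
   everywhere because \sum_k 4^k (F (k+1) - F k)^2 is integrable; Fatou's lemma
   turns the pointwise limit into a limit in mean square. *)
Lemma riesz_fischer (c : nat -> R) (B : R) : (forall N, \sum_(n < N) c n ^+ 2 <= B ^+ 2) ->
  exists2 f, sq_integrable f & forall eps, 0 < eps -> exists M0, forall N, (M0 <= N)%N ->
    inner (fun x => f x - lincomb c N x) (fun x => f x - lincomb c N x) <= eps ^+ 2.
Proof.
move=> cB.
have p4 k : 0 < (4^-1 : R) ^+ k by rewrite exprn_gt0// invr_gt0.
have /choice[M0 hM0] : forall k, exists M, forall N, \sum_(n < N | (M <= n)%N) c n ^+ 2 <= (4^-1 ^+ k) ^+ 2.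
  by move=> k; exact: square_tail cB (p4 k).
(* The sum makes the indices nondecreasing and at least [M0 k]; the summand [k] makes them tend to
   infinity. *)
pose M k := (k + \sum_(i < k.+1) M0 i)%N.
have M0M k : (M0 k <= M k)%N.
  by rewrite /M big_ord_recr /= addnA leq_addl.
have MS k : (M k <= M k.+1)%N.
  by rewrite /M [in leqRHS]big_ord_recr /= addSn -addnS leq_add2l leqW// leq_addr.
have kM k : (k <= M k)%N by rewrite leq_addr.
pose F k := lincomb c (M k).
pose q k x := (F k.+1 x - F k x) ^+ 2.
have sF k : sq_integrable (F k) by exact: lincomb_sq.
have mF k : measurable_fun D (F k) by exact: sq_integrable_meas.
have mq k : measurable_fun D (q k) by apply: measurable_funX; exact: measurable_funB.
have iq k : (\int[mu]_(x in D) (q k x)%:E <= ((4^-1 ^+ k) ^+ 2)%:E)%E.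
  rewrite (integral_sq (fun x => F k.+1 x - F k x)); last exact: sq_integrableB.
  by rewrite lee_fin; apply: (lincomb_cauchy c _ (M0 k)) => //; exact: leq_trans (MS k).
(* The factor 4^k leaves a summable series of integrals, at most 4^{-k} each. Where [G] is finite,
   |F (k+1) - F k| <= 2^{-k} G^{1/2}, so F converges there. *)
pose G x := (\sum_(k <oo) (4 ^+ k * q k x)%:E)%E.
have g0 k x : 0 <= 4 ^+ k * q k x by apply: mulr_ge0; [exact: exprn_ge0|exact: sqr_ge0].
have mG : measurable_fun D G.
  apply: ge0_emeasurable_sum => k; first by move=> x Dx _; rewrite lee_fin.
  by move=> _; apply/measurable_EFinP/measurable_funM.
have iG : mu.-integrable D G.
  apply/integrableP; split => //.
  rewrite (eq_integral G); last first.
    by move=> x _; rewrite gee0_abs//; apply: nneseries_ge0 => k _ _; rewrite lee_fin.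
  rewrite /G integral_nneseries//; last 2 first.
    by move=> k; apply/measurable_EFinP/measurable_funM.
    by move=> k x Dx; rewrite lee_fin.
  apply: (@le_lt_trans _ _ (2 : R)%:E); last exact: ltry.
  apply: (@le_trans _ _ (\sum_(k <oo) ((4^-1 : R) ^+ k)%:E)%E).
    apply: lee_nneseries => [k _ _|k _].
      by apply: integral_ge0 => x _; rewrite lee_fin.
    under eq_integral do rewrite EFinM.
    rewrite ge0_integralZl//; last 2 first.
      exact/measurable_EFinP.
      by move=> x _; rewrite lee_fin sqr_ge0.
    apply: (@le_trans _ _ ((4 ^+ k)%:E * ((4^-1 ^+ k) ^+ 2)%:E)%E).
      by rewrite lee_wpmul2l// lee_fin exprn_ge0.
    by rewrite -EFinM lee_fin expr2 mulrA -exprMn divff// expr1n mul1r.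
  apply: nneseries_le_fin => [k|N]; first exact: ltW.
  by apply: (le_trans (geometric4_le N)); rewrite gerBl mulr_ge0// ltW.
have cF x : D x -> G x \is a fin_num -> cvgn (F ^~ x).
  move=> Dx Gx.
  have G0 : 0 <= fine (G x) by rewrite fine_ge0// nneseries_ge0// => k _ _; rewrite lee_fin.
  apply: (fast_cauchy _ (Num.sqrt (fine (G x)))) => k.
  have : 4 ^+ k * q k x <= fine (G x).
    rewrite -lee_fin fineK//; apply: (@le_trans _ _ (\sum_(0 <= i < k.+1) (4 ^+ i * q i x)%:E)%E).
      rewrite big_nat_recr //= leeDr// sume_ge0// => i _; first by rewrite lee_fin.
    by apply: nneseries_lim_ge => i _ _; rewrite lee_fin.
  rewrite -ler_pdivlMl ?exprn_gt0// => hq.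
  have -> : 2^-1 ^+ k = Num.sqrt ((4 ^+ k)^-1) :> R.
    rewrite -exprVn (_ : 4^-1 = 2^-1 ^+ 2 :> R); last by field.
    by rewrite -exprM mulnC exprM sqrtr_sqr ger0_norm// exprn_ge0// invr_ge0.
  rewrite -sqrtrM ?invr_ge0 ?exprn_ge0// -sqrtr_sqr; exact: ler_wsqrtr.
(* The upper limit is measurable on all of [D] and coincides with the limit wherever [G] is
   finite. *)
pose f x := fine (limn_esup (fun k => (F k x)%:E)).
have mf : measurable_fun D f.
  apply: (@measurableT_comp _ _ _ _ _ _ fine) => //.
  by apply: measurable_fun_limn_esup => k; exact/measurable_EFinP.
have Ff x : D x -> G x \is a fin_num -> F k x @[k --> \oo] --> f x.
  move=> Dx Gx; have cx := cF x Dx Gx.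
  have cxE : (F k x)%:E @[k --> \oo] --> (lim (F k x @[k --> \oo]))%:E by apply: cvg_EFin => //; exact: nearW.
  rewrite /f is_cvg_limn_esupE; last by apply/cvg_ex; eexists; exact: cxE.
  by rewrite (cvg_lim _ cxE).
have aeG := integrable_ae mD iG.
have key eps : 0 < eps -> exists M1, forall N, (M1 <= N)%N ->
    (\int[mu]_(x in D) ((f x - lincomb c N x) ^+ 2)%:E <= (eps ^+ 2)%:E)%E.
  move=> e0; have [M1 hM1] := square_tail c B eps cB e0; exists M1 => N M1N.
  have mS : measurable_fun D (lincomb c N) by apply: sq_integrable_meas; exact: lincomb_sq.
  pose u k x := ((F k x - lincomb c N x) ^+ 2)%:E.
  have mu_ k : measurable_fun D (u k) by apply/measurable_EFinP/measurable_funX/measurable_funB.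
  have -> : (\int[mu]_(x in D) ((f x - lincomb c N x) ^+ 2)%:E =
             \int[mu]_(x in D) limn_einf (u ^~ x))%E.
    apply: ae_eq_integral => //.
    - by apply/measurable_EFinP/measurable_funX/measurable_funB.
    - rewrite (_ : (fun x => limn_einf _) = (fun x => - limn_esup (fun k => - u k x))%E)//.
      apply: measurableT_comp => //; apply: measurable_fun_limn_esup => k.
      exact: measurableT_comp.
    - move: aeG; apply: filterS => x Gx Dx; have Fx := Ff x Dx (Gx Dx).
      have ux : u k x @[k --> \oo] --> ((f x - lincomb c N x) ^+ 2)%:E.
        apply: cvg_EFin; first exact: nearW.
        have C : F k x - lincomb c N x @[k --> \oo] --> f x - lincomb c N x.
          by apply: cvgB; [exact: Fx|exact: cvg_cst].
        exact: (cvgM C C).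
      by rewrite is_cvg_limn_einfE; [rewrite (cvg_lim _ ux)|apply/cvg_ex; eexists; exact: ux].
  apply: le_trans (fatou mu mD mu_ _) _; first by move=> k x _; rewrite lee_fin sqr_ge0.
  apply: (limn_einf_le_near _ _ N) => k Nk.
  rewrite (integral_sq (fun x => F k x - lincomb c N x)); last first.
    by apply: sq_integrableB => //; exact: lincomb_sq.
  rewrite lee_fin; apply: (lincomb_cauchy c _ M1) => //.
  by apply: leq_trans (kM k); exact: leq_trans Nk.
have sf : sq_integrable f.
  (* Fatou has put [f] within distance 1 of a partial sum, which is square integrable; hence so is
     [f]. *)
  have [M1 hM1] := key 1 ltr01.
  have sS : sq_integrable (lincomb c M1) by exact: lincomb_sq.
  have sd : sq_integrable (fun x => f x - lincomb c M1 x).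
    split; first by apply: measurable_funB => //; exact: sq_integrable_meas.
    by apply: le_lt_trans (hM1 M1 (leqnn _)) _; exact: ltry.
  have := sq_integrableD _ _ sd sS; congr sq_integrable; apply/funext => x; exact: subrK.
exists f => // eps e0; have [M1 hM1] := key eps e0; exists M1 => N M1N.
have := hM1 N M1N; rewrite (integral_sq (fun x => f x - lincomb c N x)) ?lee_fin//.
by apply: sq_integrableB => //; exact: lincomb_sq.
Qed.

Lemma inner_limit (c : nat -> R) f n : sq_integrable f ->
  (forall eps, 0 < eps -> exists M0, forall N, (M0 <= N)%N ->
    inner (fun x => f x - lincomb c N x) (fun x => f x - lincomb c N x) <= eps ^+ 2) ->
  inner f (e n) = c n.
Proof.
move=> sf fc; apply/eqP; rewrite -subr_eq0 -normr_le0; apply/ler_addgt0Pr => eps e0; rewrite add0r.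
have e2 : 0 < eps / 2 by rewrite divr_gt0.
have [M0 hM0] := fc (eps / 2) e2.
pose N := maxn M0 n.+1.
have sS : sq_integrable (lincomb c N) by exact: lincomb_sq.
have -> : inner f (e n) - c n = inner (fun x => f x - lincomb c N x) (e n).
  by rewrite innerBl// inner_lincomb_e leq_maxr.
apply: le_trans (inner_amgm _ _ (eps / 2) e2 _ (e_sq n)) _; first exact: sq_integrableB.
rewrite e_on eqxx mulr1; have := hM0 N (leq_maxl _ _) => h.
have : (eps / 2)^-1 * inner (fun x => f x - lincomb c N x) (fun x => f x - lincomb c N x) <= eps / 2.
  by rewrite ler_pdivrMl// -expr2.
by move: (inner _ _) => z; lra.
Qed.

End riesz_fischer.

(** * Integrability of s^{-1/2} at the origin *)

Section integral_inv_sqrt.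
Context (R : realType).
Local Notation leb := (@lebesgue_measure R).
Local Notation mR := (measurableTypeR R).

Lemma measurable_powR_half (D : set R) : measurable_fun D (fun s : R => s `^ (- 2^-1)).
Proof. by apply: measurable_funTS; exact: measurable_powR. Qed.

Lemma powR_continuous_within (p a t : R) : 0 < a -> {within `[a, t], continuous (@powR R ^~ p)}.
Proof.
move=> a0; apply: continuous_in_subspaceT => x; rewrite inE /= in_itv /= => /andP[ax _].
by apply: differentiable_continuous; apply/derivable1_diffP; apply: ex_derive; exact: is_derive1_powR (lt_le_trans a0 ax).
Qed.

Lemma integral_powR_half (a t : R) : 0 < a -> a < t ->
  (\int[leb]_(s in `[a, t]) (s `^ (- 2^-1))%:E <= (2 * t `^ 2^-1)%:E)%E.
Proof.
move=> a0 at_.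
rewrite (@continuous_FTC2 _ _ (fun s => 2 * s `^ 2^-1))//.
- by rewrite -EFinB lee_fin gerBl mulr_ge0// powR_ge0.
- exact: powR_continuous_within.
- have cF : {within `[a, t], continuous (fun s => 2 * s `^ 2^-1)}.
    move=> x; apply: cvgM; first exact: cvg_cst.
    exact: powR_continuous_within.
  have /continuous_within_itvP := cF => /(_ at_)[_ c1 c2].
  split=> // x; rewrite in_itv /= => /andP[ax xt].
  by apply: derivableM => //; apply: ex_derive; exact: is_derive1_powR (lt_trans a0 ax).
- move=> x; rewrite in_itv /= => /andP[ax xt]; rewrite derive1E.
  have dx := is_derive1_powR 2^-1 (lt_trans a0 ax).
  have -> : (fun s => 2 * s `^ 2^-1) = 2 \*: (fun s : R => s `^ 2^-1) by [].
  rewrite deriveZ//= derive_val.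
  rewrite -[LHS]/(2 * (2^-1 * x `^ (2^-1 - 1))) mulrA divff// mul1r; congr (_ `^ _); lra.
Qed.

Lemma integrable_powR_half (t : R) : leb.-integrable `]0, t[ (EFin \o (fun s : R => s `^ (- 2^-1))).
Proof.
have [t0|t0] := ltP 0 t; last first.
  by rewrite set_itv_ge ?bnd_simp -?leNgt//; exact: integrable_set0.
apply: (@integrableS _ mR R leb `]0, t]) => //.
  by apply: subset_itv; rewrite bnd_simp.
apply/integrableP; split; first by apply/measurable_EFinP; exact: measurable_powR_half.
(* Starting with the denominator 2 keeps the left endpoint strictly below [t], as the fundamental
   theorem of calculus requires. *)
pose F (i : nat) : set R := `[t / i.+2%:R, t]%classic.
have FE : `]0, t]%classic = \bigcup_i F i.
  apply/seteqP; split => [x|x [i _]] /=; rewrite !in_itv /= => /andP[x1 x2].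
    exists (Num.truncn (t / x)) => //=; rewrite /F /= in_itv /= x2 andbT.
    rewrite ler_pdivrMr// mulrC -ler_pdivrMr// ltW//.
    by apply: lt_le_trans (truncnS_gt _) _; rewrite ler_nat.
  by move: x1 x2; rewrite !bnd_simp => x1 ->; rewrite andbT (lt_le_trans _ x1)// divr_gt0.
have ndF : nondecreasing_seq F.
  move=> i j ij; apply/subsetPset; apply: subset_itvr; rewrite bnd_simp.
  by rewrite ler_pM2l// lef_pV2 ?posrE// ler_nat !ltnS.
rewrite FE; under eq_integral do rewrite /= ger0_norm ?powR_ge0//.
have mF i : measurable (F i) by rewrite /F; exact: measurable_itv.
have C := @ge0_nondecreasing_set_cvg_integral _ mR R F (fun s => (s `^ (- 2^-1))%:E) leb ndF mF.
have {}C := C (fun i => (measurable_EFinP _ _).2 (measurable_powR_half (F i))) _.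
rewrite -(cvg_lim _ (C _))//; last by move=> i x _; rewrite lee_fin powR_ge0.
apply: (@le_lt_trans _ _ (2 * t `^ 2^-1)%:E); last exact: ltry.
apply: lime_le; first by apply/cvg_ex; eexists; apply: C => i x _; rewrite lee_fin powR_ge0.
apply: nearW => i; apply: integral_powR_half; first by rewrite divr_gt0.
by rewrite ltr_pdivrMr// ltr_pMr// ltr1n.
Qed.

End integral_inv_sqrt.

(** * Approximation of real functions by simple functions given as lists *)

Section simple_approximation.
Context (R : realType).
Local Notation leb := (@lebesgue_measure R).
Local Notation mR := (measurableTypeR R).
Import HBNNSimple HBSimple.

(** The scalar counterpart of [simple_fun]: each coefficient of a vector-valued simple function has
    this form. *)
Definition simple_val (l : seq (set R * R)) (t : R) : R := \sum_(p <- l) \1_(p.1) t * p.2.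

Lemma simple_val_cat l1 l2 t : simple_val (l1 ++ l2) t = simple_val l1 t + simple_val l2 t.
Proof. by rewrite /simple_val big_cat. Qed.

Lemma simple_valN l t : simple_val [seq (p.1, - p.2) | p <- l] t = - simple_val l t.
Proof. by rewrite /simple_val big_map -sumrN; apply: eq_bigr => p _ /=; rewrite mulrN. Qed.

Lemma nnsfun_simple_val (f : {nnsfun mR >-> R}) :
  exists2 l : seq (set R * R), (forall p, p \in l -> measurable p.1) & forall t, f t = simple_val l t.
Proof.
exists [seq (f @^-1` [set y], y) | y <- finmap.enum_fset (fset_set (range f))].
  by move=> p /mapP[y _ ->] /=; apply: (measurable_sfunP f); exact: measurable_set1.
move=> t; rewrite fimfunE fsbig_finite//= /simple_val big_map.
by apply: eq_bigr => y _ /=; rewrite mulrC.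
Qed.

Lemma nonneg_approximation (D : set R) (g : R -> R) : measurable D -> measurable_fun D g ->
  (forall t, D t -> 0 <= g t) ->
  exists l : nat -> seq (set R * R), [/\ forall k p, p \in l k -> measurable p.1,
    forall t, D t -> simple_val (l k) t @[k --> \oo] --> g t &
    forall t k, D t -> 0 <= simple_val (l k) t <= g t].
Proof.
move=> mD mg g0; have mg' : measurable_fun (D : set mR) (EFin \o g) by exact/measurable_EFinP.
pose s := nnsfun_approx (mD : measurable (D : set mR)) mg'.
have /choice[l hl] : forall k, exists l : seq (set R * R),
    (forall p, p \in l -> measurable p.1) /\ forall t, s k t = simple_val l t.
  by move=> k; have [l h1 h2] := nnsfun_simple_val (s k); exists l.
have cs t : D t -> simple_val (l k) t @[k --> \oo] --> g t.
  move=> Dt; have C := @cvg_nnsfun_approx _ mR R D mD (EFin \o g) mg' (fun x Dx => g0 x Dx) t Dt.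
  move: C => /fine_cvgP[_]; apply: cvg_trans; apply: near_eq_cvg; apply: nearW => k /=.
  by rewrite (hl k).2.
exists l; split => // [k p|t k Dt]; first exact: (hl k).1.
rewrite -(hl k).2; apply/andP; split; first exact: fun_ge0.
have nd : nondecreasing_seq (fun k => simple_val (l k) t).
  move=> i j ij; rewrite -!(hl _).2.
  by have /lefP := @nd_nnsfun_approx _ mR R D mD (EFin \o g) mg' i j ij; exact.
have := nondecreasing_cvgn_le nd (cvgP _ (cs t Dt)) k.
by rewrite (cvg_lim _ (cs t Dt))// -(hl k).2.
Qed.

(** The positive and negative parts are approximated from below. The resulting bound of the error by
    |g| provides the domination needed to sum over all coordinates. *)
Lemma simple_approximation (D : set R) (g : R -> R) : measurable D -> measurable_fun D g ->
  exists l : nat -> seq (set R * R), [/\ forall k p, p \in l k -> measurable p.1,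
    forall t, D t -> simple_val (l k) t @[k --> \oo] --> g t &
    forall t k, D t -> `|g t - simple_val (l k) t| <= `|g t|].
Proof.
move=> mD mg.
have mp : measurable_fun D (fun t => Num.max (g t) 0) by exact: measurable_maxr.
have mn : measurable_fun D (fun t => Num.max (- g t) 0).
  by apply: measurable_maxr => //; exact: measurableT_comp.
have [lp [p1 p2 p3]] := nonneg_approximation D _ mD mp (fun t _ => ltac:(by rewrite le_max lexx orbT)).
have [ln [n1 n2 n3]] := nonneg_approximation D _ mD mn (fun t _ => ltac:(by rewrite le_max lexx orbT)).
have gE t : g t = Num.max (g t) 0 - Num.max (- g t) 0.
  have [g0|g0] := leP 0 (g t).
    by rewrite max_r ?subr0// oppr_le0.
  by rewrite max_l ?sub0r ?opprK// oppr_ge0 ltW.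
have gN t : `|g t| = Num.max (g t) 0 + Num.max (- g t) 0.
  have [g0|g0] := leP 0 (g t).
    by rewrite max_r ?addr0 ?ger0_norm// oppr_le0.
  by rewrite max_l ?add0r ?ltr0_norm// oppr_ge0 ltW.
exists (fun k => lp k ++ [seq (p.1, - p.2) | p <- ln k]); split.
- move=> k p; rewrite mem_cat => /orP[|/mapP[q qn ->]]; [exact: p1|exact: n1 qn].
- move=> t Dt; rewrite gE; under eq_fun do rewrite simple_val_cat simple_valN.
  by apply: cvgB; [exact: p2|exact: n2].
- move=> t k Dt; rewrite gN simple_val_cat simple_valN {1}gE.
  have := p3 t k Dt; have := n3 t k Dt.
  move: (simple_val _ t) (simple_val _ t) (Num.max _ _) (Num.max _ _) => a b c d.
  move=> /andP[h1 h2] /andP[h3 h4]; rewrite ler_norml; apply/andP; split; lra.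
Qed.

Lemma measurable_simple_val (D : set R) l : (forall p, p \in l -> measurable p.1) ->
  measurable_fun D (simple_val l).
Proof.
elim: l => [|p l IH] h.
  by rewrite (_ : simple_val _ = fun=> 0)//; apply/funext => t; rewrite /simple_val big_nil.
rewrite (_ : simple_val _ = fun t => \1_(p.1) t * p.2 + simple_val l t); last first.
  by apply/funext => t; rewrite /simple_val big_cons.
apply: measurable_funD; last by apply: IH => q ql; apply: h; rewrite inE ql orbT.
apply: measurable_funM => //; apply: measurable_indic; apply: h; exact: mem_head.
Qed.

Lemma Rintegral_simple_val (D : set R) l : measurable D -> (leb D < +oo)%E ->
  (forall p, p \in l -> measurable p.1) ->
  leb.-integrable D (EFin \o simple_val l) /\
  \int[leb]_(t in D) simple_val l t = \sum_(p <- l) fine (leb (D `&` p.1)) * p.2.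
Proof.
move=> mD Doo; elim: l => [|p l IH] h.
  rewrite (_ : simple_val _ = fun=> 0); last by apply/funext => t; rewrite /simple_val big_nil.
  by rewrite big_nil Rintegral_cst// mul0r; split => //; exact: integrable0.
have [i1 i2] : leb.-integrable D (EFin \o simple_val l) /\ \int[leb]_(t in D) simple_val l t = \sum_(p <- l) fine (leb (D `&` p.1)) * p.2.
  by apply: IH => q ql; apply: h; rewrite inE ql orbT.
have mp : measurable p.1 by apply: h; exact: mem_head.
have ip : leb.-integrable D (EFin \o (fun t => \1_(p.1) t * p.2)).
  apply: (integrable_bounded _ _ _ `|p.2|) => //.
    by apply: measurable_funM => //; exact: measurable_indic.
  move=> x _; rewrite normrM ler_piMl// indicE; case: (_ \in _); rewrite ?normr1 ?normr0//.
rewrite (_ : simple_val _ = fun t => \1_(p.1) t * p.2 + simple_val l t); last first.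
  by apply/funext => t; rewrite /simple_val big_cons.
split; first by apply: leb_integrableD.
rewrite RintegralD// i2 big_cons; congr (_ + _).
under eq_Rintegral do rewrite mulrC.
rewrite RintegralZl//; last first.
  apply: (integrable_bounded _ _ _ 1) => //.
  by move=> x _; rewrite indicE; case: (_ \in _); rewrite ?normr1 ?normr0//.
rewrite mulrC; congr (_ * _).
by rewrite /Rintegral integral_indic// setIC.
Qed.

End simple_approximation.

(** * Measurability of open sets of row vectors *)

Section open_rV.
Context (R : realType) (d : nat).

Lemma measurable_rV_coord (i : 'I_d) (A : set R) : measurable A ->
  measurable [set y : 'rV[R]_d | A (y ord0 i)].
Proof.
move=> mA; have mt := @measurable_tnth _ (measurableTypeR R) d i.
exists ((@tnth d (measurableTypeR R) ^~ i) @^-1` A).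
  by rewrite -[X in measurable X]setTI; exact: mt.
by rewrite setTI; apply/seteqP; split => y /=; rewrite tnth_mktuple.
Qed.

(** The sigma-algebra is generated by the coordinates, so an open set is written as the countable
    union of the boxes with rational centre and side 2 / (n + 1) that it contains. *)
Lemma open_measurable_rV (A : set 'rV[R]_d) : open A -> measurable A.
Proof.
move=> oA.
pose box (p : 'rV[rat]_d * nat) : set 'rV[R]_d :=
  [set y | forall i, `|y ord0 i - ratr (p.1 ord0 i)| < p.2.+1%:R^-1].
have mbox p : measurable (box p).
  rewrite (_ : box p = \bigcap_(i : 'I_d) [set y | `|y ord0 i - ratr (p.1 ord0 i)| < p.2.+1%:R^-1]).
    apply: fin_bigcap_measurable => // i _.
    apply: (measurable_rV_coord i [set z : R | `|z - ratr (p.1 ord0 i)| < p.2.+1%:R^-1]).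
    have := measurable_ball (ratr (p.1 ord0 i) : R) p.2.+1%:R^-1.
    by congr measurable; apply/seteqP; split => z; rewrite /ball /= distrC.
  by apply/seteqP; split => [y h i _ /=|y h i]; [exact: h|exact: (h i)].
rewrite (_ : A = \bigcup_p (if `[< box p `<=` A >] then box p else set0)).
  apply: countable_bigcupT_measurable => [|p]; first exact: countableP.
  by case: asboolP => // _; exact: measurable0.
apply/seteqP; split => [x Ax|x [p _]]; last by case: asboolP => // pA /pA.
have /nbhs_ballP[e /= e0 eA] := oA x Ax.
pose n := Num.truncn (2 / e).
have n0 : 0 < (n.+1%:R^-1 : R) by [].
have hn : n.+1%:R^-1 < e / 2.
  by rewrite invf_plt ?posrE ?divr_gt0// invf_div; exact: truncnS_gt.
have hq i : exists q : rat, `|x ord0 i - ratr q| < n.+1%:R^-1 :> R.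
  have [|q] := @rat_in_itvoo R (x ord0 i - n.+1%:R^-1) (x ord0 i + n.+1%:R^-1).
    by rewrite ltrBlDr -addrA ltrDl addr_gt0.
  by rewrite in_itv /=; move: (n.+1%:R^-1) => z /andP[q1 q2]; exists q; rewrite ltr_norml; apply/andP; split; lra.
have /choice[q hq'] := hq.
exists (\row_i q i, n) => //; case: asboolP => [_|]; first by move=> i /=; rewrite mxE.
case=> y /= hy; apply: eA; split => // i j; rewrite ord1 /ball /=.
have := hy j; have := hq' j; rewrite mxE => h1 h2.
rewrite -(subrKA (ratr (q j))) (le_lt_trans (ler_normD _ _))//.
by rewrite [X in _ + X]distrC; move: hn h1 h2; move: (n.+1%:R^-1) => z; lra.
Qed.

End open_rV.

(** * Hilbert scale spaces in terms of coefficients *)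

Section hilbert_scale_coefficients.
Context (R : realType) (d : nat) (Omega : set 'rV[R]_d) (mO : measurable Omega).
Context (lam : nat -> R) (e : nat -> 'rV[R]_d -> R).
Hypothesis lam_gt0 : forall n, 0 < lam n.
Hypothesis lam_ge : forall n, lam 0%N <= lam n.
Hypothesis e_L2 : forall n, L2 Omega (e n).
Hypothesis e_on : forall n k, L2inner Omega (e n) (e k) = (n == k)%:R.
Local Notation vol := (@lebesgue_rV R d).
Local Notation sqi := (sq_integrable _ _ R vol Omega).
Local Notation inn := (inner _ _ R vol Omega).
Local Notation nle := (@norm_le R lam).
Local Notation V := ('rV[R]_d -> R).
Local Notation coef := (coef Omega e).

Lemma L2P (phi : V) : L2 Omega phi <-> sqi phi.
Proof.
split=> -[mp h]; split=> //; last exact: poweR_lty.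
rewrite ltey; apply/eqP => hoo; move: h; rewrite /L2norm hoo poweRyr ?ltxx//.
Qed.

Lemma L2normE (phi : V) : L2 Omega phi -> L2norm Omega phi = (Num.sqrt (inn phi phi))%:E.
Proof.
move=> /L2P sp; rewrite /L2norm integral_sq// poweR_EFin powR12_sqrt//.
exact: inner_ge0.
Qed.

Lemma L2D (phi psi : V) : L2 Omega phi -> L2 Omega psi -> L2 Omega (phi + psi).
Proof. by move=> /L2P h1 /L2P h2; apply/L2P; exact: sq_integrableD. Qed.

Lemma L2Z a (phi : V) : L2 Omega phi -> L2 Omega (a *: phi).
Proof. by move=> /L2P h1; apply/L2P; exact: sq_integrableZ. Qed.

Lemma L2B (phi psi : V) : L2 Omega phi -> L2 Omega psi -> L2 Omega (phi - psi).
Proof. by move=> /L2P h1 /L2P h2; apply/L2P; exact: sq_integrableB. Qed.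

Lemma L20 : L2 Omega (0 : V).
Proof. by apply/L2P; exact: sq_integrable0. Qed.

Lemma coefD (phi psi : V) n : L2 Omega phi -> L2 Omega psi ->
  coef (phi + psi) n = coef phi n + coef psi n.
Proof. by move=> /L2P h1 /L2P h2; apply: innerDl => //; exact/L2P. Qed.

Lemma coefB (phi psi : V) n : L2 Omega phi -> L2 Omega psi ->
  coef (phi - psi) n = coef phi n - coef psi n.
Proof. by move=> /L2P h1 /L2P h2; apply: innerBl => //; exact/L2P. Qed.

Lemma coefZ a (phi : V) n : L2 Omega phi -> coef (a *: phi) n = a * coef phi n.
Proof. by move=> /L2P h1; apply: innerZl => //; exact/L2P. Qed.

Lemma coef0 n : coef (0 : V) n = 0.
Proof. by have := coefZ 0 0 n L20; rewrite scale0r mul0r. Qed.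

Lemma sum_lincomb (c : nat -> R) N : \sum_(n < N) c n *: e n = lincomb _ _ R e c N :> V.
Proof.
apply/funext => x; rewrite /lincomb; elim: N => [|N IH]; first by rewrite !big_ord0.
by rewrite !big_ord_recr /= -IH.
Qed.

Lemma L2_sum (c : nat -> R) N : L2 Omega (\sum_(n < N) c n *: e n).
Proof. by rewrite sum_lincomb; apply/L2P; apply: lincomb_sq => // n; exact/L2P. Qed.

Lemma innBC (f g : V) : inn (f - g) (f - g) = inn (fun x => g x - f x) (fun x => g x - f x).
Proof. by apply: eq_Rintegral => x _; rewrite -mulrNN !opprB. Qed.

Lemma L2cvgP (c : nat -> R) (phi : V) : L2 Omega phi ->
  L2cvg Omega (fun N => \sum_(n < N) c n *: e n) phi <->
  forall eps, 0 < eps -> exists M0, forall N, (M0 <= N)%N ->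
    inn (fun x => phi x - lincomb _ _ R e c N x) (fun x => phi x - lincomb _ _ R e c N x) <= eps ^+ 2.
Proof.
move=> lp; have E N : L2norm Omega (\sum_(n < N) c n *: e n - phi) =
    (Num.sqrt (inn (fun x => phi x - lincomb _ _ R e c N x) (fun x => phi x - lincomb _ _ R e c N x)))%:E.
  rewrite L2normE; last by apply: L2B => //; exact: L2_sum.
  by rewrite innBC sum_lincomb.
rewrite /L2cvg; under eq_fun do rewrite E; split => [h eps e0|h].
  move: h => /fine_cvgP[_ /cvgr0_norm_le/(_ _ e0)[M0 _ hM]]; exists M0 => N /hM /=.
  rewrite ger0_norm ?sqrtr_ge0// => h.
  rewrite -(sqr_sqrtr (inner_ge0 _ _ _ _ _ _)) lerXn2r ?nnegrE ?sqrtr_ge0//.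
  exact: ltW.
apply/fine_cvgP; split; first exact: nearW.
apply/cvgr0Pnorm_le => eps e0; have [M0 hM] := h eps e0; exists M0 => // N /= /hM hN.
rewrite ger0_norm ?sqrtr_ge0// -(ger0_norm (ltW e0)) -sqrtr_sqr; exact: ler_wsqrtr.
Qed.

Lemma wnorm_leP rho (B : R) (x : nat -> R) : 0 <= B ->
  (wnorm lam rho x <= B%:E)%E <-> nle rho B x.
Proof.
move=> B0; rewrite /wnorm; set S := (\sum_(n <oo) _)%E.
have t0 n : 0 <= lam n `^ rho * x n ^+ 2 by rewrite mulr_ge0 ?sqr_ge0 ?powR_ge0.
have S0 : (0 <= S)%E by apply: nneseries_ge0 => n _ _; rewrite lee_fin.
split=> [h|[_ h]].
  split=> // N; rewrite -lee_fin; apply: (@le_trans _ _ S).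
    rewrite -sumEFin -(big_mkord xpredT (fun n => (lam n `^ rho * x n ^+ 2)%:E)).
    by apply: nneseries_lim_ge => n _ _; rewrite lee_fin.
  case: S S0 h => [s| |] //=; last by rewrite invr_eq0 (negbTE (lt0r_neq0 _)).
  rewrite !lee_fin => s0; rewrite powR12_sqrt// => h.
  by rewrite -(sqr_sqrtr s0) lerXn2r ?nnegrE ?sqrtr_ge0.
have SB : (S <= (B ^+ 2)%:E)%E by exact: nneseries_le_fin.
case: S S0 SB => [s| |] //=; rewrite !lee_fin => s0 sB.
by rewrite powR12_sqrt// -(ger0_norm B0) -sqrtr_sqr ler_wsqrtr.
Qed.

Lemma wnorm_ge0 rho x : (0 <= wnorm lam rho x)%E.
Proof. exact: poweR_ge0. Qed.

Lemma wnorm_fin rho x : (wnorm lam rho x < +oo)%E -> exists B, nle rho B x.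
Proof.
move=> h; exists (fine (wnorm lam rho x)); apply/wnorm_leP.
  by rewrite fine_ge0// wnorm_ge0.
by rewrite fineK// ge0_fin_numE// wnorm_ge0.
Qed.

Lemma HscaleP rho (phi : V) : Hscale Omega lam e rho phi <->
  L2 Omega phi /\ exists B, nle rho B (coef phi).
Proof.
split=> -[lp h]; split=> //; first exact: wnorm_fin.
have [B hB] := h; have B0 := norm_le_ge0 _ _ _ _ _ hB.
by rewrite /Hnorm; apply: le_lt_trans ((wnorm_leP _ _ _ B0).2 hB) _; exact: ltry.
Qed.

(** The embedding of H^mu into L^2: the weights are bounded below by that of the smallest
    eigenvalue. *)
Lemma norm_le_ell2 mu (B : R) x : 0 <= mu -> nle mu B x ->
  forall N, \sum_(n < N) x n ^+ 2 <= (Num.sqrt (lam 0%N `^ mu)^-1 * B) ^+ 2.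
Proof.
move=> mu0 [B0 xB] N; have l0 : 0 < lam 0%N `^ mu by rewrite powR_gt0.
rewrite exprMn sqr_sqrtr ?invr_ge0 ?(ltW l0)// ler_pdivlMl//.
apply: le_trans (xB N); rewrite mulr_sumr; apply: ler_sum => n _.
rewrite ler_wpM2r ?sqr_ge0//; apply: ge0_ler_powR => //; rewrite nnegrE ltW//.
Qed.

(** The body repeats that of [resolvent], so [resolvent] at time t is convertible to the synthesis
    of the damped coefficients. *)
Definition synthesis (x : nat -> R) : V :=
  get [set phi | L2 Omega phi /\ L2cvg Omega (fun N => \sum_(n < N) x n *: e n) phi].

Lemma synthesisP mu (B : R) x : 0 <= mu -> nle mu B x ->
  Hscale Omega lam e mu (synthesis x) /\ coef (synthesis x) =1 x.
Proof.
move=> mu0 xB; have e_sq n : sqi (e n) by exact/L2P.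
have [f sf fx] := riesz_fischer _ _ _ _ _ mO e e_sq e_on x _ (norm_le_ell2 _ _ _ mu0 xB).
have lf : L2 Omega f by exact/L2P.
have [ls cs] : [set phi | L2 Omega phi /\ L2cvg Omega (fun N => \sum_(n < N) x n *: e n) phi] (synthesis x).
  by apply: getPex; exists f; split => //; exact/L2cvgP.
have E : coef (synthesis x) =1 x.
  move=> n; apply: (inner_limit _ _ _ vol Omega mO e e_sq e_on x _ n); first exact/L2P.
  exact/L2cvgP.
split => //; apply/HscaleP; split => //; exists B.
by apply: norm_le_ext xB => n; rewrite E.
Qed.

Lemma HscaleB rho (phi psi : V) : Hscale Omega lam e rho phi -> Hscale Omega lam e rho psi ->
  Hscale Omega lam e rho (phi - psi).
Proof.
move=> /HscaleP[l1 [B1 h1]] /HscaleP[l2 [B2 h2]]; apply/HscaleP; split; first exact: L2B.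
exists (B1 + B2); apply: norm_le_ext (norm_leB _ _ lam_gt0 _ _ _ _ _ h1 h2) => n.
by rewrite coefB.
Qed.

Lemma HscaleZ rho a (phi : V) : Hscale Omega lam e rho phi -> Hscale Omega lam e rho (a *: phi).
Proof.
move=> /HscaleP[l1 [B1 h1]]; apply/HscaleP; split; first exact: L2Z.
exists (`|a| * B1); apply: norm_le_ext (norm_leM _ _ _ _ _ (fun=> a) _ _ _ h1) => // n.
by rewrite coefZ.
Qed.

Lemma Hscale0 rho : Hscale Omega lam e rho (0 : V).
Proof.
apply/HscaleP; split; first exact: L20.
exists 0; apply: norm_le_ext (norm_le0 _ _ _ _ (lexx 0)) => n.
by rewrite coef0.
Qed.

Lemma coef_e n k : coef (e n) k = (n == k)%:R.
Proof. exact: e_on. Qed.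

Lemma Hscale_e rho n : Hscale Omega lam e rho (e n).
Proof.
apply/HscaleP; split => //; exists (Num.sqrt (lam n `^ rho)); split; first exact: sqrtr_ge0.
move=> N; rewrite sqr_sqrtr ?powR_ge0//.
have [nN|Nn] := ltnP n N.
  rewrite (bigD1 (Ordinal nN))//= coef_e eqxx expr1n mulr1 big1 ?addr0// => k kn.
  rewrite coef_e (_ : (n == k) = false) ?expr0n ?mulr0//.
  by apply/negbTE; apply: contra kn => /eqP nk; apply/eqP/val_inj.
rewrite big1 ?powR_ge0// => k _; rewrite coef_e (_ : (n == k) = false) ?expr0n ?mulr0//.
by apply/negbTE; rewrite neq_ltn (leq_trans (ltn_ord k) Nn) orbT.
Qed.

Local Notation leb := (@lebesgue_measure R).
Local Notation mR := (measurableTypeR R).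

(** Minkowski's inequality with a time-dependent bound: [kernel_estimate1] with kernel [W] and the
    normalised vectors g / W. Where [W] vanishes, so does [g]. *)
Lemma norm_le_integral rho (D : set R) (W : R -> R) (g : R -> nat -> R) : measurable D ->
  leb.-integrable D (EFin \o W) -> (forall n, measurable_fun D (g ^~ n)) ->
  (forall t, D t -> nle rho (W t) (g t)) ->
  nle rho (\int[leb]_(t in D) W t) (fun n => \int[leb]_(t in D) g t n).
Proof.
move=> mD iW mg gW.
have W0 t : D t -> 0 <= W t by move=> /gW; exact: norm_le_ge0.
have mW : measurable_fun D W by exact: integrable_measurable iW.
pose x t n := W t `^ (-1) * g t n.
have := kernel_estimate1 R lam lam_gt0 D W x rho 1 mD iW.
have -> : \int[leb]_(t in D) `|W t| = \int[leb]_(t in D) W t.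
  by apply: eq_Rintegral => t /set_mem Dt; rewrite ger0_norm ?W0.
rewrite mulr1 => h; apply: norm_le_ext (h _ ler01 _) => [n|n|t Dt].
- apply: eq_Rintegral => t /set_mem Dt; rewrite /x powR_inv1 ?W0//.
  have [W_eq0|W_neq0] := eqVneq (W t) 0; last by rewrite mulVKf.
  rewrite W_eq0 mul0r; have := gW t Dt; rewrite W_eq0 => /(norm_le_eq0 _ _ lam_gt0) ->//.
- apply: measurable_funM => //.
  apply: (@measurableT_comp _ _ _ mR mR R (@powR R ^~ (-1)) _ W _ mW); exact: measurable_powR.
- have [W_eq0|W_neq0] := eqVneq (W t) 0.
    apply: (norm_le_ext _ _ _ _ (fun=> 0)); last by apply: norm_le0.
    move=> n; rewrite /x; have := gW t Dt; rewrite W_eq0 => /(norm_le_eq0 _ _ lam_gt0) ->//.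
    by rewrite mulr0.
  have Wp : 0 <= (W t)^-1 by rewrite invr_ge0 W0.
  have := norm_leM R lam rho (W t) (W t)^-1 (fun=> W t `^ (-1)) (g t) Wp _ (gW t Dt).
  rewrite mulVf//; apply => _; rewrite powR_inv1 ?W0// ger0_norm//.
Qed.

Lemma measurable_wnorm rho (D : set R) (c : R -> nat -> R) : measurable D ->
  (forall n, measurable_fun D (c ^~ n)) -> measurable_fun D (fun t => wnorm lam rho (c t)).
Proof.
move=> mD mc; apply: (@measurableT_comp _ _ _ _ _ _ (poweR ^~ 2^-1)); first exact: measurable_poweR.
apply: ge0_emeasurable_sum => n; first by move=> t Dt _; rewrite lee_fin mulr_ge0 ?powR_ge0 ?sqr_ge0.
by move=> _; apply/measurable_EFinP; apply: measurable_funM => //; exact: measurable_funX.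
Qed.

Lemma integrable_coord rho (g : R -> nat -> R) (W : R -> R) (D : set R) n : measurable D ->
  leb.-integrable D (EFin \o W) -> measurable_fun D (g ^~ n) ->
  (forall t, D t -> nle rho (W t) (g t)) -> leb.-integrable D (EFin \o (g ^~ n)).
Proof.
move=> mD iW mg gW.
apply: (@le_integrable _ mR R leb _ _ _ (EFin \o (fun t => Num.sqrt (lam n `^ rho)^-1 * W t))) => //.
- by apply/measurable_EFinP; exact: mg.
- move=> t Dt /=; rewrite lee_fin [leRHS]ger0_norm.
    exact: (norm_le_coord_abs _ _ lam_gt0 _ _ _ _ (gW t Dt)).
  by rewrite mulr_ge0 ?sqrtr_ge0// (norm_le_ge0 _ _ _ _ _ (gW t Dt)).
- exact: leb_integrableZ.
Qed.

(** The weight [phi] is left free to cover both [simple_fun], where it is an indicator at a given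
    time, and [simple_int], where it is a measure. *)
Lemma L2_simple (l : seq (set R * V)) (phi : set R -> R) : (forall p, p \in l -> L2 Omega p.2) ->
  L2 Omega (\sum_(p <- l) phi p.1 *: p.2).
Proof.
elim: l => [|p l IH] h; first by rewrite big_nil; exact: L20.
rewrite big_cons; apply: L2D; last by apply: IH => q ql; apply: h; rewrite inE ql orbT.
by apply: L2Z; apply: h; exact: mem_head.
Qed.

Lemma coef_simple (l : seq (set R * V)) (phi : set R -> R) n : (forall p, p \in l -> L2 Omega p.2) ->
  coef (\sum_(p <- l) phi p.1 *: p.2) n = \sum_(p <- l) phi p.1 * coef p.2 n.
Proof.
elim: l => [|p l IH] h; first by rewrite !big_nil coef0.
have hl q : q \in l -> L2 Omega q.2 by move=> ql; apply: h; rewrite inE ql orbT.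
have hp : L2 Omega p.2 by apply: h; exact: mem_head.
by rewrite !big_cons coefD ?IH ?coefZ//; [exact: L2Z|exact: L2_simple].
Qed.

Definition coef_list (l : seq (set R * V)) n : seq (set R * R) := [seq (p.1, coef p.2 n) | p <- l].

Lemma coef_simple_fun (l : seq (set R * V)) t n : (forall p, p \in l -> L2 Omega p.2) ->
  coef (simple_fun l t) n = simple_val R (coef_list l n) t.
Proof.
by move=> h; rewrite /simple_fun (coef_simple l (fun A => \1_A t))// /simple_val big_map.
Qed.

Lemma coef_simple_int (D : set R) (l : seq (set R * V)) n : measurable D -> (leb D < +oo)%E ->
  (forall p, p \in l -> measurable p.1 /\ L2 Omega p.2) ->
  leb.-integrable D (EFin \o simple_val R (coef_list l n)) /\
  coef (simple_int D l) n = \int[leb]_(t in D) simple_val R (coef_list l n) t.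
Proof.
move=> mD Doo h.
have [|i1 i2] := Rintegral_simple_val R D (coef_list l n) mD Doo.
  by move=> p /mapP[q ql ->] /=; exact: (h q ql).1.
split => //; rewrite i2 /simple_int (coef_simple l (fun A => fine (leb (D `&` A)))) ?big_map//.
by move=> p /h[].
Qed.

Lemma simple_coef (s : seq (set R * V)) (F : R -> V) t : L2 Omega (F t) ->
  (forall p, p \in s -> L2 Omega p.2) ->
  coef (F t - simple_fun s t) = fun n => coef (F t) n - simple_val R (coef_list s n) t.
Proof.
move=> LF sL; apply/funext => n; rewrite coefB//; last by apply: (L2_simple s (fun A => \1_A t)).
by rewrite coef_simple_fun.
Qed.

Lemma measurable_simple_coef (s : seq (set R * V)) (D : set R) n :
  (forall p, p \in s -> measurable p.1) -> measurable_fun D (simple_val R (coef_list s n)).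
Proof. by move=> ms; apply: measurable_simple_val => p /mapP[q qs ->] /=; exact: ms. Qed.

(** The vector-valued simple function whose first [k] coefficients are the scalar simple functions
    given by [l], all others being zero. *)
Definition basis_list (l : nat -> seq (set R * R)) (k : nat) : seq (set R * V) :=
  flatten [seq [seq (p.1, p.2 *: e n) | p <- l n] | n <- iota 0 k].

Lemma basis_listP l k p : (forall n q, q \in l n -> measurable q.1) ->
  p \in basis_list l k -> measurable p.1 /\ exists n a, p.2 = a *: e n.
Proof.
by move=> h /flattenP[s /mapP[n _ ->] /mapP[q ql ->]] /=; split; [exact: h ql|exists n, q.2].
Qed.

Lemma basis_list_L2 l k p : p \in basis_list l k -> L2 Omega p.2.
Proof. by move=> /flattenP[s /mapP[n _ ->] /mapP[q ql ->]] /=; exact: L2Z. Qed.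

Lemma coef_basis_list (l : nat -> seq (set R * R)) k n t :
  simple_val R (coef_list (basis_list l k) n) t = if (n < k)%N then simple_val R (l n) t else 0.
Proof.
rewrite /simple_val big_map big_flatten big_map.
have -> : iota 0 k = index_iota 0 k by rewrite /index_iota subn0.
rewrite big_mkord (eq_bigr (fun i : 'I_k => (if i == n :> nat then simple_val R (l n) t else 0))).
  rewrite -big_mkcond /=; case: ifPn => nk.
    by rewrite (big_pred1 (Ordinal nk))// => i; rewrite -val_eqE.
  by rewrite big1// => i /eqP ik; exfalso; move: nk; rewrite -ik ltn_ord.
move=> i _; rewrite big_map /simple_val.
case: eqP => [->|ik].
  by apply: eq_bigr => p _ /=; rewrite coefZ// coef_e eqxx mulr1.
by rewrite big1// => p _ /=; rewrite coefZ// coef_e; case: eqP => // _; rewrite !mulr0.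
Qed.

(** * Bochner integrals through coefficients *)

Section bochner_Hscale.
Context (mu : R) (mu_ge0 : 0 <= mu) (D : set R) (mD : measurable D) (Doo : (leb D < +oo)%E).
Local Notation Hmu := (Hscale Omega lam e mu).
Local Notation N := (Hnorm Omega lam e mu).

(** The k-th simple function approximates the first [k] coefficients and ignores the others. The
    error is dominated by [F t] in every coordinate and tends to zero in each, hence in norm;
    dominated convergence with majorant [W] gives convergence of the integrals. *)
Lemma is_bochner_coef (F : R -> V) (W : R -> R) (I : V) :
  leb.-integrable D (EFin \o W) -> (forall n, measurable_fun D (fun t => coef (F t) n)) ->
  (forall t, D t -> Hmu (F t)) -> (forall t, D t -> nle mu (W t) (coef (F t))) ->
  Hmu I -> (forall n, coef I n = \int[leb]_(t in D) coef (F t) n) ->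
  is_bochner Hmu N D F I.
Proof.
move=> iW mF HF FW HI IE.
have W0 t : D t -> 0 <= W t by move=> /FW; exact: norm_le_ge0.
have /choice[l hl] := fun n => simple_approximation R D _ mD (mF n).
pose s k := basis_list (l ^~ k) k.
have ms k p : p \in s k -> measurable p.1 /\ L2 Omega p.2.
  move=> ps; split; last exact: basis_list_L2 ps.
  by apply: (basis_listP _ _ _ _ ps).1 => n q; have [+ _ _] := hl n; exact.
have Li k : L2 Omega (simple_int D (s k)).
  by apply: (L2_simple (s k) (fun A => fine (leb (D `&` A)))) => p /ms[].
have LF t : D t -> L2 Omega (F t) by move=> /HF /HscaleP[].
pose c k t n := coef (F t) n - simple_val R (coef_list (s k) n) t.
have cE k t : D t -> coef (F t - simple_fun (s k) t) = c k t.
  by move=> Dt; apply: simple_coef; [exact: LF|move=> p /ms[]].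
have c_dom k t n : D t -> `|c k t n| <= `|coef (F t) n|.
  move=> Dt; rewrite /c coef_basis_list; case: ifP => _; last by rewrite subr0.
  by have [_ _ h] := hl n; exact: h.
have c_cvg t n : D t -> c k t n @[k --> \oo] --> (0 : R).
  move=> Dt; have [_ h _] := hl n; have {}h := h t Dt.
  have C : coef (F t) n - simple_val R (l n k) t @[k --> \oo] --> coef (F t) n - coef (F t) n.
    by apply: cvgB => //; exact: cvg_cst.
  rewrite subrr in C; apply: cvg_trans C; apply: near_eq_cvg.
  by exists n.+1 => // k /= nk; rewrite /c coef_basis_list nk.
have mc k n : measurable_fun D (fun t => c k t n).
  by apply: measurable_funB => //; apply: measurable_simple_coef => p /ms[].
have c_nle k t : D t -> nle mu (W t) (c k t).
  by move=> Dt; apply: norm_le_dom (FW t Dt) _ => n; exact: c_dom.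
pose h k t := wnorm lam mu (c k t).
have hW k t : D t -> (h k t <= (W t)%:E)%E.
  by move=> Dt; apply/wnorm_leP; [exact: W0|exact: c_nle].
have h0 k t : (0 <= h k t)%E by exact: wnorm_ge0.
have hfin k t : D t -> h k t \is a fin_num.
  by move=> Dt; rewrite ge0_fin_numE//; apply: le_lt_trans (hW k t Dt) _; exact: ltry.
have h_cvg t : D t -> h k t @[k --> \oo] --> 0%E.
  move=> Dt; apply/fine_cvgP; split.
    by apply: nearW => k; exact: hfin.
  apply/cvgr0Pnorm_le => eps e0.
  have [M [del d0 hM]] := norm_le_dominated _ _ lam_gt0 _ _ _ _ (FW t Dt) e0.
  have : \forall k \near \oo, forall n : 'I_M, `|c k t n| <= del * `|coef (F t) n|.
    (* The tolerance is relative to the coefficient. Where the coefficient is zero, domination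
       already forces the error to be zero. *)
    apply: filter_forall => n; have [Fn0|Fn0] := eqVneq (coef (F t) n) 0.
      by apply: nearW => k; have := c_dom k t n Dt; rewrite Fn0 normr0 mulr0.
    have dF : 0 < del * `|coef (F t) n| by rewrite mulr_gt0// normr_gt0.
    move/cvgrPdist_lt : (c_cvg t n Dt) => /(_ _ dF); apply: filterS => k.
    by rewrite sub0r normrN => /ltW.
  case=> K _ hK; have {}hK k : (K <= k)%N -> nle mu eps (c k t).
    move=> /hK h'; apply: hM => [n|n nM]; first exact: c_dom.
    exact: (h' (Ordinal nM)).
  exists K => // k /= /hK hk; rewrite ger0_norm ?fine_ge0//.
  by rewrite -lee_fin fineK ?hfin//; apply/wnorm_leP => //; exact: ltW.
have mh k : measurable_fun D (h k) by exact: measurable_wnorm.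
have h_int : (\int[leb]_(t in D) h k t)%E @[k --> \oo] --> 0%E.
  rewrite -(@integral0 _ mR R leb D).
  apply: (@dominated_cvg _ mR R leb D mD h (fun=> 0%E) (fun t => (W t)%:E)) => //.
  by move=> k t Dt; rewrite gee0_abs// hW.
have mfh k : measurable_fun D (fun t => fine (h k t)).
  by apply: (@measurableT_comp _ _ _ _ _ _ fine).
have ih k : leb.-integrable D (EFin \o (fun t => fine (h k t))).
  apply: (@le_integrable _ mR R leb _ _ _ (EFin \o W)) => //.
    by apply/measurable_EFinP; exact: mfh.
  move=> t Dt /=; rewrite lee_fin ger0_norm ?fine_ge0// ger0_norm ?W0//.
  by rewrite -lee_fin fineK ?hfin// hW.
split => //.
  by apply: aeW => t Dt; exact: HF.
exists s; split.
- move=> k p ps; split; first exact: (ms k p ps).1.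
  have [_ [n [a ->]]] := basis_listP _ _ _ (fun n q => let: And3 g _ _ := hl n in g k q) ps.
  by apply: HscaleZ; exact: Hscale_e.
- by apply: aeW => t Dt; rewrite /Hnorm; under eq_fun do rewrite cE//; exact: h_cvg.
- apply: cvg_trans h_int; apply: near_eq_cvg; apply: nearW => k.
  by apply: eq_integral => t /set_mem Dt; rewrite /Hnorm cE.
(* By Minkowski's inequality the distance from [I] to the simple integral is at most the integral of
   the pointwise errors. *)
- apply: (@squeeze_cvge _ _ _ _ (fun=> 0%E) _ (fun k => (\int[leb]_(t in D) h k t)%E)) => //; last exact: cvg_cst.
  apply: nearW => k; rewrite wnorm_ge0 /=.
  have -> : (\int[leb]_(t in D) h k t = (\int[leb]_(t in D) fine (h k t))%:E)%E.
    rewrite /Rintegral fineK; last exact: integrable_fin_num (ih k).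
    by apply: eq_integral => t /set_mem Dt; rewrite /= fineK// hfin.
  apply/wnorm_leP; first by apply: Rintegral_ge0 => t Dt; exact: fine_ge0.
  apply: norm_le_ext (norm_le_integral mu D _ (c k) mD (ih k) (mc k) _) => [n|t Dt].
    have [i1 i2] := coef_simple_int D (s k) n mD Doo (ms k).
    rewrite coefB//; last by have /HscaleP[] := HI.
    rewrite IE i2 -RintegralB//.
    exact: (integrable_coord mu (fun t => coef (F t)) W).
  by apply/wnorm_leP; rewrite ?fine_ge0// fineK ?hfin.
Qed.

Lemma abs_coord_le_wnorm (x : nat -> R) n :
  (`|x n|%:E <= (Num.sqrt (lam n `^ mu)^-1)%:E * wnorm lam mu x)%E.
Proof.
have [h|] := ltP (wnorm lam mu x) +oo%E.
  have fN : wnorm lam mu x \is a fin_num by rewrite ge0_fin_numE// wnorm_ge0.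
  rewrite -(fineK fN) -EFinM lee_fin; apply: norm_le_coord_abs => //.
  by apply/wnorm_leP; [rewrite fine_ge0// wnorm_ge0|rewrite fineK].
rewrite leye_eq => /eqP ->; rewrite mulry gtr0_sg ?mul1e ?leey//.
by rewrite sqrtr_gt0 invr_gt0 powR_gt0.
Qed.

(** A coefficient is a linear functional bounded by a multiple of the norm, so it commutes with any
    approximation by simple functions. Both error terms in [u] tend to zero, hence the coefficients
    of [I] do not depend on the approximating sequence. *)
Lemma coef_bochner (F : R -> V) (W : R -> R) (I : V) n :
  leb.-integrable D (EFin \o W) -> (forall n, measurable_fun D (fun t => coef (F t) n)) ->
  (forall t, D t -> Hmu (F t)) -> (forall t, D t -> nle mu (W t) (coef (F t))) ->
  is_bochner Hmu N D F I -> coef I n = \int[leb]_(t in D) coef (F t) n.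
Proof.
move=> iW mF HF FW [HI _ [s [hs _ s_int s_I]]].
have W0 t : D t -> 0 <= W t by move=> /FW; exact: norm_le_ge0.
have ms k p : p \in s k -> measurable p.1 /\ L2 Omega p.2 by move=> /hs[? /HscaleP[]].
have Li k : L2 Omega (simple_int D (s k)).
  by apply: (L2_simple (s k) (fun A => fine (leb (D `&` A)))) => p /ms[].
have LF t : D t -> L2 Omega (F t) by move=> /HF /HscaleP[].
have LI : L2 Omega I by have /HscaleP[] := HI.
pose c k t n := coef (F t) n - simple_val R (coef_list (s k) n) t.
have cE k t : D t -> coef (F t - simple_fun (s k) t) = c k t.
  by move=> Dt; apply: simple_coef; [exact: LF|move=> p /ms[]].
have mc k j : measurable_fun D (fun t => c k t j).
  by apply: measurable_funB => //; apply: measurable_simple_coef => p /ms[].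
have iF : leb.-integrable D (EFin \o (fun t => coef (F t) n)).
  exact: (integrable_coord mu (fun t => coef (F t)) W).
set C := Num.sqrt (lam n `^ mu)^-1; have C0 : 0 <= C by exact: sqrtr_ge0.
pose u k := (C%:E * N (I - simple_int D (s k))%R +
  C%:E * \int[leb]_(t in D) N (F t - simple_fun (s k) t)%R)%E.
have u0 : u k @[k --> \oo] --> 0%E.
  rewrite (_ : 0%E = C%:E * 0 + C%:E * 0)%E; last by rewrite !mule0 adde0.
  by apply: cvgeD; [rewrite mule0|exact: cvgeZl|exact: cvgeZl].
have key k : (`|coef I n - \int[leb]_(t in D) coef (F t) n|%:E <= u k)%E.
  have [i1 i2] := coef_simple_int D (s k) n mD Doo (ms k).
  have ic : leb.-integrable D (EFin \o (fun t => c k t n)) by exact: leb_integrableB.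
  have E2 : coef (simple_int D (s k)) n - \int[leb]_(t in D) coef (F t) n =
      - \int[leb]_(t in D) c k t n by rewrite i2 RintegralB// opprB.
  rewrite -(subrKA (coef (simple_int D (s k)) n)) E2.
  apply: (@le_trans _ _ (`|coef I n - coef (simple_int D (s k)) n|%:E +
      `|\int[leb]_(t in D) c k t n|%:E)%E).
    by rewrite -EFinD lee_fin ler_normB.
  apply: leeD.
    rewrite -coefB//; exact: abs_coord_le_wnorm.
  apply: (@le_trans _ _ (\int[leb]_(t in D) `|c k t n|%:E)%E).
    rewrite -[leRHS]fineK; last exact: integrable_fin_num (leb_integrable_norm _ D _ mD ic).
    by rewrite lee_fin; exact: (@le_normr_Rintegral _ mR R leb D _ mD ic).
  rewrite -ge0_integralZl//.
  - apply: ge0_le_integral => //.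
    + exact: (measurable_int _ (leb_integrable_norm _ D _ mD ic)).
    + apply: (@eq_measurable_fun _ _ mR _ _ (fun t => C%:E * wnorm lam mu (c k t))%E).
        by move=> t /set_mem Dt; rewrite /Hnorm cE.
      by apply: measurable_funeM; exact: measurable_wnorm.
    + move=> t Dt; rewrite /Hnorm cE//; exact: abs_coord_le_wnorm.
  - apply: (@eq_measurable_fun _ _ mR _ _ (fun t => wnorm lam mu (c k t))%E).
      by move=> t /set_mem Dt; rewrite /Hnorm cE.
    exact: measurable_wnorm.
  - by move=> t _; exact: wnorm_ge0.
have : (`|coef I n - \int[leb]_(t in D) coef (F t) n|%:E <= 0)%E.
  rewrite -(cvg_lim _ u0)//; apply: lime_ge; first by apply/cvg_ex; eexists; exact: u0.
  by apply: nearW.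
by rewrite lee_fin normr_le0 subr_eq0 => /eqP.
Qed.

End bochner_Hscale.

End hilbert_scale_coefficients.

(** * Mild solutions as fixed points of the Picard map on coefficients *)

Lemma picard_ext (R : realType) (w : nat -> R -> R) (T : R) (ell : R -> R)
    (Phi : (nat -> R) -> (nat -> R) -> nat -> R) (xi : nat -> R) (x y : R -> nat -> R) :
  (forall t, t \in `[0, T] -> x t =1 y t) -> forall t, t \in `[0, T] ->
  picard R w ell Phi xi x t =1 picard R w ell Phi xi y t.
Proof.
have sub (s t : R) : t \in `[0, T] -> s \in `]0, t[ -> s \in `[0, T] by rewrite !in_itv /=; lra.
move=> xy t tT n; rewrite /picard; congr (semigroup R w xi t n + _); apply: eq_Rintegral => s /set_mem st.
have sT := sub s t tT st.
rewrite /forcing (funext (xy s sT)) (_ : mem_path R ell x s = mem_path R ell y s)//.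
apply/funext => k; apply: eq_Rintegral => r /set_mem rs.
by rewrite (xy r (sub r s sT rs)).
Qed.

Section mild.
Context (R : realType) (d : nat) (Omega : set 'rV[R]_d) (mO : measurable Omega).
Context (lam : nat -> R) (e : nat -> 'rV[R]_d -> R).
Hypothesis lam_gt0 : forall n, 0 < lam n.
Hypothesis lam_ge : forall n, lam 0%N <= lam n.
Hypothesis e_L2 : forall n, L2 Omega (e n).
Hypothesis e_on : forall n k, L2inner Omega (e n) (e k) = (n == k)%:R.
Context (m : R -> R) (hm : kernel_assumption m).
Hypothesis hmdec : forall s t : R, 0 < s -> s <= t -> m t <= m s.
Context (mu theta : R) (mu_gt0 : 0 < mu) (mutheta : mu = 1 - theta).
Context (T : R) (T_gt0 : 0 < T) (ell : R -> R).
Hypothesis iell : (@lebesgue_measure R).-integrable `]0, T[ (EFin \o ell).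
Local Notation V := ('rV[R]_d -> R).
Local Notation Hs := (Hscale Omega lam e).
Local Notation N := (Hnorm Omega lam e).
Local Notation coefO := (coef Omega e).
Local Notation syn := (synthesis R d Omega e).
Local Notation leb := (@lebesgue_measure R).
Local Notation nle := (@norm_le R lam).
Local Notation w := (fun n => omega m (lam n)).
Context (f : V -> V -> V -> R) (Lf Kf : R -> R).
Hypothesis hf0 : forall phi, Hs theta phi -> f 0 0 phi = 0.
Hypothesis Lf_ge0 : forall rho : R, 0 < rho -> 0 <= Lf rho.
Hypothesis Kf_ge0 : forall rho : R, 0 < rho -> 0 <= Kf rho.
Hypothesis hLip : forall rho rho' : R, 0 < rho -> 0 < rho' ->
    forall v1 v2 w1 w2, Hs mu v1 -> Hs mu v2 -> Hs mu w1 -> Hs mu w2 ->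
      (N mu v1 <= rho%:E)%E -> (N mu v2 <= rho%:E)%E ->
      (N mu w1 <= rho'%:E)%E -> (N mu w2 <= rho'%:E)%E ->
      (Hdual_norm lam e theta (f v1 w1 - f v2 w2)%R
       <= (Lf rho)%:E * N mu (v1 - v2)%R + (Kf rho')%:E * N mu (w1 - w2)%R)%E.

Local Notation mild := (mild_solution Omega lam e m ell mu T f).
Local Notation mem u := (memory Omega lam e ell mu u).
Local Notation res := (resolvent Omega lam e m).
Local Notation adm rho u := (admissible R lam mu T rho (fun t => coefO (u t))).

Lemma Hs_L2 rho phi : Hs rho phi -> L2 Omega phi.
Proof. by case. Qed.

Lemma coefB_Hs rho v1 v2 n : Hs rho v1 -> Hs rho v2 -> coefO (v1 - v2) n = coefO v1 n - coefO v2 n.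
Proof. by move=> [L1 _] [L2 _]; exact: coefB. Qed.

Lemma forcing_lip (rho rho' d1 d2 : R) v1 v2 w1 w2 : 0 < rho -> 0 < rho' ->
  Hs mu v1 -> Hs mu v2 -> Hs mu w1 -> Hs mu w2 ->
  nle mu rho (coefO v1) -> nle mu rho (coefO v2) ->
  nle mu rho' (coefO w1) -> nle mu rho' (coefO w2) ->
  nle mu d1 (fun n => coefO v1 n - coefO v2 n) -> nle mu d2 (fun n => coefO w1 n - coefO w2 n) ->
  nle (- theta) (Lf rho * d1 + Kf rho' * d2) (fun n => dcoef e (f v1 w1) n - dcoef e (f v2 w2) n).
Proof.
move=> r0 r'0 Hv1 Hv2 Hw1 Hw2 nv1 nv2 nw1 nw2 nv nw.
have d10 := norm_le_ge0 _ _ _ _ _ nv; have d20 := norm_le_ge0 _ _ _ _ _ nw.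
have Nle (B : R) phi : 0 <= B -> nle mu B (coefO phi) -> (N mu phi <= B%:E)%E.
  by move=> B0 h; apply/wnorm_leP.
have := hLip rho rho' r0 r'0 v1 v2 w1 w2 Hv1 Hv2 Hw1 Hw2 (Nle _ _ (ltW r0) nv1) (Nle _ _ (ltW r0) nv2)
  (Nle _ _ (ltW r'0) nw1) (Nle _ _ (ltW r'0) nw2).
have Nv : (N mu (v1 - v2)%R <= d1%:E)%E.
  apply: Nle => //; apply: norm_le_ext nv => n.
  by rewrite (coefB_Hs mu).
have Nw : (N mu (w1 - w2)%R <= d2%:E)%E.
  apply: Nle => //; apply: norm_le_ext nw => n.
  by rewrite (coefB_Hs mu).
move=> h; apply/(wnorm_leP _ _ (- theta)).
  by rewrite addr_ge0// mulr_ge0 ?Lf_ge0 ?Kf_ge0.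
apply: le_trans h _; rewrite EFinD !EFinM; apply: leeD; apply: lee_wpmul2l => //.
  by rewrite lee_fin Lf_ge0.
by rewrite lee_fin Kf_ge0.
Qed.

(** The nonlinearity transported to sequences, evaluated at the representatives chosen by
    [synthesis]. *)
Definition coef_forcing (x y : nat -> R) : nat -> R := dcoef e (f (syn x) (syn y)).
Local Notation Phi := coef_forcing.

Lemma synthesis_nle B x : nle mu B x -> Hs mu (syn x) /\ coefO (syn x) =1 x.
Proof. by apply: synthesisP => //; exact: ltW. Qed.

Lemma coef_forcing_lip (rho rho' : R) : 0 < rho -> 0 < rho' ->
  forall (x1 x2 y1 y2 : nat -> R) (d1 d2 : R),
  nle mu rho x1 -> nle mu rho x2 -> nle mu rho' y1 -> nle mu rho' y2 ->
  nle mu d1 (fun n => x1 n - x2 n) -> nle mu d2 (fun n => y1 n - y2 n) ->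
  nle (- theta) (Lf rho * d1 + Kf rho' * d2) (fun n => Phi x1 y1 n - Phi x2 y2 n).
Proof.
move=> r0 r'0 x1 x2 y1 y2 d1 d2 hx1 hx2 hy1 hy2 hx hy.
have [Hx1 Ex1] := synthesis_nle _ _ hx1; have [Hx2 Ex2] := synthesis_nle _ _ hx2.
have [Hy1 Ey1] := synthesis_nle _ _ hy1; have [Hy2 Ey2] := synthesis_nle _ _ hy2.
apply: forcing_lip => //.
- by apply: norm_le_ext hx1 => n; rewrite Ex1.
- by apply: norm_le_ext hx2 => n; rewrite Ex2.
- by apply: norm_le_ext hy1 => n; rewrite Ey1.
- by apply: norm_le_ext hy2 => n; rewrite Ey2.
- by apply: norm_le_ext hx => n; rewrite Ex1 Ex2.
- by apply: norm_le_ext hy => n; rewrite Ey1 Ey2.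
Qed.

(** Two representatives of the same element are at distance zero, so the Lipschitz condition equates
    the coefficients of [f] at them. The radii are increased by 1 because the condition asks for
    positive ones. *)
Lemma dcoef_forcing v v' : Hs mu v -> Hs mu v' -> dcoef e (f v v') =1 Phi (coefO v) (coefO v').
Proof.
move=> Hv Hv' n.
have [_ [B hB]] := (HscaleP _ _ _ _ _ _ _).1 Hv; have [_ [B' hB']] := (HscaleP _ _ _ _ _ _ _).1 Hv'.
have [H1 E1] := synthesis_nle _ _ hB; have [H2 E2] := synthesis_nle _ _ hB'.
have B0 := norm_le_ge0 _ _ _ _ _ hB; have B'0 := norm_le_ge0 _ _ _ _ _ hB'.
have hB1 : nle mu (B + 1) (coefO v) by apply: norm_le_weaken hB; rewrite lerDl.
have hB'1 : nle mu (B' + 1) (coefO v') by apply: norm_le_weaken hB'; rewrite lerDl.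
have := forcing_lip (B + 1) (B' + 1) 0 0 v (syn (coefO v)) v' (syn (coefO v')).
rewrite !mulr0 addr0 => h; apply/eqP; rewrite -subr_eq0; apply/eqP.
suff h0 : nle (- theta) 0 (fun n => dcoef e (f v v') n - Phi (coefO v) (coefO v') n).
  exact: (norm_le_eq0 _ _ lam_gt0 (- theta) _ h0 n).
apply: h => //.
- by rewrite ltr_wpDl.
- by rewrite ltr_wpDl.
- by apply: norm_le_ext hB1 => k; rewrite E1.
- by apply: norm_le_ext hB'1 => k; rewrite E2.
- exact: norm_le_diff0 (lexx 0) (fsym E1).
- exact: norm_le_diff0 (lexx 0) (fsym E2).
Qed.

Lemma coef_forcing0 : Phi (fun=> 0) (fun=> 0) =1 fun=> 0.
Proof.
move=> n; have H0 : Hs mu 0 by exact: Hscale0.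
have := dcoef_forcing 0 0 H0 H0 n; rewrite /dcoef hf0; last exact: Hscale_e.
by rewrite (_ : coefO 0 = fun=> 0)//; apply/funext => k; exact: coef0.
Qed.

(** As [w] lies in [0, 1], lam w^2 <= lam w <= 1 / s by [omega_decay]. The factor s^{-1/2} is the
    integrable majorant for the Bochner integral in the mild formula. *)
Lemma resolvent_smoothing (B s : R) (c : nat -> R) : 0 < s -> nle (- theta) B c ->
  nle mu (s `^ (- 2^-1) * B) (fun n => w n s * c n).
Proof.
move=> s0 [B0 cB]; split; first by rewrite mulr_ge0// powR_ge0.
move=> M; have -> : (s `^ (- 2^-1) * B) ^+ 2 = s^-1 * B ^+ 2.
  rewrite exprMn; congr (_ * _); rewrite -powR_mulrn ?powR_ge0// -powRrM.
  by rewrite mulNr mulVf// powR_inv1// ltW.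
apply: (@le_trans _ _ (s^-1 * \sum_(n < M) lam n `^ (- theta) * c n ^+ 2)); last first.
  by rewrite ler_wpM2l// invr_ge0 ltW.
rewrite mulr_sumr; apply: ler_sum => n _.
have -> : lam n `^ mu = lam n * lam n `^ (- theta).
  by rewrite mutheta powRD ?powRr1 ?(ltW (lam_gt0 n))// (gt_eqF (lam_gt0 n)) implybT.
have w0 : 0 <= w n s by apply: omega_ge0 => //; exact: ltW.
have w1 : w n s <= 1 by apply: omega_le1 => //; exact: ltW.
have wd : lam n * w n s ^+ 2 <= s^-1.
  apply: (@le_trans _ _ (lam n * w n s)).
    by rewrite ler_pM2l// expr2 ler_piMr.
  rewrite -[leRHS]mul1r ler_pdivlMr// mulrAC; exact: omega_decay.
have -> : lam n * lam n `^ (- theta) * (w n s * c n) ^+ 2 =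
    (lam n * w n s ^+ 2) * (lam n `^ (- theta) * c n ^+ 2) by ring.
by apply: ler_wpM2r => //; rewrite mulr_ge0 ?powR_ge0 ?sqr_ge0.
Qed.

Lemma Hcontinuous_path_cont (u : R -> V) : Hcontinuous Omega lam e mu T u ->
  path_cont R lam mu T (fun t => coefO (u t)).
Proof.
move=> [uH uc] t0 t0T eps e0.
have := uc t0 t0T; move=> /fine_cvgP[h1 /cvgr0_norm_lt/(_ _ e0) h2].
have : \forall t \near within `[0, T] (nbhs t0), nle mu eps (fun n => coefO (u t) n - coefO (u t0) n).
  have h3 : \forall t \near within `[0, T] (nbhs t0), t \in `[0, T].
    by apply: withinT.
  near=> t.
  have tT : t \in `[0, T] by near: t.
  have ft : N mu (u t - u t0) \is a fin_num by near: t.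
  have lt_ : `|fine (N mu (u t - u t0))| < eps by near: t.
  apply: (norm_le_ext _ _ _ _ (coefO (u t - u t0))) => [n|].
    by rewrite coefB//; apply: Hs_L2; apply: uH.
  apply/wnorm_leP; first exact: ltW.
  rewrite -[leLHS](fineK ft) lee_fin; apply: le_trans (ltW lt_); exact: ler_norm.
rewrite near_withinE => /nbhs_ballP[del /= d0 hd]; exists del => // t tT tt0.
by apply: hd => //; rewrite /ball /= distrC.
Unshelve. all: end_near. Qed.

Lemma path_cont_Hcontinuous (u : R -> V) : (forall t, t \in `[0, T] -> Hs mu (u t)) ->
  path_cont R lam mu T (fun t => coefO (u t)) -> Hcontinuous Omega lam e mu T u.
Proof.
move=> uH uc; split=> // t0 t0T.
have key eps : 0 < eps -> \forall t \near within `[0, T] (nbhs t0), (N mu (u t - u t0)%R <= eps%:E)%E.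
  move=> e0; have [del d0 hd] := uc t0 t0T eps e0.
  rewrite near_withinE; exists del => // t /= tt0 tT.
  apply/wnorm_leP; first exact: ltW.
  apply: norm_le_ext (hd t tT _) => [n|]; last by rewrite distrC.
  by rewrite coefB//; apply: Hs_L2; exact: uH.
have fin eps t : (N mu (u t - u t0)%R <= eps%:E)%E -> N mu (u t - u t0) \is a fin_num.
  by move=> h; rewrite ge0_fin_numE ?wnorm_ge0//; apply: le_lt_trans h _; exact: ltry.
apply/fine_cvgP; split; first by apply: filterS (key 1 ltr01) => t; exact: fin.
apply/cvgr0Pnorm_le => eps e0; apply: filterS (key eps e0) => t h /=.
rewrite ger0_norm ?fine_ge0 ?wnorm_ge0//.
by rewrite -lee_fin fineK//; exact: fin h.
Qed.

Lemma Hcontinuous_admissible (u : R -> V) : Hcontinuous Omega lam e mu T u ->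
  exists2 rho : R, 0 < rho & adm rho u.
Proof.
move=> uC; have xc := Hcontinuous_path_cont u uC.
have [|B B0 hB] := path_bounded _ _ lam_gt0 _ _ _ (ltW T_gt0) xc; last by exists B.
by move=> t tT; have /HscaleP[_] := uC.1 t tT.
Qed.

Lemma itv_oo_sub (s t : R) : t <= T -> s \in `]0, t[ -> s \in `[0, T].
Proof. by move=> tT; rewrite !in_itv /=; lra. Qed.

(** [memory] is a choice by [xget]: [is_bochner_coef], applied to the synthesised candidate, shows
    that a Bochner integral exists, and [coef_bochner] computes the coefficients of whichever one
    was chosen. *)
Lemma memoryP (u : R -> V) (rho t : R) : (forall t, t \in `[0, T] -> Hs mu (u t)) ->
  adm rho u -> t \in `[0, T] ->
  Hs mu (mem u t) /\
  coefO (mem u t) = mem_path R ell (fun t => coefO (u t)) t.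
Proof.
move=> uH xa tT'; pose x t := coefO (u t).
have tT : t <= T by move: tT'; rewrite in_itv /= => /andP[].
have rho0 : 0 <= rho by exact: norm_le_ge0 _ _ _ _ _ (xa.2 t tT').
have mx n : measurable_fun `]0, t[ (x ^~ n) by exact: admissible_measurable xa tT.
have xB s : s \in `]0, t[ -> nle mu rho (x s) by exact: admissible_sub xa tT.
pose F tau := ell (t - tau) *: u tau; pose W tau := rho * `|ell (t - tau)|.
have iet : leb.-integrable `]0, t[ (EFin \o (fun tau => ell (t - tau))).
  by apply: integrable_reflect_itv; apply: (integrable_ell _ T) => //.
have iW : leb.-integrable `]0, t[ (EFin \o W).
  by apply: leb_integrableZ => //; exact: leb_integrable_norm.
have FE s n : s \in `]0, t[ -> coefO (F s) n = ell (t - s) * x s n.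
  by move=> st; rewrite coefZ//; apply: Hs_L2; apply: uH; exact: itv_oo_sub st.
have ix n := integrable_mem R lam lam_gt0 T ell iell mu x rho t n tT (mx n) xB.
have mF n : measurable_fun `]0, t[ (fun s => coefO (F s) n).
  apply: (@eq_measurable_fun _ _ R R _ (fun s => ell (t - s) * x s n)).
    by move=> s /set_mem st; rewrite FE.
  exact: integrable_measurable (ix n).
have FH s : s \in `]0, t[ -> Hs mu (F s).
  by move=> st; apply: HscaleZ => //; apply: uH; exact: itv_oo_sub st.
have FW s : s \in `]0, t[ -> nle mu (W s) (coefO (F s)).
  move=> st; rewrite /W mulrC.
  apply: norm_le_ext (norm_leM _ _ _ _ _ (fun=> ell (t - s)) _ _ _ (xB s st)) => //= n.
  by rewrite FE.
have [HI IE] := synthesis_nle _ _ (mem_bound R lam lam_gt0 T ell iell mu x rho t rho0 tT mx xB).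
have md : measurable `]0, t[%classic by exact: measurable_itv.
have doo := lebesgue_itv_lty R 0 t false true.
have B : is_bochner (Hs mu) (N mu) `]0, t[ F (mem u t).
  apply: (xgetPex (0 : V)); exists (syn (mem_path R ell x t)).
  apply: (is_bochner_coef R d Omega mO lam e lam_gt0 e_L2 e_on mu _ md doo F W) => // n.
  by rewrite IE; apply: eq_Rintegral => s /set_mem st; rewrite FE.
have [HM _ _] := B; split=> //; apply/funext => n.
rewrite (coef_bochner R d Omega mO lam e lam_gt0 e_L2 mu _ md doo F W _ n iW mF FH FW B)//.
by apply: eq_Rintegral => s /set_mem st; rewrite FE.
Qed.

(** The forward direction takes coefficients with [coef_bochner], the backward one rebuilds the
    integral with [is_bochner_coef]; both use the majorant [W], a multiple of (t - tau)^{-1/2}. *)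
Lemma mild_bochnerP (u : R -> V) (rho : R) (xi : V) (t : R) : 0 < rho ->
  (forall t, t \in `[0, T] -> Hs mu (u t)) ->
  adm rho u -> Hs mu xi -> t \in `[0, T] ->
  is_bochner (Hs mu) (N mu) `]0, t[
    (fun tau => res (t - tau)
       (dcoef e (f (u tau) (mem u tau))))
    (u t - res t (coefO xi)) <->
  coefO (u t) =1 picard R w ell Phi (coefO xi) (fun t => coefO (u t)) t.
Proof.
move=> rho0 uH xa xiH tT'; pose x t := coefO (u t).
move: (tT'); rewrite in_itv /= => /andP[t0 tT].
have [rho' rho'0 hrho] := mem_radius R T ell rho rho0.
pose G := (Lf rho + Kf rho' * ell_norm R T ell) * rho.
pose g := forcing R ell Phi x.
have gB s : s \in `]0, t[ -> nle (- theta) G (g s).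
  exact: (forcing_sub R lam lam_gt0 mu theta T ell iell Phi Lf Kf coef_forcing0 coef_forcing_lip
    rho rho' rho0 rho'0 hrho x s t xa tT).
have mg n : measurable_fun `]0, t[ (g ^~ n).
  exact: (forcing_measurable R lam lam_gt0 mu theta T ell iell Phi Lf Kf Lf_ge0 Kf_ge0 coef_forcing_lip
    rho rho' rho0 rho'0 hrho x n t xa tT).
have dE s : s \in `]0, t[ -> dcoef e (f (u s) (mem u s)) = g s.
  move=> st; have sT := itv_oo_sub _ _ tT st.
  have [HM ME] := memoryP u rho s uH xa sT.
  by rewrite (funext (dcoef_forcing _ _ (uH s sT) HM)) ME.
pose F tau := res (t - tau) (dcoef e (f (u tau) (mem u tau))).
pose W tau := G * (t - tau) `^ (- 2^-1).
have iW : leb.-integrable `]0, t[ (EFin \o W).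
  apply: leb_integrableZ => //.
  exact: (integrable_reflect_itv _ _ (fun s => s `^ (- 2^-1)) (integrable_powR_half R t)).
have FP s : s \in `]0, t[ -> [/\ Hs mu (F s), coefO (F s) =1 (fun n => w n (t - s) * g s n) &
    nle mu (W s) (fun n => w n (t - s) * g s n)].
  move=> st; have ts : 0 < t - s by move: st; rewrite in_itv /=; lra.
  have h : nle mu (W s) (fun n => w n (t - s) * g s n).
    by rewrite /W mulrC; apply: resolvent_smoothing => //; exact: gB.
  by have [H E] := synthesis_nle _ _ h; rewrite /F dE.
have FH s : s \in `]0, t[ -> Hs mu (F s) by move=> /FP[].
have FW s : s \in `]0, t[ -> nle mu (W s) (coefO (F s)).
  by move=> /FP[_ E]; apply: norm_le_ext => n; rewrite E.
have mF n : measurable_fun `]0, t[ (fun s => coefO (F s) n).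
  apply: (@eq_measurable_fun _ _ R R _ (fun s => omega m (lam n) (t - s) * g s n)).
    by move=> s /set_mem /FP[_ -> _].
  apply: measurable_funM => //.
  by apply: (measurable_fun_reflect_itv _ _ (w n)); exact: measurable_omega.
have IE n : \int[leb]_(s in `]0, t[) coefO (F s) n = duhamel R w g t n.
  by apply: eq_Rintegral => s /set_mem /FP[_ -> _].
have [xiL [B xiB]] := (HscaleP _ _ _ _ _ _ _).1 xiH.
have [RH RE] : Hs mu (res t (coefO xi)) /\
    coefO (res t (coefO xi)) =1 semigroup R w (coefO xi) t.
  apply: (synthesis_nle (1 * B)); apply: norm_leM => // n; exact: omega_norm_le1.
have cE n : coefO (u t - res t (coefO xi)) n =
    coefO (u t) n - semigroup R w (coefO xi) t n.
  by rewrite coefB ?RE//; [apply: Hs_L2; exact: uH|exact: Hs_L2 RH].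
have md : measurable `]0, t[%classic by exact: measurable_itv.
have doo := lebesgue_itv_lty R 0 t false true.
split=> [B1 n|E].
  have := coef_bochner R d Omega mO lam e lam_gt0 e_L2 mu _ md doo F W _ n iW mF FH FW B1.
  by rewrite cE IE /picard => /eqP; rewrite subr_eq addrC => /eqP.
apply: (is_bochner_coef R d Omega mO lam e lam_gt0 e_L2 e_on mu _ md doo F W _ iW mF FH FW).
  exact: (HscaleB _ _ _ mO _ _ lam_gt0 e_L2 _ _ _ (uH t tT') RH).
by move=> n; rewrite cE IE E /picard addrC addKr.
Qed.

Lemma mild_solutionP (u : R -> V) (xi : V) : Hs mu xi -> Hcontinuous Omega lam e mu T u ->
  mild xi u <->
  solution R w T ell Phi (coefO xi) (fun t => coefO (u t)).
Proof.
move=> xiH uC; have [rho rho0 xa] := Hcontinuous_admissible u uC.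
split=> [[_ h] t tT|h].
  exact: ((mild_bochnerP u rho xi t rho0 uC.1 xa xiH tT).1 (h t tT)).
split=> [|t tT]; first exact: uC.
exact: ((mild_bochnerP u rho xi t rho0 uC.1 xa xiH tT).2 (h t tT)).
Qed.

Let wc n := omega_cont R m hm (lam n) (lam_gt0 n).
Let w0 n t := omega_ge0 R m hm (lam n) t (lam_gt0 n).
Let wn n s t := omega_noninc R m hm (lam n) s t (lam_gt0 n).
Let w1 n t := omega_le1 R m hm (lam n) t (lam_gt0 n).
Let wa n t := omega_antitone R m hm (lam n) (lam 0%N) t (lam_gt0 0%N) (lam_ge n).
Let wi n t := omega_int_le R m hm (lam n) t (lam_gt0 n).
Let wd n t h := omega_diff_le R m hm hmdec (lam n) t h (lam_gt0 n).

Lemma mild_exists (rho rho' : R) (xi : V) : 0 < rho -> 0 < rho' ->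
  ell_norm R T ell * rho <= rho' ->
  let q := (Num.sqrt (lam 0%N))^-1 * (Lf rho + Kf rho' * ell_norm R T ell) in
  q < 1 -> Hs mu xi -> nle mu ((1 - q) * rho) (coefO xi) ->
  exists u, mild xi u.
Proof.
move=> rho0 rho'0 hrho q q1 xiH xiB.
have [|x [xc xB] xs] := picard_exists R lam lam_gt0 w wc w0 wn w1 wa wi wd mu theta mutheta T T_gt0
  ell iell Phi Lf Kf coef_forcing0 Lf_ge0 Kf_ge0 coef_forcing_lip rho ((1 - q) * rho) (coefO xi) rho0 _ xiB.
  by exists rho' => //; split=> //; split=> //; rewrite -/q -mulrDl subrK mul1r.
pose u t := syn (x t).
have uP t : t \in `[0, T] -> Hs mu (u t) /\ coefO (u t) =1 x t by move=> /xB; exact: synthesis_nle.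
have uC : Hcontinuous Omega lam e mu T u.
  apply: path_cont_Hcontinuous => [t /uP[]//|t0 t0T eps e0].
  have [del d0 hd] := xc t0 t0T eps e0; exists del => // t tT tt0.
  apply: norm_le_ext (hd t tT tt0) => n.
  by rewrite (uP t tT).2 (uP t0 t0T).2.
exists u; apply: (mild_solutionP u xi xiH uC).2 => t tT n; rewrite (uP t tT).2 (xs t tT n).
by apply: (picard_ext _ _ T _ _ _ _ _ _ _ tT) => s sT k; rewrite (uP s sT).2.
Qed.

(** Any mild solution is continuous on a compact interval, hence bounded; the larger of the two
    bounds is a common radius, so competitors may leave the ball of the contraction argument. *)
Lemma mild_unique (u v : R -> V) (xi : V) : Hs mu xi ->
  mild xi u -> mild xi v ->
  forall t, t \in `[0, T] -> N mu (u t - v t)%R = 0%E.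
Proof.
move=> xiH hu hv t tT; have [uC _] := hu; have [vC _] := hv.
have [r1 r10 ua] := Hcontinuous_admissible u uC.
have [r2 r20 va] := Hcontinuous_admissible v vC.
have r0 : 0 < Num.max r1 r2 by rewrite lt_max r10.
have ua' : adm (Num.max r1 r2) u.
  by apply: admissible_weaken ua; rewrite le_max lexx.
have va' : adm (Num.max r1 r2) v.
  by apply: admissible_weaken va; rewrite le_max lexx orbT.
have E : coefO (u t) =1 coefO (v t).
  exact: (solution_unique R lam lam_gt0 w wc w0 w1 wi mu theta mutheta T T_gt0 ell iell Phi Lf Kf
    coef_forcing0 Lf_ge0 Kf_ge0 coef_forcing_lip (Num.max r1 r2) (coefO xi)
    (fun t => coefO (u t)) (fun t => coefO (v t)) r0 ua' va'
    ((mild_solutionP u xi xiH uC).1 hu) ((mild_solutionP v xi xiH vC).1 hv) t tT).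
apply/le_anti; rewrite wnorm_ge0 andbT; apply/wnorm_leP => //.
apply: norm_le_ext (norm_le_diff0 _ _ _ _ _ _ (lexx 0) E) => n.
by rewrite (coefB_Hs mu)//; [exact: uC.1 t tT|exact: vC.1 t tT].
Qed.

(** The exponent is 1/4: the factor (t / h)^{1/4} in the quotient cancels the bound (h / t)^{1/4} of
    [solution_holder]. *)
Lemma mild_holder (u : R -> V) (xi : V) : Hs mu xi ->
  mild xi u -> holder_continuous Omega lam e mu T u.
Proof.
move=> xiH hu; have [uC _] := hu; have [rho rho0 ua] := Hcontinuous_admissible u uC.
have [_ [B xiB]] := (HscaleP _ _ _ _ _ _ _).1 xiH.
have [C C0 hC] := solution_holder R lam lam_gt0 w wc w0 wn w1 wi wd mu theta mutheta T T_gt0 ell iell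
  Phi Lf Kf coef_forcing0 Lf_ge0 Kf_ge0 coef_forcing_lip rho (coefO xi) B _ rho0 ua
  ((mild_solutionP u xi xiH uC).1 hu) xiB.
have root4 (x : R) : 0 <= x -> x `^ 4^-1 = Num.sqrt (Num.sqrt x).
  move=> x0; rewrite -!powR12_sqrt ?powR_ge0// -powRrM; congr (_ `^ _); lra.
exists 4^-1; first by apply/andP; split; lra.
apply: (@le_lt_trans _ _ C%:E); last exact: ltry.
apply: ub_ereal_sup => _ [t [h [h0 t0 th ->]]].
have tT : t \in `[0, T] by rewrite in_itv /=; lra.
have thT : t + h \in `[0, T] by rewrite in_itv /=; lra.
have tht : t + h <= T by lra.
have Nle : (N mu (u (t + h) - u t)%R <= (C * Num.sqrt (Num.sqrt (h / t)))%:E)%E.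
  apply/wnorm_leP; first by rewrite mulr_ge0// sqrtr_ge0.
  apply: norm_le_ext (hC t h t0 h0 tht) => n.
  by rewrite (coefB_Hs mu)//; [exact: uC.1 _ thT|exact: uC.1 _ tT].
have c0 : 0 <= t `^ 4^-1 / h `^ 4^-1 by rewrite divr_ge0 ?powR_ge0.
apply: (@le_trans _ _ ((t `^ 4^-1 / h `^ 4^-1)%:E * (C * Num.sqrt (Num.sqrt (h / t)))%:E)%E).
  by apply: lee_wpmul2l.
rewrite -EFinM lee_fin !root4 ?(ltW t0) ?(ltW h0)//.
have E : Num.sqrt (Num.sqrt t) * Num.sqrt (Num.sqrt (h / t)) = Num.sqrt (Num.sqrt h).
  rewrite -sqrtrM ?sqrtr_ge0// -sqrtrM ?(ltW t0)// mulrCA divff ?mulr1//.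
  by rewrite gt_eqF.
have h4 : 0 < Num.sqrt (Num.sqrt h) by rewrite !sqrtr_gt0.
by rewrite mulrCA mulrAC E divff ?mulr1// gt_eqF.
Qed.

Lemma mild_well_posed (rho rho' : R) : 0 < rho -> 0 < rho' -> ell_norm R T ell * rho <= rho' ->
  let q := (Num.sqrt (lam 0%N))^-1 * (Lf rho + Kf rho' * ell_norm R T ell) in
  q < 1 -> forall xi, Hs mu xi -> nle mu ((1 - q) * rho) (coefO xi) ->
  exists u, [/\ mild xi u,
    forall v, mild xi v -> forall t, t \in `[0, T] -> N mu (u t - v t)%R = 0%E &
    holder_continuous Omega lam e mu T u].
Proof.
move=> r0 r'0 hr q q1 xi xiH xiB; have [u hu] := mild_exists rho rho' xi r0 r'0 hr q1 xiH xiB.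
exists u; split; [exact: hu|move=> v hv; exact: mild_unique hu hv|exact: mild_holder hu].
Qed.

End mild.

(** * Choice of the radii and conclusion *)

Lemma limsup_right_le (R : realType) (L : R -> R) (l eps : R) :
  limf_esup (EFin \o L) (0 : R)^'+ = l%:E -> 0 < eps ->
  exists2 del : R, 0 < del & forall rho, 0 < rho -> rho < del -> L rho <= l + eps.
Proof.
move=> Ll e0; have : (limf_esup (EFin \o L) (0 : R)^'+ < (l + eps)%:E)%E.
  by rewrite Ll lte_fin ltrDl.
move=> /ereal_inf_lt[_ [A hA <-]] hlt.
have [del /= d0 hd] := hA; exists del => // rho rho0 rhod.
rewrite -lee_fin; apply: le_trans (ltW hlt); apply: ereal_sup_ubound; exists rho => //.
by apply: hd => //=; rewrite sub0r normrN gtr0_norm.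
Qed.

(** From (L + K l)^2 <= 4 (L^2 + K^2 l^2) < lam0 one gets L + K l < Num.sqrt lam0, a strict
    inequality that persists for [Lf] and [Kf] at small radii. *)
Lemma contraction_radius (R : realType) (Lf Kf : R -> R) (L K l lam0 : R) : 0 <= l -> 0 < lam0 ->
  limf_esup (EFin \o Lf) (0 : R)^'+ = L%:E -> limf_esup (EFin \o Kf) (0 : R)^'+ = K%:E ->
  4 * (L ^+ 2 + K ^+ 2 * l ^+ 2) < lam0 ->
  exists rho rho', [/\ 0 < rho, 0 < rho', l * rho <= rho' &
    (Num.sqrt lam0)^-1 * (Lf rho + Kf rho' * l) < 1].
Proof.
move=> l0 lam00 hL hK hs.
have s0 : 0 < Num.sqrt lam0 by rewrite sqrtr_gt0.
have LKs : L + K * l < Num.sqrt lam0.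
  apply: le_lt_trans (ler_norm _) _; rewrite -sqrtr_sqr ltr_sqrt//.
  apply: le_lt_trans hs; have := sqr_ge0 (L - K * l); have := sqr_ge0 L; have := sqr_ge0 (K * l).
  by rewrite sqrrB sqrrD exprMn; move: (L ^+ 2) (K ^+ 2 * l ^+ 2) (L * (K * l)) => a b c; lra.
have l1 : 0 < l + 1 by rewrite ltr_wpDl.
(* The perturbation (L + eps) + (K + eps) l adds eps (l + 1) to L + K l, which is half of the
   available gap. *)
pose eps := (Num.sqrt lam0 - (L + K * l)) / 2 / (l + 1).
have e0 : 0 < eps by rewrite !divr_gt0// subr_gt0.
have [d1 d10 h1] := limsup_right_le R Lf L eps hL e0.
have [d2 d20 h2] := limsup_right_le R Kf K eps hK e0.
(* The memory radius is fixed by [Kf]; [rho] is then shrunk so that the memory of a path in the ball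
   stays within it. The denominator l + 1 allows l = 0. *)
pose rho' := d2 / 2; pose rho := Num.min (d1 / 2) (rho' / (l + 1)).
have rho'0 : 0 < rho' by rewrite divr_gt0.
have rho0 : 0 < rho by rewrite lt_min !divr_gt0.
have rhod : rho < d1.
  by apply: (@le_lt_trans _ _ (d1 / 2)); [rewrite ge_min lexx|rewrite ltr_pdivrMr// ltr_pMr// ltr1n].
have rho'd : rho' < d2 by rewrite ltr_pdivrMr// ltr_pMr// ltr1n.
exists rho, rho'; split => //.
  apply: (@le_trans _ _ (l * (rho' / (l + 1)))); first by rewrite ler_wpM2l// ge_min lexx orbT.
  by rewrite mulrCA ler_piMr ?(ltW rho'0)// ler_pdivrMr// mul1r lerDl.
rewrite ltr_pdivrMl// mulr1.
apply: (@le_lt_trans _ _ ((L + eps) + (K + eps) * l)).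
  by rewrite lerD ?h1// ler_wpM2r ?h2.
have -> : (L + eps) + (K + eps) * l = L + K * l + eps * (l + 1) by ring.
have -> : eps * (l + 1) = (Num.sqrt lam0 - (L + K * l)) / 2 by rewrite /eps divfK// gt_eqF.
by move: LKs; move: (Num.sqrt lam0) (L + K * l) => a b; lra.
Qed.

Theorem theorem3p4 (R : realType) (d : nat) (hd : (0 < d)%N)
  (Omega : set 'rV[R]_d) (hOmega : bounded_smooth_domain Omega)
  (lambda : nat -> R) (e : nat -> 'rV[R]_d -> R)
  (he : dirichlet_eigenbasis Omega lambda e)
  (T : R) (hT : 0 < T)
  (ell : R -> R)
  (hell : (@lebesgue_measure R).-integrable `]0, T[ (EFin \o ell))
  (m : R -> R) (hm : kernel_assumption m)
  (hmdec : forall s t : R, 0 < s -> s <= t -> m t <= m s)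
  (mu theta : R) (hmu0 : 0 < mu) (hmu2 : mu < 2)
  (htheta : theta = 1 - mu) (htheta0 : 0 < theta)
  (f : ('rV[R]_d -> R) -> ('rV[R]_d -> R) -> ('rV[R]_d -> R) -> R)
  (hf : forall v w, Hscale Omega lambda e mu v -> Hscale Omega lambda e mu w ->
    Hdual Omega lambda e theta (f v w))
  (hf0 : forall phi, Hscale Omega lambda e theta phi -> f 0 0 phi = 0)
  (Lf Kf : R -> R)
  (hLf : forall rho : R, 0 < rho -> 0 <= Lf rho)
  (hKf : forall rho : R, 0 < rho -> 0 <= Kf rho)
  (hLip : forall rho rho' : R, 0 < rho -> 0 < rho' ->
    forall v1 v2 w1 w2,
      Hscale Omega lambda e mu v1 -> Hscale Omega lambda e mu v2 ->
      Hscale Omega lambda e mu w1 -> Hscale Omega lambda e mu w2 ->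
      (Hnorm Omega lambda e mu v1 <= rho%:E)%E ->
      (Hnorm Omega lambda e mu v2 <= rho%:E)%E ->
      (Hnorm Omega lambda e mu w1 <= rho'%:E)%E ->
      (Hnorm Omega lambda e mu w2 <= rho'%:E)%E ->
      (Hdual_norm lambda e theta (f v1 w1 - f v2 w2)%R
       <= (Lf rho)%:E * Hnorm Omega lambda e mu (v1 - v2)%R
          + (Kf rho')%:E * Hnorm Omega lambda e mu (w1 - w2)%R)%E)
  (Lstar Kstar : R)
  (hLstar : limf_esup (EFin \o Lf) (0 : R)^'+ = Lstar%:E)
  (hKstar : limf_esup (EFin \o Kf) (0 : R)^'+ = Kstar%:E)
  (hsmall : 4 * (Lstar ^+ 2 + Kstar ^+ 2 *
      (\int[@lebesgue_measure R]_(t in `]0, T[) `|ell t|) ^+ 2) < lambda 0%N) :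
  exists2 eta : R, 0 < eta &
    forall xi, Hscale Omega lambda e mu xi ->
      (Hnorm Omega lambda e mu xi <= eta%:E)%E ->
      exists u : R -> 'rV[R]_d -> R,
        [/\ mild_solution Omega lambda e m ell mu T f xi u,
            forall v, mild_solution Omega lambda e m ell mu T f xi v ->
              forall t : R, t \in `[0, T] ->
                Hnorm Omega lambda e mu (u t - v t) = 0%E &
            holder_continuous Omega lambda e mu T u].
Proof.
have [[e_L2 e_on _] _ lam_gt0 lam_homo] := he.
have [oO _ _ _ _] := hOmega.
have mO : measurable Omega by exact: open_measurable_rV.
have lam_ge n : lambda 0%N <= lambda n by exact: lam_homo.
have mutheta : mu = 1 - theta by rewrite htheta subKr.
have l0 : 0 <= ell_norm R T ell by exact: ell_norm_ge0.
have [rho [rho' [rho0 rho'0 hrho q1]]] :=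
  contraction_radius R Lf Kf Lstar Kstar (ell_norm R T ell) (lambda 0%N) l0 (lam_gt0 0%N) hLstar hKstar hsmall.
set q := _ * _ in q1.
(* The Picard map sends the ball of radius [rho] into that of radius eta + q rho; this is the
   largest eta for which the latter is at most [rho]. *)
exists ((1 - q) * rho); first by rewrite mulr_gt0// subr_gt0.
move=> xi xiH xiB.
have eta0 : 0 <= (1 - q) * rho by rewrite mulr_ge0 ?subr_ge0 ?(ltW q1) ?(ltW rho0).
exact: (mild_well_posed R d Omega mO lambda e lam_gt0 lam_ge e_L2 e_on m hm hmdec mu theta hmu0
  mutheta T hT ell hell f Lf Kf hf0 hLf hKf hLip rho rho' rho0 rho'0 hrho q1 xi xiH
  ((wnorm_leP _ _ _ _ _ eta0).1 xiB)).
Qed.
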